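(* Let $\omega$ be a concave weight function. Then both rings ${}_1\mathcal{E}^{\{\omega\}}$ and ${}_1\mathcal{E}^{(\omega)}$ have property $(\mathscr{D})$.
   Context: A weight function is a continuous increasing $\omega:[0,\infty)\to[0,\infty)$ with $\omega(2t)=O(\omega(t))$, $\omega(t)=o(t)$, $\log t=o(\omega(t))$ as $t\to\infty$, and such that $\varphi_\omega(t):=\omega(e^t)$ is convex on $[0,\infty)$. Let $\varphi_\omega^*(s):=\sup_{t\ge0}(st-\varphi_\omega(t))$. For open $U\subseteq\mathbb{R}^d$ and $\rho>0$, $\mathcal{B}^\omega_\rho(U)$ is the set of $f\in C^\infty(U)$ with $\sup_{x\in U,\alpha\in\mathbb{N}^d}|\partial^\alpha f(x)|e^{-\varphi_\omega^*(\rho|\alpha|)/\rho}<\infty$. $\mathcal{E}^{\{\omega\}}(U)$ is the set of $f\in C^\infty(U)$ such that for every relatively compact open $V\subseteq U$ there is $n\in\mathbb{N}_{\ge1}$ with $f|_V\in\mathcal{B}^\omega_n(V)$; $\mathcal{E}^{(\omega)}(U)$ is the set of $f$ with $f|_V\in\mathcal{B}^\omega_{1/n}(V)$ for all such $V$ and all $n\ge1$. ${}_d\mathcal{E}^{\{\omega\}}$ (resp. ${}_d\mathcal{E}^{(\omega)}$) is the ring of germs at $0\in\mathbb{R}^d$ of complex valued functions of class $\mathcal{E}^{\{\omega\}}$ (resp. $\mathcal{E}^{(\omega)}$). A subring $\mathcal{S}$ of the ring of germs at $0\in\mathbb{R}^d$ of complex valued $C^\infty$ functions has property $(\mathscr{D})$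 if for every complex valued function germ $f$ at $0$: if $f^j,f^{j+1}\in\mathcal{S}$ for some integer $j\ge1$, then $f\in\mathcal{S}$. *)

(* Defs.v *)
From Stdlib Require Import Reals Lra.
From Coquelicot Require Import Coquelicot.
Open Scope R_scope.

(** * Weight functions (Braun--Meise--Taylor), given as total functions R -> R
      of which only the restriction to [0, +oo) matters. *)

Definition phi_w (w : R -> R) (t : R) : R := w (exp t).

Definition weight_function (w : R -> R) : Prop :=
  (forall t, 0 <= t -> 0 <= w t) /\
  (forall t, 0 <= t -> forall eps, 0 < eps -> exists delta, 0 < delta /\
      forall s, 0 <= s -> Rabs (s - t) < delta -> Rabs (w s - w t) < eps) /\
  (forall s t, 0 <= s -> s <= t -> w s <= w t) /\
  (exists C T, forall t, T <= t -> Rabs (w (2 * t)) <= C * Rabs (w t)) /\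
  (forall eps, 0 < eps -> exists T, forall t, T <= t -> Rabs (w t) <= eps * Rabs t) /\
  (forall eps, 0 < eps -> exists T, forall t, T <= t -> Rabs (ln t) <= eps * Rabs (w t)) /\
  (forall s t l, 0 <= s -> 0 <= t -> 0 <= l <= 1 ->
      phi_w w (l * s + (1 - l) * t) <= l * phi_w w s + (1 - l) * phi_w w t).

Definition concave_nonneg (w : R -> R) : Prop :=
  forall s t l, 0 <= s -> 0 <= t -> 0 <= l <= 1 ->
    l * w s + (1 - l) * w t <= w (l * s + (1 - l) * t).

(** Young conjugate phi_w^*(s) = sup_{t >= 0} (s t - phi_w(t)) (a real number
    for s >= 0, which is the only case used). *)
Definition phi_star (w : R -> R) (s : R) : R :=
  real (Lub_Rbar (fun y => exists t, 0 <= t /\ y = s * t - phi_w w t)).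

Definition derivs_on (U : R -> Prop) (f : R -> C) (g : nat -> R -> C) : Prop :=
  (forall x, U x -> g O x = f x) /\
  (forall n x, U x -> is_derive (g n) x (g (S n) x)).

Definition smooth_on (U : R -> Prop) (f : R -> C) : Prop :=
  exists g, derivs_on U f g.

(** f|_U belongs to B^w_rho(U) (d = 1, so multi-indices are natural numbers) *)
Definition in_B (w : R -> R) (rho : R) (U : R -> Prop) (f : R -> C) : Prop :=
  exists g, derivs_on U f g /\
    exists M, forall x n, U x ->
      Cmod (g n x) * exp (- phi_star w (rho * INR n) / rho) <= M.

Definition relcomp_open_in (V U : R -> Prop) : Prop :=
  open_set V /\ compact (adherence V) /\ included (adherence V) U.

Definition E_roum (w : R -> R) (U : R -> Prop) (f : R -> C) : Prop :=
  smooth_on U f /\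
  forall V, relcomp_open_in V U -> exists n : nat, (1 <= n)%nat /\ in_B w (INR n) V f.

Definition E_beur (w : R -> R) (U : R -> Prop) (f : R -> C) : Prop :=
  smooth_on U f /\
  forall V, relcomp_open_in V U -> forall n : nat, (1 <= n)%nat -> in_B w (/ INR n) V f.

Definition germ_roum (w : R -> R) (f : R -> C) : Prop :=
  exists U, open_set U /\ U 0 /\ E_roum w U f.

Definition germ_beur (w : R -> R) (f : R -> C) : Prop :=
  exists U, open_set U /\ U 0 /\ E_beur w U f.

(** Property (D) for a germ-invariant class P of complex function germs at 0 *)
Definition propD (P : (R -> C) -> Prop) : Prop :=
  forall (f : R -> C) (j : nat), (1 <= j)%nat ->
    P (fun x => Cpow (f x) j) -> P (fun x => Cpow (f x) (S j)) -> P f.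

(* Main.v *)
(** Write [g = f ^ j], [h = f ^ (j + 1)].  For every small slope [s] let [t] be a
    point at which a line of slope [s] touches [w] from above.  By concavity of [w]
    and convexity of [phi_w], at the scale [eps ~ s / rho] the Taylor polynomials
    [p], [q] of [g], [h] have bounded coefficients, degree at most a small multiple
    of [w t / rho] and error [exp (- c w t / rho)].  So [q ^ j - p ^ (j + 1)] is tiny, and the point is
    to show that [p] is then close to the [j]-th power of a function [F]
    holomorphic in a disc.  After subtracting from [p] a small constant [u]
    whose fibre is regular (a pigeonhole argument), the polynomial interpolating [q] at
    the roots of [p - u] in the disc is small because [|q| ~ |p| ^ (1 + 1/j)]
    there; subtracting it makes [q] divisible by [p - u] in the disc, and the
    quotient [F] satisfies [F ^ j ~ p], hence approximates [f].  These
    approximations, taken at the scales [eps / 2 ^ k] around every real point,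
    differ by exponentially small amounts; summing the differences gives the
    derivatives of [f] and their bounds, with [rho] multiplied by a constant that
    depends only on [j], which settles both classes at once. *)

Require Import Defs.
From Stdlib Require Import Reals Lra Lia Classical Factorial ClassicalEpsilon.
From Coquelicot Require Import Coquelicot.
From mathcomp Require all_boot all_order all_algebra cyclic separable cyclotomic complex.
From mathcomp Require lra ring Rstruct.
Open Scope R_scope.

(** Where [f ^ j] has no zeros, [f] is the quotient of [f ^ (j + 1)] by it; the difficulty is a
    bound that survives the zeros. Every polynomial estimate below (extrapolation from a real
    interval, interpolation at roots) costs a factor [B ^ D], where [D] is the degree and [B]
    depends only on [j]. The length [eps = exp (- 1 / theta) * s / rho] is chosen so that
    [D <= theta * E] with [E = w t / (2 * rho)] while the Taylor error stays of order [exp (- E)]: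
    for small [theta] the factor [B ^ D] is a small power of [exp E], and an error [exp (- c * E)]
    remains. The fibre must be regular because the Lagrange denominators at the roots [x i] of
    [Q = p - u] in the disc equal [Q' (x i) / G (x i)], where [G] is the cofactor without roots in
    the disc. A lower bound on [Q'] is what prevents these roots from clustering. *)

Module PolynomialRoots.
Import boot.all_boot order.all_order algebra.all_algebra.
Import cyclic separable cyclotomic complex.
Import mathcomp.algebra_tactics.lra mathcomp.algebra_tactics.ring Rstruct.
Set Implicit Arguments. Unset Strict Implicit. Unset Printing Implicit Defensive.
Import Order.TTheory GRing.Theory Num.Theory.

Module CC := Coquelicot.Complex.

(** A polynomial with [m] coefficients in the complex type of Coquelicot: the common language of the
    algebraic and the analytic part. *)
Fixpoint psum (c : nat -> CC.C) (x : R) (m : nat) : CC.C :=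
  match m with O => CC.RtoC 0%R | S k => CC.Cplus (psum c x k) (CC.Cmult (c k) (CC.RtoC (pow x k))) end.

Local Open Scope ring_scope.

(** * Complex polynomials: interpolation and coefficient estimates *)

Section ComplexModulus.
Variable R : archiRcfType.
Local Notation C := R[i].

(** The modulus as an element of [R]; the generic norm on [R[i]] takes its values in [R[i]]
    itself. *)
Definition cnorm (z : C) : R := Normc.normc z.

Lemma cnorm_ge0 z : 0 <= cnorm z.
Proof. by case: z => a b; exact: sqrtr_ge0. Qed.

Lemma cnormM y z : cnorm (y * z) = cnorm y * cnorm z.
Proof. exact: Normc.normcM. Qed.

Lemma cnormV z : cnorm z^-1 = (cnorm z)^-1.
Proof. exact: Normc.normcV. Qed.

Lemma cnormD y z : cnorm (y + z) <= cnorm y + cnorm z.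
Proof. exact: le_normcD. Qed.

Lemma cnormN z : cnorm (- z) = cnorm z.
Proof. exact: normcN. Qed.

Lemma cnormB y z : cnorm (y - z) <= cnorm y + cnorm z.
Proof. by rewrite -(cnormN z) cnormD. Qed.

Lemma cnorm0 : cnorm 0 = 0.
Proof. exact: Normc.normc0. Qed.

Lemma cnorm1 : cnorm 1 = 1.
Proof. exact: Normc.normc1. Qed.

Lemma cnorm_eq0 z : (cnorm z == 0) = (z == 0).
Proof. by apply/eqP/eqP => [/Normc.eq0_normc//|->]; rewrite ?cnorm0. Qed.

Lemma cnorm_gt0 z : (0 < cnorm z) = (z != 0).
Proof. by rewrite lt_def cnorm_ge0 cnorm_eq0 andbT. Qed.

Lemma cnormX z n : cnorm (z ^+ n) = cnorm z ^+ n.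
Proof. by elim: n => [|n IH]; rewrite ?expr0 ?cnorm1// !exprS cnormM IH. Qed.

Lemma cnorm_real (x : R) : cnorm x%:C%C = `|x|.
Proof. by rewrite /cnorm /= expr0n /= addr0 sqrtr_sqr. Qed.

Lemma cnorm_nat n : cnorm n%:R = n%:R.
Proof. by rewrite -(rmorph_nat (real_complex R)) cnorm_real normr_nat. Qed.

Lemma cnorm_sum I (r : seq I) (P : pred I) (F : I -> C) :
  cnorm (\sum_(i <- r | P i) F i) <= \sum_(i <- r | P i) cnorm (F i).
Proof.
elim/big_ind2: _ => [|x a y b ha hb|//]; first by rewrite cnorm0.
exact: le_trans (cnormD _ _) (lerD ha hb).
Qed.

Lemma cnorm_prod I (r : seq I) (P : pred I) (F : I -> C) :
  cnorm (\prod_(i <- r | P i) F i) = \prod_(i <- r | P i) cnorm (F i).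
Proof. by apply: (big_morph cnorm cnormM cnorm1). Qed.

Lemma cnorm_dist y z : cnorm (y - z) = cnorm (z - y).
Proof. by rewrite -cnormN opprB. Qed.

Lemma cnorm_leD y z a b : cnorm y <= a -> cnorm z <= b -> cnorm (y + z) <= a + b.
Proof. by move=> h k; apply: le_trans (cnormD _ _) (lerD h k). Qed.

Lemma cnorm_leB y z a b : cnorm y <= a -> cnorm z <= b -> cnorm (y - z) <= a + b.
Proof. by move=> h k; apply: le_trans (cnormB _ _) (lerD h k). Qed.

Lemma cnorm_leM y z a b : cnorm y <= a -> cnorm z <= b -> cnorm (y * z) <= a * b.
Proof. by move=> h k; rewrite cnormM ler_pM ?cnorm_ge0. Qed.

Lemma cnorm_leX y a n : cnorm y <= a -> cnorm (y ^+ n) <= a ^+ n.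
Proof. by move=> h; rewrite cnormX lerXn2r // nnegrE ?cnorm_ge0 // (le_trans (cnorm_ge0 y)). Qed.

Lemma cnorm_geB y z : cnorm y - cnorm z <= cnorm (y - z).
Proof. by rewrite lerBlDr; have := cnormD (y - z) z; rewrite subrK. Qed.

Lemma lagrange_eval n (x : 'I_n -> C) (P : {poly C}) (z : C) :
  injective x -> (size P <= n)%N ->
  P.[z] = \sum_i P.[x i] * \prod_(l | l != i) ((z - x l) / (x i - x l)).
Proof.
move=> xI sP.
pose e i : {poly C} := \prod_(l | l != i) ((x i - x l)^-1 *: ('X - (x l)%:P)).
pose Q := P - \sum_i P.[x i] *: e i.
have ee i w : (e i).[w] = \prod_(l | l != i) ((w - x l) / (x i - x l)).
  by rewrite horner_prod; apply: eq_bigr => l _; rewrite hornerZ hornerXsubC mulrC.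
have exx i k : (e i).[x k] = (i == k)%:R.
  rewrite ee; case: eqP => [->|/eqP ne].
    by rewrite big1 // => l lk; rewrite divff // subr_eq0 (inj_eq xI) eq_sym.
  by rewrite (bigD1 k) /= ?subrr ?mul0r ?mul0r // eq_sym.
have se i : (size (e i) <= n)%N.
  apply: leq_trans (size_prod_leq _ _) _.
  rewrite leq_subLR (cardC1 i) card_ord.
  apply: leq_trans (_ : (n.-1 * 2).+1 <= _)%N; last first.
    by rewrite muln2 -addnn -addnS leq_add2l; case: (n) (i) => [[]|].
  rewrite ltnS -[n in n.-1]card_ord -(cardC1 i) -sum_nat_const.
  by apply: leq_sum => l _; apply: leq_trans (size_scale_leq _ _) _; rewrite size_XsubC.
have Q0 : Q = 0.
  apply/eqP; apply: contraT => Qn0.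
  have := @max_poly_roots _ Q [seq x i | i <- enum 'I_n] Qn0.
  rewrite size_map size_enum_ord.
  have -> : all (root Q) [seq x i | i <- enum 'I_n].
    apply/allP => _ /mapP [k _ ->]; rewrite /root /Q !hornerE horner_sum (bigD1 k) //=.
    rewrite hornerZ exx eqxx mulr1 big1 ?addr0 ?subrr // => i ik.
    by rewrite hornerZ exx (negPf ik) mulr0.
  rewrite (map_inj_uniq xI) enum_uniq => /(_ isT isT); rewrite ltnNge => /negP; case.
  rewrite (leq_trans (size_polyD _ _)) // geq_max sP size_polyN.
  apply: leq_trans (size_sum _ _ _) _; apply/bigmax_leqP => i _.
  exact: leq_trans (size_scale_leq _ _) _.
have : Q.[z] = 0 by rewrite Q0 horner0.
rewrite /Q !hornerE horner_sum => /eqP; rewrite subr_eq0 => /eqP ->.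
by apply: eq_bigr => i _; rewrite hornerZ ee.
Qed.

(** Each factor of [(2 m) (2 m - 1) ... (m + 1) = 'C(2 m, m) * m!] is at least [m], and the binomial
    is at most [2 ^ (2 m)]. *)
Lemma expnn_fact m : (m ^ m <= 4 ^ m * m`!)%N.
Proof.
have h : ('C(m + m, m) <= 4 ^ m)%N.
  have -> : (4 ^ m = 2 ^ (m + m))%N by rewrite addnn -mul2n expnM.
  have := expnDn 1 1 (m + m); rewrite addn1 => ->.
  have hm : (m < (m + m).+1)%N by rewrite ltnS leq_addr.
  by rewrite (bigD1 (Ordinal hm)) //= !exp1n !muln1 leq_addr.
apply: leq_trans (leq_mul h (leqnn _)); rewrite bin_ffact.
rewrite ffact_prod.
have -> : (m ^ m = \prod_(i < m) m)%N by rewrite prod_nat_const card_ord.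
by apply: leq_prod => i _; rewrite leq_subRL ?(ltnW (ltn_addr _ (ltn_ord i))) // leq_add2r ltnW.
Qed.

Lemma expnn_factR m : m%:R ^+ m <= 4 ^+ m * m`!%:R :> R.
Proof.
by have := expnn_fact m; rewrite -(ler_nat R) natrM !natrX.
Qed.

Lemma prod_dist_fact m (i : 'I_m.+1) :
  \prod_(l < m.+1 | l != i) `|i%:R - l%:R| = (i`! * (m - i)`!)%:R :> R.
Proof.
have split_prod : \prod_(l < m.+1 | l != i) `|i%:R - l%:R| =
  \prod_(0 <= l < i) `|i%:R - l%:R| * \prod_(i.+1 <= l < m.+1) `|i%:R - l%:R| :> R.
  rewrite (eq_bigl (fun l : 'I__ => (l : nat) != i)) //.
  rewrite -(big_mkord (fun l => l != i) (fun l => `|i%:R - l%:R : R|)).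
  rewrite (big_cat_nat (n := i)) ?(ltnW (ltn_ord i)) //=.
  congr (_ * _).
    by apply: congr_big_nat => // l /andP[_ li]; rewrite ltn_eqF.
  rewrite big_mkcond big_ltn // eqxx /= mul1r -big_mkcond.
  by apply: congr_big_nat => // l /andP[li _]; rewrite gtn_eqF.
rewrite split_prod natrM; congr (_ * _).
  rewrite fact_prod natr_prod big_nat_rev /= add0n big_add1 /=.
  apply: eq_big_nat => l /andP[_ li]; rewrite natrB // opprB addrC subrK.
  by rewrite normr_nat.
rewrite fact_prod natr_prod.
have -> : (i.+1 = 1 + i)%N by [].
rewrite big_addn subSn ?leq_ord //.
apply: eq_big_nat => l _; rewrite natrD opprD addrCA subrr addr0 normrN.
by rewrite normr_nat.
Qed.

(** Lagrange interpolation at [m + 1] equidistant nodes of the interval. The factors of the [i]-th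
    basis polynomial are at most [5 m / |i - l|], so it is bounded by [(5 m) ^ m / (i! (m - i)!) <=
    20 ^ m * 'C(m, i)]; summing the binomials gives [40 ^ m]. *)
Lemma extrapolate m (P : {poly C}) (c M : R) : (size P <= m.+1)%N ->
  (forall x : R, `|x - c| <= 1 -> cnorm P.[x%:C%C] <= M) ->
  forall z, cnorm (z - c%:C%C) <= 8 -> cnorm P.[z] <= 40 ^+ m * M.
Proof.
move=> sP hP z hz.
have M0 : 0 <= M by apply: le_trans (cnorm_ge0 _) (hP c _); rewrite subrr normr0.
(* Constants are treated apart, since the spacing of the nodes is [2 / m]. *)
case: m sP => [|m'] sP.
  rewrite expr0 mul1r; have := hP c; rewrite subrr normr0 => /(_ ler01).
  by rewrite (size1_polyC sP) !hornerC.
set m := m'.+1 in sP *.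
have m0 : 0 < m%:R :> R by rewrite ltr0n.
pose x (i : 'I_m.+1) : R := c - 1 + 2 * i%:R / m%:R.
have xB i l : x i - x l = 2 / m%:R * (i%:R - l%:R) by rewrite /x; field; lra.
have xI : injective (fun i => (x i)%:C%C).
  move=> i l /complexI/eqP; rewrite -subr_eq0 xB (mulf_eq0 (2 / _)) subr_eq0 eqr_nat.
  by rewrite gt_eqF ?divr_gt0 //= => /eqP/ord_inj.
have xc i : `|x i - c| <= 1.
  have h0 : 0 <= i%:R / m%:R :> R by rewrite divr_ge0.
  have h1 : i%:R / m%:R <= 1 :> R by rewrite ler_pdivrMr // mul1r ler_nat -ltnS.
  by rewrite ler_norml /x -mulrA; apply/andP; split; lra.
rewrite (lagrange_eval z xI sP).
apply: le_trans (cnorm_sum _ _ _) _.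
have term i : cnorm (P.[(x i)%:C%C] * \prod_(l | l != i)
    ((z - (x l)%:C%C) / ((x i)%:C%C - (x l)%:C%C))) <=
    M * ((20 ^+ m) * 'C(m, i)%:R).
  apply: cnorm_leM; first exact: hP.
  rewrite cnorm_prod.
  apply: le_trans (_ : \prod_(l | l != i) (5 * m%:R / `|i%:R - l%:R|) <= _).
    apply: ler_prod => l li; rewrite cnorm_ge0 /= cnormM cnormV -rmorphB cnorm_real xB.
    rewrite normrM invfM mulrA ger0_norm ?divr_ge0 //.
    have lin : 0 < `|i%:R - l%:R : R| by rewrite normr_gt0 subr_eq0 eqr_nat eq_sym.
    apply: ler_pM; rewrite ?mulr_ge0 ?invr_ge0 ?cnorm_ge0 ?divr_ge0 //.
    have : cnorm (z - (x l)%:C%C) <= 8 + 1.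
      rewrite -(subrK c%:C%C z) -addrA; apply: cnorm_leD => //.
      by rewrite cnorm_dist -rmorphB cnorm_real.
    move=> h; rewrite invf_div.
    apply: le_trans (ler_wpM2r _ h) _; first by rewrite divr_ge0.
    by rewrite mulrA; lra.
  rewrite big_split /= prodr_const (cardC1 i) card_ord /= prodfV prod_dist_fact.
  rewrite ler_pdivrMr ?ltr0n ?muln_gt0 ?fact_gt0 //.
  rewrite -mulrA -(natrM _ 'C(m, i)) bin_fact ?leq_ord // exprMn.
  have -> : 20 = 5 * 4 :> R by ring.
  rewrite (exprMn _ 5 4) -mulrA ler_wpM2l ?exprn_ge0 //.
  exact: expnn_factR.
apply: le_trans (ler_sum _ (fun i _ => term i)) _.
rewrite -mulr_sumr -mulr_sumr mulrC -natr_sum.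
have -> : (\sum_(i < m.+1) 'C(m, i) = 2 ^ m)%N.
  have := expnDn 1 1 m; rewrite addn1 => ->.
  by apply: eq_bigr => i _; rewrite !exp1n !muln1.
by rewrite natrX -exprMn (_ : 20 * 2 = 40); last ring.
Qed.

Lemma exists_prim_root n : (0 < n)%N -> exists w : C, n.-primitive_root w.
Proof.
move=> n0; have [r def] := closed_field_poly_normal ('X^n - 1 : {poly C}).
have mon : ('X^n - 1 : {poly C}) \is monic by rewrite monicXnsubC.
rewrite (monicP mon) scale1r in def.
have n_neq0 : n%:R != 0 :> C by rewrite pnatr_eq0 -lt0n.
have sep : separable_poly ('X^n - 1 : {poly C}) by rewrite -(polyC1 C) separable_Xn_sub_1.
have ur : uniq r by rewrite -separable_prod_XsubC -def.
have : has n.-primitive_root r.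
  apply: has_prim_root => //.
    by apply/allP => x xr; rewrite unity_rootE -subr_eq0; have := root_prod_XsubC r x;
      rewrite -def xr /root !hornerE.
  rewrite -ltnS -(size_prod_XsubC r id) -def size_XnsubC //.
by case/hasP => w _ hw; exists w.
Qed.
End ComplexModulus.

Section CoefficientBounds.
Variable R : archiRcfType.
Local Notation C := R[i].

(** A discrete Cauchy formula: the average of [P (w ^ l) * w ^ (- l k)] over the [n]-th roots of
    unity is exactly the [k]-th coefficient, because [n = size P] exceeds the degree and no aliasing
    occurs. *)
Lemma cauchy_estimate (P : {poly C}) (M : R) :
  (forall z, cnorm z <= 1 -> cnorm P.[z] <= M) -> forall k, cnorm P`_k <= M.
Proof.
move=> hP k; have M0 : 0 <= M by apply: le_trans (cnorm_ge0 _) (hP 0 _); rewrite cnorm0.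
have [/(nth_default 0) ->|kP] := leqP (size P) k; first by rewrite cnorm0.
set n := size P in kP; have n0 : (0 < n)%N by apply: leq_ltn_trans kP.
have [w hw] := exists_prim_root R n0.
have w0 : w != 0.
  by apply/eqP => w0; have := prim_expr_order hw; rewrite w0 expr0n gtn_eqF // => /eqP; rewrite eq_sym oner_eq0.
have wn : cnorm w = 1.
  have : cnorm w ^+ n == 1 by rewrite -cnormX (prim_expr_order hw) cnorm1.
  by rewrite pexprn_eq1 ?cnorm_ge0 // (gtn_eqF n0) => /eqP.
have wexp i : cnorm (w ^+ i) = 1 by rewrite cnormX wn expr1n.
have orth (i : 'I_n) : \sum_(l < n) w ^+ (l * i) * w ^- (l * k) = (i == k :> nat)%:R * n%:R.
  pose u := w ^+ i / w ^+ k.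
  have -> : \sum_(l < n) w ^+ (l * i) * w ^- (l * k) = \sum_(l < n) u ^+ l.
    apply: eq_bigr => l _; rewrite /u exprMn exprVn -!exprM.
    by rewrite (mulnC l i) (mulnC l k).
  have [ik|ik] := eqVneq (i : nat) k.
    rewrite mul1r (eq_bigr (fun=> 1)) ?sumr_const ?card_ord // => l _.
    by rewrite /u ik divff ?expf_neq0 // expr1n.
  rewrite mul0r; have u1 : u != 1.
    apply: contra ik => /eqP u1; have : w ^+ i == w ^+ k.
      by rewrite -[w ^+ i](divfK (expf_neq0 k w0)) -/u u1 mul1r.
    by rewrite (eq_prim_root_expr hw) !modn_small.
  have : u ^+ n - 1 = 0.
    by rewrite /u exprMn exprVn -!exprM !(mulnC _ n) !exprM (prim_expr_order hw) !expr1n divr1 subrr.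
  rewrite subrX1 => /eqP; rewrite mulf_eq0 subr_eq0 (negPf u1) /= => /eqP //.
have nn : n%:R != 0 :> C by rewrite pnatr_eq0 -lt0n.
have : P`_k * n%:R = \sum_(l < n) P.[w ^+ l] * w ^- (l * k).
  under eq_bigr => l _ do rewrite horner_coef mulr_suml.
  rewrite exchange_big /=.
  rewrite (eq_bigr (fun i : 'I_n => P`_i * ((i == k :> nat)%:R * n%:R))); last first.
    move=> i _; rewrite -orth mulr_sumr; apply: eq_bigr => l _.
    by rewrite -exprM mulrA.
  rewrite (bigD1 (Ordinal kP)) //= eqxx mul1r big1 ?addr0 // => i.
  by rewrite -val_eqE /= => /negPf ->; rewrite mul0r mulr0.
move=> /(congr1 (@cnorm R)); rewrite cnormM cnorm_nat => e.
have : cnorm P`_k * n%:R <= M * n%:R.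
  rewrite e; apply: le_trans (cnorm_sum _ _ _) _.
  apply: le_trans (ler_sum _ (_ : forall l, _ -> _ <= M)) _; last by rewrite sumr_const card_ord mulr_natr.
  move=> l _; rewrite cnormM cnormV wexp invr1 mulr1.
  by apply: hP; rewrite wexp.
by rewrite ler_pM2r // ltr0n.
Qed.

Lemma coef_bound_interval m (P : {poly C}) (M : R) : (size P <= m.+1)%N ->
  (forall x : R, `|x| <= 1 -> cnorm P.[x%:C%C] <= M) ->
  forall k, cnorm P`_k <= 40 ^+ m * M.
Proof.
move=> sP hP; apply: cauchy_estimate => z hz.
apply: (extrapolate (c := 0) sP) => [x|]; first by rewrite subr0; exact: hP.
by rewrite subr0; lra.
Qed.

Lemma geometric_poly_bound (P : {poly C}) (a b : R) : 0 <= b ->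
  (forall k, cnorm P`_k <= a * b ^+ k) ->
  forall z, b * cnorm z <= 2^-1 -> cnorm P.[z] <= 2 * a.
Proof.
move=> b0 hP z hz; rewrite horner_coef.
have a0 : 0 <= a by have := le_trans (cnorm_ge0 _) (hP 0); rewrite expr0 mulr1.
apply: le_trans (cnorm_sum _ _ _) _.
apply: le_trans (_ : \sum_(i < size P) a * 2^-1 ^+ i <= _).
  apply: ler_sum => i _; rewrite cnormM cnormX.
  apply: le_trans (ler_wpM2r _ (hP i)) _; first by rewrite exprn_ge0 ?cnorm_ge0.
  by rewrite -mulrA -exprMn ler_wpM2l // lerXn2r ?nnegrE ?mulr_ge0 ?invr_ge0 ?cnorm_ge0 //.
rewrite -mulr_sumr mulrC ler_wpM2r //.
have : 2^-1 ^+ size P - 1 = (2^-1 - 1) * \sum_(i < size P) 2^-1 ^+ i :> R.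
  exact: subrX1.
have : 0 <= 2^-1 ^+ size P :> R by rewrite exprn_ge0 ?invr_ge0.
lra.
Qed.

(** The binomials of the recentering turn the decay [16 ^ (- k)] into [8 ^ (- k)], which still sums
    geometrically for [|y| <= 2] and again for [|h| <= 4]; the resulting constant [2 * (2 / 64)] is
    below 1. *)
Lemma taylor_remainder (P : {poly C}) : (forall k, cnorm P`_k <= 16^-1 ^+ k) ->
  forall y h, cnorm y <= 2 -> cnorm h <= 4 ->
  cnorm (P.[y + h] - P.[y] - P^`().[y] * h) <= cnorm h ^+ 2.
Proof.
move=> hP y h hy hh.
rewrite (@nderiv_taylor_wide _ (size P).+2) ?(ltnW (leqnSn _)) //; last exact: mulrC.
rewrite !big_ord_recl /= nderivn0 nderivn1 expr0 mulr1 expr1.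
have -> x y0 (s : C) : x + (y0 + s) - x - y0 = s by ring.
pose A := \poly_(i < size P) P^`N(i.+2).[y].
have -> : \sum_(i < size P) P^`N(bump 0 (bump 0 i)).[y] * h ^+ bump 0 (bump 0 i)
    = A.[h] * h ^+ 2.
  rewrite /A horner_poly mulr_suml; apply: eq_bigr => i _.
  by rewrite /bump /= !add1n -mulrA -exprD addn2.
rewrite cnormM cnormX -[leRHS]mul1r ler_wpM2r ?exprn_ge0 ?cnorm_ge0 //.
apply: le_trans (_ : 2 * (2 * 64^-1) <= _); last by lra.
apply: (@geometric_poly_bound _ _ 8^-1); [by rewrite invr_ge0| |by lra].
move=> k; rewrite coef_poly; case: ifP => _; last by rewrite cnorm0 !mulr_ge0 ?exprn_ge0 ?invr_ge0.
apply: le_trans (_ : 2 * (8^-1 ^+ k.+2) <= _); last by rewrite !exprS; lra.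
apply: (@geometric_poly_bound _ _ 8^-1); [by rewrite invr_ge0| |by lra].
move=> l; rewrite coef_nderivn -[P`__ *+ _]mulr_natr -exprD.
apply: le_trans (cnorm_leM (hP _) (_ : _ <= 2 ^+ (k.+2 + l))) _.
  rewrite cnorm_nat -natrX ler_nat.
  have := expnDn 1 1 (k.+2 + l); rewrite addn1 => ->.
  have hm : (k.+2 < (k.+2 + l).+1)%N by rewrite ltnS leq_addr.
  by rewrite (bigD1 (Ordinal hm)) //= !exp1n !muln1 leq_addr.
by rewrite -exprMn (_ : 16^-1 * 2 = 8^-1) //; field.
Qed.
End CoefficientBounds.

(** * Approximate roots of complex polynomials *)

Section RegularLevel.
Variable R : archiRcfType.
Local Notation C := R[i].

Lemma Re_le_cnorm (z : C) : `|complex.Re z| <= cnorm z.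
Proof.
by case: z => a b; rewrite /cnorm /= -sqrtr_sqr ler_wsqrtr // lerDl sqr_ge0.
Qed.

Lemma Im_le_cnorm (z : C) : `|complex.Im z| <= cnorm z.
Proof.
by case: z => a b; rewrite /cnorm /= -sqrtr_sqr ler_wsqrtr // lerDr sqr_ge0.
Qed.

Lemma cnorm_le_ReIm (z : C) : cnorm z <= `|complex.Re z| + `|complex.Im z|.
Proof.
case: z => a b; rewrite /cnorm /=.
have h : 0 <= `|a| + `|b| by rewrite addr_ge0.
rewrite -(ger0_norm h) -sqrtr_sqr ler_wsqrtr // sqrrD !real_normK ?num_real //.
by rewrite addrAC lerDl mulrn_wge0 // mulr_ge0.
Qed.

Lemma dist_nat_ge1 n (i l : 'I_n) : i != l -> 1 <= `|i%:R - l%:R| :> R.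
Proof.
rewrite -val_eqE /= neq_ltn => /orP[h|h].
  by rewrite distrC -natrB ?(ltnW h) // normr_nat ler1n subn_gt0.
by rewrite -natrB ?(ltnW h) // normr_nat ler1n subn_gt0.
Qed.

(* If every w of a grid of (M+1)^2 levels were attained with small derivative,
   two of the (M+1)^2 points would lie in one of M^2 cells, too close to have
   distinct images. *)
Lemma regular_level (P : {poly C}) (s : R) : (forall k, cnorm P`_k <= 16^-1 ^+ k) ->
  0 < s -> exists w, cnorm w <= s /\
    forall z, cnorm z <= 2 -> P.[z] = w -> s / 80 <= cnorm P^`().[z].
Proof.
move=> hP s0; apply: NNPP => hno.
pose M := (Num.bound (800 / s)).+1.
have M0 : 0 < M%:R :> R by rewrite ltr0n.
(* With [q = 1 / M], two points in one cell are at distance at most [10 q], so their levels differ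
   by at most [100 q ^ 2 + (s / 80) * 10 q]. The bound [800 q < s] makes this less than [s q / 4],
   hence less than the grid step [g]. *)
have hM : 800 / s < M%:R.
  apply: lt_le_trans (_ : (Num.bound (800 / s))%:R <= _); last by rewrite ler_nat.
  exact: archi_boundP (divr_ge0 _ (ltW s0)).
pose g := s / (2 * M.+1%:R).
have g0 : 0 < g by rewrite divr_gt0 // mulr_gt0.
pose w (u : 'I_M.+1 * 'I_M.+1) : C := Complex (g * u.1%:R) (g * u.2%:R).
have gn n : 0 <= g * n%:R by rewrite (mulr_ge0 (ltW g0)).
have hw u : cnorm (w u) <= s.
  apply: le_trans (cnorm_le_ReIm _) _; rewrite /= !ger0_norm ?gn //.
  rewrite -mulrDr -natrD /g mulrAC ler_pdivrMr; last by rewrite mulr_gt0.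
  by rewrite ler_wpM2l ?(ltW s0) // -natrM ler_nat mul2n -addnn leq_add // ltnW.
have hz : forall u, exists z, [/\ cnorm z <= 2, P.[z] = w u & cnorm P^`().[z] < s / 80].
  move=> v; apply: NNPP => hn; apply: hno; exists (w v); split=> [|z z2 zw]; first exact: hw.
  by rewrite leNgt; apply/negP => h; apply: hn; exists z.
have [Z hZ] := fin_all_exists hz.
(* Dividing by 5 although [[-2, 2]] has length 4 keeps the index of the endpoint 2 below [M]. *)
pose cell (x : R) : 'I_M := inord (Num.truncn ((x + 2) * M%:R / 5)).
have cellP (x y : R) : `|x| <= 2 -> `|y| <= 2 -> cell x = cell y -> `|x - y| <= 5 / M%:R.
  have main t : `|t| <= 2 -> (cell t)%:R <= (t + 2) * M%:R / 5 < (cell t)%:R + 1.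
    rewrite ler_norml => /andP[t1 t2].
    have tp : 0 <= (t + 2) * M%:R / 5 by rewrite divr_ge0 // mulr_ge0 //; lra.
    have tM : (Num.truncn ((t + 2) * M%:R / 5) < M)%N.
      rewrite truncn_lt_nat //.
      rewrite ltr_pdivrMr // mulrC ltr_pM2l //; lra.
    by rewrite /cell inordK // natr1 truncn_itv.
  move=> /main hx /main hy e; move: hx hy; rewrite e => /andP[x1 x2] /andP[y1 y2].
  have : `|(x - y) * M%:R| <= 5 by rewrite ler_norml; apply/andP; split; lra.
  by rewrite normrM (ger0_norm (ltW M0)) ler_pdivlMr.
have [inj|/injectivePn] := boolP (injectiveb (fun u => (cell (complex.Re (Z u)), cell (complex.Im (Z u))))).
  have /injectiveP/leq_card := inj; rewrite !card_prod !card_ord.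
  by rewrite leqNgt ltn_mul.
case=> u [v uv [e1 e2]].
have [zu pu _] := hZ u; have [zv pv dv] := hZ v.
set h := Z u - Z v.
have hh : cnorm h <= 10 / M%:R.
  apply: le_trans (cnorm_le_ReIm _) _.
  have -> : 10 / M%:R = 5 / M%:R + 5 / M%:R :> R by lra.
  rewrite lerD // ?raddfB /=; apply: cellP => //;
    first [exact: (le_trans (Re_le_cnorm _) zu) | exact: (le_trans (Re_le_cnorm _) zv)
      | exact: (le_trans (Im_le_cnorm _) zu) | exact: (le_trans (Im_le_cnorm _) zv)].
have h4 : cnorm h <= 4 by apply: le_trans (cnormB _ _) _; lra.
have e : Z v + h = Z u by rewrite /h addrC subrK.
have := taylor_remainder hP zv h4; rewrite e pu pv => ht.
have sep : g <= cnorm (w u - w v).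
  have [i|i] := eqVneq u.1 v.1.
    have i2 : u.2 != v.2.
      by apply: contra uv => /eqP k; rewrite [u]surjective_pairing [v]surjective_pairing i k.
    apply: le_trans (Im_le_cnorm _); rewrite /w /= -mulrBr normrM gtr0_norm //.
    by rewrite ler_peMr ?(ltW g0) // dist_nat_ge1.
  apply: le_trans (Re_le_cnorm _); rewrite /w /= -mulrBr normrM gtr0_norm //.
  by rewrite ler_peMr ?(ltW g0) // dist_nat_ge1.
have up : cnorm (w u - w v) <= cnorm h ^+ 2 + s / 80 * cnorm h.
  rewrite -(subrK (P^`().[Z v] * h) (w u - w v)); apply: cnorm_leD => //.
  by rewrite cnormM ler_wpM2r ?cnorm_ge0 // ltW.
have h0 := cnorm_ge0 h.
set t := cnorm h in hh h0 up; set q := M%:R^-1 : R.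
have q0 : 0 < q by rewrite invr_gt0.
have hq : 800 * q < s by rewrite ltr_pdivrMr // mulrC -ltr_pdivrMr.
have gq : s * q / 4 <= g.
  rewrite /g /q -mulrA ler_wpM2l ?(ltW s0) // -invfM lef_pV2 ?posrE ?mulr_gt0 //.
  by rewrite -!natrM ler_nat mulnC (mulnA M 2 2) leq_pmul2r // muln2 -addnn -addn1 leq_add2l.
have hh' : t <= 10 * q by [].
have : t ^+ 2 <= 100 * q ^+ 2 by nra.
have : s / 80 * t <= s / 80 * (10 * q) by rewrite ler_wpM2l // divr_ge0 // ltW.
nra.
Qed.
End RegularLevel.

(** * Simple roots in a disc and interpolation at them *)

Section DiscFactorization.
Variable R : archiRcfType.
Local Notation C := R[i].

Lemma cnorm_subX (a b : C) (A : R) n : cnorm a <= A -> cnorm b <= A -> 1 <= A ->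
  cnorm (a ^+ n - b ^+ n) <= n%:R * A ^+ n * cnorm (a - b).
Proof.
move=> ha hb A1; rewrite subrXX cnormM mulrC ler_wpM2r ?cnorm_ge0 //.
apply: le_trans (cnorm_sum _ _ _) _.
apply: le_trans (_ : \sum_(i < n) A ^+ n <= _); last by rewrite sumr_const card_ord mulr_natl.
apply: ler_sum => i _; apply: le_trans (cnorm_leM (cnorm_leX _ ha) (cnorm_leX _ hb)) _.
have hi : (i <= n.-1)%N by case: (n) i => [[]|k i] //; exact: leq_ord.
by rewrite -exprD ler_weXn2l // subnK // leq_pred.
Qed.

(** Closeness of the [j]-th powers fixes [b] only up to a root of unity; the smallness of
    [a ^ j * (a - b)] selects the branch where [a] is large, and where [a] is small both numbers
    are. In formulas, [|a - b| ^ j] is at most [2 ^ j] times [2 |a| ^ j + e], and one more factor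
    [|a - b|] brings in the second hypothesis. *)
Lemma dist_pow_bound (a b : C) (A e : R) j : cnorm a <= A -> cnorm b <= A -> 1 <= A -> 0 <= e ->
  cnorm (b ^+ j - a ^+ j) <= e -> cnorm (a ^+ j * (a - b)) <= e ->
  cnorm (a - b) ^+ j.+1 <= 2 ^+ j * (2 + 2 * A) * e.
Proof.
move=> ha hb A1 e0 h1 h2.
have d2 : cnorm (a - b) <= 2 * A by have := cnormB a b; lra.
have hbj : cnorm b ^+ j <= cnorm a ^+ j + e.
  by have := cnorm_geB (b ^+ j) (a ^+ j); rewrite !cnormX; lra.
have dj : cnorm (a - b) ^+ j <= 2 ^+ j * (2 * cnorm a ^+ j + e).
  pose m := Num.max (cnorm a) (cnorm b).
  have m0 : 0 <= m by rewrite le_max cnorm_ge0.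
  apply: le_trans (_ : (2 * m) ^+ j <= _).
    rewrite lerXn2r ?nnegrE ?mulr_ge0 ?cnorm_ge0 //.
    apply: le_trans (cnormB _ _) _; rewrite mulr_natl mulr2n.
    by rewrite lerD // le_max lexx ?orbT.
  rewrite exprMn ler_wpM2l ?exprn_ge0 //.
  have a0 : 0 <= cnorm a ^+ j by rewrite exprn_ge0 ?cnorm_ge0.
  by rewrite /m /Num.max; case: ifP => _; lra.
rewrite exprSr; apply: le_trans (ler_wpM2r (cnorm_ge0 _) dj) _.
rewrite -!mulrA ler_wpM2l ?exprn_ge0 //.
move: h2; rewrite cnormM cnormX => h2.
have : e * cnorm (a - b) <= e * (2 * A) by rewrite ler_wpM2l.
lra.
Qed.

(** The derivative bound excludes [Q = 0] and multiple roots in the disc, so the roots there can be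
    listed injectively. *)
Lemma factor_disc (Q : {poly C}) (b : R) : 0 < b ->
  (forall z, cnorm z <= 2 -> Q.[z] = 0 -> b <= cnorm Q^`().[z]) ->
  exists n (x : 'I_n -> C) (a : C) (r : seq C),
  [/\ injective x, forall i, cnorm (x i) <= 2, a != 0,
      {in r, forall z, 2 < cnorm z}
    & Q = (\prod_i ('X - (x i)%:P)) * (a *: \prod_(z <- r) ('X - z%:P))].
Proof.
move=> b0 hQ; have Q0 : Q != 0.
  apply/eqP => Q0; have := hQ 0; rewrite Q0 cnorm0 deriv0 !horner0 cnorm0.
  by move=> /(_ (ler0n _ 2) erefl); rewrite leNgt b0.
have [r def] := closed_field_poly_normal Q.
pose rin := [seq z <- r | cnorm z <= 2].
have defr : \prod_(z <- r) ('X - z%:P) =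
   (\prod_(z <- rin) ('X - z%:P)) * \prod_(z <- [seq z <- r | ~~ (cnorm z <= 2)]) ('X - z%:P).
  by rewrite !big_filter (bigID (fun z => cnorm z <= 2)).
have uin : uniq rin.
  apply: count_mem_uniq => z; case: (boolP (z \in rin)) => [zr|/count_memPn//].
  have := perm_to_rem zr => /permP/(_ (pred1 z)) /= ->; rewrite eqxx.
  suff /count_memPn -> : z \notin rem z rin by [].
  apply/negP => zrr.
  have z2 : cnorm z <= 2 by move: zr; rewrite mem_filter => /andP[].
  have eQ : exists H, Q = ('X - z%:P) * (('X - z%:P) * H).
    rewrite def defr (perm_big _ (perm_to_rem zr)) big_cons (perm_big _ (perm_to_rem zrr)) big_cons /=.
    exists (lead_coef Q *: (\prod_(y <- rem z (rem z rin)) ('X - y%:P) *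
      \prod_(y <- [seq y <- r | ~~ (cnorm y <= 2)]) ('X - y%:P))).
    by rewrite -!scalerAr !mulrA.
  have [H eH] := eQ.
  have Qz : Q.[z] = 0 by rewrite eH hornerM hornerXsubC subrr mul0r.
  have := hQ z z2 Qz; rewrite {1}eH derivM hornerD !hornerM !hornerXsubC subrr !(mul0r, mulr0) addr0.
  by rewrite cnorm0 leNgt b0.
exists (size rin), (fun i => nth 0 rin i), (lead_coef Q), [seq z <- r | ~~ (cnorm z <= 2)]; split.
- by move=> i k /eqP; rewrite nth_uniq // => /eqP/ord_inj.
- by move=> i; have := mem_nth 0 (ltn_ord i); rewrite mem_filter => /andP[].
- by rewrite lead_coef_eq0.
- by move=> z; rewrite mem_filter ltNge => /andP[].
by rewrite {1}def defr (big_nth 0) big_mkord scalerAr.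
Qed.

(** The remainder is the Lagrange interpolant of [q] at the [x i]. Differentiating [Q] at [x i]
    gives [Q' (x i) = G (x i) * prod (x i - x l)], so the inverse of each denominator is at most
    [X / b]; the numerators contribute [8 ^ n], and the [n <= 2 ^ n] terms make it [16 ^ n]. *)
Lemma remainder_bound (Q q G : {poly C}) n (x : 'I_n -> C) (e X b : R) :
  injective x -> (forall i, cnorm (x i) <= 2) -> 0 < b -> 0 <= e -> 0 <= X ->
  Q = (\prod_i ('X - (x i)%:P)) * G ->
  (forall i, b <= cnorm Q^`().[x i]) -> (forall i, cnorm G.[x i] <= X) ->
  (forall i, cnorm q.[x i] <= e) ->
  forall y, cnorm y <= 6 -> cnorm (q %% (\prod_i ('X - (x i)%:P))).[y] <= 16 ^+ n * (e * X / b).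
Proof.
move=> xI x2 b0 e0 X0 eQ hQ' hG hq y y6; set p := \prod_i _ in eQ *.
have pn0 : p != 0 by rewrite monic_neq0 // monic_prod_XsubC.
have sp : size p = n.+1 by rewrite size_prod_XsubC /index_enum -enumT size_enum_ord.
have sr : (size (q %% p)%R <= n)%N by rewrite -ltnS -sp ltn_modp.
rewrite (lagrange_eval y xI sr).
apply: le_trans (cnorm_sum _ _ _) _.
have pE i : p = ('X - (x i)%:P) * \prod_(l | l != i) ('X - (x l)%:P) by rewrite /p (bigD1 i).
have px i : p.[x i] = 0 by rewrite (pE i) hornerM hornerXsubC subrr mul0r.
have dE i : Q^`().[x i] = (\prod_(l | l != i) (x i - x l)) * G.[x i].
  rewrite eQ derivM hornerD !hornerM px mul0r addr0 (pE i) derivM derivXsubC mul1r.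
  rewrite hornerD hornerM hornerXsubC subrr mul0r addr0 horner_prod.
  by congr (_ * _); apply: eq_bigr => l _; rewrite hornerXsubC.
have term i : cnorm ((q %% p).[x i] * \prod_(l | l != i) ((y - x l) / (x i - x l)))
    <= e * (8 ^+ n * (X / b)).
  have -> : (q %% p).[x i] = q.[x i].
    by rewrite [in RHS](Pdiv.Field.divp_eq q p) hornerD hornerM px mulr0 add0r.
  apply: cnorm_leM => //; rewrite big_split /= prodfV.
  apply: cnorm_leM.
    rewrite cnorm_prod; apply: le_trans (_ : \prod_(l | l != i) 8 <= _).
      apply: ler_prod => l _; rewrite cnorm_ge0 /=.
      by apply: le_trans (cnormB _ _) _; have := x2 l; lra.
    rewrite prodr_const (cardC1 i) card_ord ler_weXn2l //; first by lra.
    exact: leq_pred.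
  have := hQ' i; rewrite dE cnormM cnormV => hb.
  have ppos : 0 < cnorm (\prod_(l | l != i) (x i - x l)).
    rewrite cnorm_gt0; apply/prodf_neq0 => l li.
    by rewrite subr_eq0 (inj_eq xI) eq_sym.
  rewrite ler_pdivlMr // mulrC ler_pdivrMr // mulrC.
  by apply: le_trans hb _; rewrite ler_wpM2l ?cnorm_ge0.
apply: le_trans (ler_sum _ (fun i _ => term i)) _.
rewrite sumr_const card_ord -[_ *+ n]mulr_natl.
have c0 : 0 <= e * (8 ^+ n * (X / b)).
  by rewrite mulr_ge0 // mulr_ge0 ?exprn_ge0 // divr_ge0 // ltW.
have -> : 16 ^+ n * (e * X / b) = 2 ^+ n * (e * (8 ^+ n * (X / b))).
  have -> : 16 = 2 * 8 :> R by ring.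
  by rewrite (exprMn _ 2 8); ring.
by rewrite ler_wpM2r // -natrX ler_nat ltnW // ltn_expl.
Qed.
End DiscFactorization.

(** * The factor whose roots lie outside the disc *)

Section OuterFactor.
Variable R : archiRcfType.
Local Notation C := R[i].

(** A Harnack-type comparison: for [|y| > 2] and [|z| <= 1] the numbers [|z - y|] and [|y|] agree up
    to a factor 2, one such factor for each root. *)
Lemma outer_factor_bound (a : C) (r : seq C) (z : C) : {in r, forall y, 2 < cnorm y} ->
  cnorm z <= 1 ->
  let G := a *: \prod_(y <- r) ('X - y%:P) in
  cnorm G.[z] <= 2 ^+ size r * cnorm G.[0] /\ cnorm G.[0] <= 2 ^+ size r * cnorm G.[z].
Proof.
move=> hr hz /=; rewrite !hornerZ !cnormM.
suff [h1 h2] : cnorm (\prod_(y <- r) ('X - y%:P)).[z] <= 2 ^+ size r * cnorm (\prod_(y <- r) ('X - y%:P)).[0]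
   /\ cnorm (\prod_(y <- r) ('X - y%:P)).[0] <= 2 ^+ size r * cnorm (\prod_(y <- r) ('X - y%:P)).[z].
  by rewrite !(mulrCA (2 ^+ _)) !ler_wpM2l ?cnorm_ge0.
elim: r hr => [|y r IH] hr; first by rewrite big_nil !hornerC expr0 mul1r.
have hy : 2 < cnorm y by apply: hr; rewrite mem_head.
have [|h1 h2] := IH; first by move=> x xr; apply: hr; rewrite inE xr orbT.
rewrite big_cons !hornerM !hornerXsubC !cnormM /= exprS sub0r cnormN.
have k1 : cnorm (z - y) <= 2 * cnorm y by have := cnormB z y; lra.
have k2 : cnorm y <= 2 * cnorm (z - y).
  by have := cnorm_geB y z; rewrite cnorm_dist; lra.
by split; rewrite [leRHS]mulrACA ler_pM ?cnorm_ge0.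
Qed.

Lemma exists_half_pow (e : R) : 0 < e -> exists m, 2^-1 ^+ m <= e.
Proof.
move=> e0; have e1 : 0 <= e^-1 by rewrite invr_ge0 ltW.
have := archi_boundP e1; set n := Num.bound _ => hn; exists n.
rewrite exprVn -[e]invrK lef_pV2 ?posrE ?exprn_gt0 ?invr_gt0 //.
by apply: le_trans (ltW hn) _; rewrite -natrX ler_nat ltnW // ltn_expl.
Qed.

(* [1 / (X - y)] is replaced by a truncated geometric series; its degree is
   irrelevant, as only values on the unit disc are used later. *)
Lemma outer_factor_inverse (a : C) (r : seq C) (e : R) : a != 0 ->
  {in r, forall y, 2 < cnorm y} -> 0 < e ->
  exists I : {poly C}, forall z, cnorm z <= 1 ->
    cnorm ((a *: \prod_(y <- r) ('X - y%:P)).[z] * I.[z] - 1) <= e.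
Proof.
move=> a0 hr e0.
have [m hm] := exists_half_pow (divr_gt0 e0 (exprn_gt0 (size r) (ltr0n _ 2))).
exists (a^-1 *: \prod_(y <- r) (- y^-1 *: \sum_(k < m) (y^-1 *: 'X) ^+ k)) => z hz.
rewrite !hornerZ mulrACA divff // mul1r -hornerM -big_split /= horner_prod.
set t := 2^-1 ^+ m in hm.
have t0 : 0 <= t by rewrite exprn_ge0 ?invr_ge0.
have t1 : t <= 1 by rewrite exprn_ile1 ?invr_ge0 // invf_le1 // ler1n.
have -> : \prod_(y <- r) (('X - y%:P) * (- y^-1 *: \sum_(k < m) (y^-1 *: 'X) ^+ k)).[z] =
  \prod_(y <- r) (1 - (z / y) ^+ m).
  rewrite big_seq [RHS]big_seq; apply: eq_bigr => y yr.
  have y0 : y != 0 by rewrite -cnorm_gt0; apply: lt_trans (hr _ yr).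
  rewrite hornerM hornerXsubC hornerZ horner_sum.
  under eq_bigr => k _ do rewrite horner_exp hornerZ hornerX mulrC.
  rewrite -[1 - _]opprB subrX1 mulrA -mulNr; congr (_ * _).
  by rewrite mulrN mulrBl divff.
(* The constant is the one reproduced by the induction: [(1 - u) p - 1 = (1 - u) (p - 1) - u] with
   [|1 - u| <= 2] and [|u| <= t] sends [A t] to [(2 A + 1) t]. *)
apply: le_trans (_ : (2 ^+ size r - 1) * t <= _); last first.
  move: hm; rewrite ler_pdivlMr ?exprn_gt0 // mulrC; lra.
elim: r hr {hm} => [|y r IH] hr; first by rewrite big_nil expr0 !subrr cnorm0 mul0r.
have hy : 2 < cnorm y by apply: hr; rewrite mem_head.
have {}IH := IH (fun x xr => hr x (mem_behead (s := y :: r) xr)).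
rewrite big_cons; set u := (z / y) ^+ m; set p := \prod_(_ <- r) _ in IH *.
have hu : cnorm u <= t.
  rewrite /u; apply: cnorm_leX; rewrite cnormM cnormV ler_pdivrMr; last by lra.
  lra.
have -> : (1 - u) * p - 1 = (1 - u) * (p - 1) - u by ring.
have h1 : cnorm (1 - u) <= 2 by apply: le_trans (cnormB _ _) _; rewrite cnorm1; lra.
apply: le_trans (cnorm_leB (cnorm_leM h1 IH) hu) _.
by rewrite /= exprS; lra.
Qed.
End OuterFactor.

(** * The approximate quotient of [q] by a regular shift of [p] *)

Section ApproximateQuotient.
Variable R : archiRcfType.
Local Notation C := R[i].

(** [640 = 16 * 40] comes from interpolating at the roots and from extrapolating the cofactor [G],
    [40 ^ (j + 1)] from extrapolating a polynomial of degree [(j + 1) D], and [2 ^ j] from dividing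
    by [G ^ j]. In front, [482 = 480 + 2] adds the size of the interpolant and two further
    errors. *)
Definition quotient_const j D : R :=
  (482 * j.+1%:R * 3 ^+ j.+1) * (40 ^+ j.+1 * 640 * 2 ^+ j) ^+ D.

Lemma size_exp_bound (p : {poly C}) d n : (size p <= d.+1)%N -> (size (p ^+ n)%R <= (n * d).+1)%N.
Proof.
move=> hp; apply: leq_trans (size_poly_exp_leq p n) _; rewrite ltnS mulnC leq_mul2l.
by apply/orP; right; move: hp; case: (size p).
Qed.

Lemma size_mul_bound (p q : {poly C}) d e : (size p <= d.+1)%N -> (size q <= e.+1)%N ->
  (size (p * q)%R <= (d + e).+1)%N.
Proof.
move=> hp hq; apply: leq_trans (size_polyMleq _ _) _.
by rewrite -subn1 leq_subLR add1n -addnS -addSn leq_add.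
Qed.

(* With [tau = v ^ (2 j)] and [s = tau ^ j], [w] is a level of size [s] at which
   [p] has simple roots with [|p'| >= s / 80]; there [|q| <= 2 s tau], so the
   Lagrange interpolant [Rm] of [q] at the roots of [p - w] in the disc is
   small and [q - Rm] is divisible by [prod (X - x_i)].  If the cofactor [G] of
   [p - w] is small at 0, so is [p - w] on the disc (first alternative). *)
Lemma approx_quotient j D (p q : {poly C}) (v : R) : (0 < j)%N ->
  (size p <= D.+1)%N -> (size q <= D.+1)%N ->
  (forall k, cnorm p`_k <= 16^-1 ^+ k) -> (forall k, cnorm q`_k <= 16^-1 ^+ k) ->
  0 < v <= 1 ->
  (forall z, cnorm z <= 8 -> cnorm (q.[z] ^+ j - p.[z] ^+ j.+1) <= v ^+ (2 * j * j * j.+1)) ->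
  quotient_const j D * v <= 1 ->
  exists w, cnorm w <= v /\
   ((forall z, cnorm z <= 1 -> cnorm (p.[z] - w) <= quotient_const j D * v) \/
    exists F : {poly C}, forall z, cnorm z <= 1 ->
     [/\ cnorm F.[z] <= 8,
         cnorm (F.[z] ^+ j - (p.[z] - w)) <= (quotient_const j D + 4 * j%:R * 8 ^+ j) * v &
         cnorm (q.[z] - (p.[z] - w) * F.[z]) <= (quotient_const j D + 12) * v]).
Proof.
move=> j0 sp sq hp hq /andP[v0 v1] hd hE.
set E0 := quotient_const j D in hE *.
pose tau := v ^+ (2 * j); pose s := tau ^+ j.
have tau0 : 0 < tau by rewrite exprn_gt0.
have tau1 : tau <= 1 by rewrite exprn_ile1 // ltW.
have s0 : 0 < s by rewrite exprn_gt0.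
have s_tau : s <= tau by rewrite -[leRHS]expr1 ler_wiXn2l // ltW.
have tau_v : tau <= v by rewrite -[leRHS]expr1 ler_wiXn2l // ?muln_gt0 // ltW.
have sv : s <= v := le_trans s_tau tau_v.
have s1 : s <= 1 := le_trans s_tau tau1.
rewrite (exprM v (2 * j * j)) (exprM v (2 * j)) -/tau -/s in hd.
have Etau : tau = v ^+ (2 * j) by [].
have Es : s = tau ^+ j by [].
clearbody s; clearbody tau.
have [w [hw hw']] := regular_level hp s0.
exists w; split; first exact: le_trans hw sv.
pose Q := p - w%:P.
have Qz z : Q.[z] = p.[z] - w by rewrite !hornerE.
have Q' : Q^`() = p^`() by rewrite derivB derivC subr0.
have sQ : (size Q <= D.+1)%N.
  apply: leq_trans (size_polyD _ _) _; rewrite geq_max sp size_polyN.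
  by apply: leq_trans (size_polyC_leq1 _) _.
have b0 : 0 < s / 80 by rewrite divr_gt0.
have [|n [x [a [r [xI x2 a0 hr defQ]]]]] := @factor_disc _ Q (s / 80) b0.
  move=> z z2 /eqP; rewrite Qz subr_eq0 => /eqP zw; rewrite Q'; exact: hw'.
set pin := \prod_i _ in defQ; set G := a *: _ in defQ.
have spin : size pin = n.+1 by rewrite size_prod_XsubC /index_enum -enumT size_enum_ord.
have mpin : pin \is monic by rewrite monic_prod_XsubC.
have sG : size G = (size r).+1 by rewrite size_scale // size_prod_XsubC.
have nr : (n + size r <= D)%N.
  move: sQ; rewrite defQ size_monicM // ?spin ?sG //; last by rewrite -size_poly_eq0 sG.
  by rewrite addSn /= addnS ltnS.
have nD : (n <= D)%N := leq_trans (leq_addr _ _) nr.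
have rD : (size r <= D)%N := leq_trans (leq_addl _ _) nr.
have pin_z z : pin.[z] = \prod_i (z - x i).
  by rewrite horner_prod; apply: eq_bigr => i _; rewrite hornerXsubC.
(* The interval [[4, 6]] is away from the roots in the disc, so dividing by [pin] there costs
   nothing; extrapolation from centre 5 with radius 8 then covers [|z| <= 3]. *)
have pin_far (y : R) : `|y - 5| <= 1 -> 1 <= cnorm pin.[y%:C%C].
  move=> hy; rewrite pin_z cnorm_prod.
  apply: le_trans (_ : \prod_(i < n) (1 : R) <= _); first by rewrite big1.
  apply: ler_prod => i _; rewrite ler01 /=.
  have := cnorm_geB y%:C%C (x i); have := x2 i; rewrite cnorm_real.
  move: hy (ler_norm y); rewrite ler_norml => /andP[y1 _]; move: y1; clear; lra.
have far6 (y : R) : `|y - 5| <= 1 -> cnorm y%:C%C <= 6.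
  by rewrite cnorm_real !ler_norml => /andP[y1 y2]; apply/andP; move: y1 y2; clear; split; lra.
have p2 z : cnorm z <= 8 -> cnorm p.[z] <= 2.
  move=> hz; rewrite -[leRHS]mulr1; apply: (geometric_poly_bound (b := 16^-1)).
  - by rewrite invr_ge0.
  - by move=> k; rewrite mul1r.
  - by move: hz; clear; lra.
have q2 z : cnorm z <= 8 -> cnorm q.[z] <= 2.
  move=> hz; rewrite -[leRHS]mulr1; apply: (geometric_poly_bound (b := 16^-1)).
  - by rewrite invr_ge0.
  - by move=> k; rewrite mul1r.
  - by move: hz; clear; lra.
have Q3 z : cnorm z <= 8 -> cnorm Q.[z] <= 3.
  by move=> /p2 hz; rewrite Qz; apply: le_trans (cnormB _ _) _; move: hz hw s1; clear; lra.
pose X : R := 3 * 40 ^+ D.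
have X0 : 0 <= X by rewrite mulr_ge0 // exprn_ge0.
have hG z : cnorm z <= 3 -> cnorm G.[z] <= X.
  move=> hz; rewrite /X mulrC; apply: (extrapolate (c := 5)).
  - by rewrite sG ltnS.
  - move=> y hy; have h1 := pin_far y hy.
    have : cnorm Q.[y%:C%C] <= 3 by apply: Q3; have := far6 _ hy; clear; lra.
    rewrite defQ hornerM cnormM => h; apply: le_trans h; rewrite ler_peMl ?cnorm_ge0 //.
  - by apply: le_trans (cnormB _ _) _; rewrite cnorm_real ger0_norm //; move: hz; clear; lra.
have Qx i : Q.[x i] = 0.
  by rewrite defQ hornerM pin_z (bigD1 i) //= subrr !mul0r.
(* At a root [p = w], hence [|q| ^ j <= 2 * s ^ (j + 1)]; since [s = tau ^ j], the right-hand side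
   is at most the [j]-th power of [2 s tau]. *)
have qx i : cnorm q.[x i] <= 2 * s * tau.
  have px : p.[x i] = w by apply/eqP; rewrite -subr_eq0 -Qz Qx.
  have xi8 : cnorm (x i) <= 8 by have := x2 i; clear; lra.
  rewrite -(@ler_pXn2r _ j) ?nnegrE ?cnorm_ge0 ?mulr_ge0 ?(ltW s0) ?(ltW tau0) //.
  have := hd _ xi8; rewrite px => h.
  have h2 := cnorm_geB (q.[x i] ^+ j) (w ^+ j.+1).
  have h3 : cnorm (w ^+ j.+1) <= s ^+ j.+1 by apply: cnorm_leX.
  have e1 : (2 * s * tau) ^+ j = 2 ^+ j * s ^+ j.+1.
    by rewrite !exprMn -Es -mulrA -exprSr.
  rewrite e1; apply: le_trans (_ : 2 * s ^+ j.+1 <= _).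
    by rewrite -cnormX; move: h h2 h3; clear; lra.
  rewrite ler_wpM2r ?exprn_ge0 ?(ltW s0) //.
  by rewrite -(prednK j0) exprS ler_peMr // exprn_ege1 // ler1n.
pose rho := 480 * 640 ^+ D * tau.
pose Rm := q %% pin; pose T := q %/ pin.
have qE : q = pin * T + Rm by rewrite mulrC; exact: Pdiv.Field.divp_eq.
have hRm y : cnorm y <= 6 -> cnorm Rm.[y] <= rho.
  move=> y6.
  apply: le_trans (_ : 16 ^+ n * ((2 * s * tau) * X / (s / 80)) <= _).
    apply: (remainder_bound xI x2 b0 _ X0 defQ) => //.
    - by rewrite !mulr_ge0 // ltW.
    - by move=> i; rewrite Q'; apply: hw' => //; apply/eqP; rewrite -subr_eq0 -Qz Qx.
    - by move=> i; apply: hG; have := x2 i; clear; lra.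
  (* The factor [s] in the values of [q] cancels the lower bound [s / 80] of the derivative, and
     [tau] is the gain that survives. *)
  have -> : 2 * s * tau * X / (s / 80) = 160 * tau * X.
    by field; rewrite lt0r_neq0.
  rewrite /rho /X; have -> : 480 * 640 ^+ D * tau = 16 ^+ D * (160 * tau * (3 * 40 ^+ D)).
    have -> : 640 = 16 * 40 :> R by ring.
    by rewrite (exprMn _ 16 40); ring.
  rewrite ler_wpM2r ?mulr_ge0 ?exprn_ge0 ?(ltW tau0) // ler_weXn2l // ?ler1n //.
have cj1 : 1 <= j.+1%:R * 3 ^+ j.+1 :> R.
  by rewrite mulr_ege1 ?ler1n // exprn_ege1 // ler1n.
set cj := j.+1%:R * 3 ^+ j.+1 in cj1.
have g640 : 640 ^+ D <= (40 ^+ j.+1 * 640 * 2 ^+ j) ^+ D :> R.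
  rewrite lerXn2r ?nnegrE ?mulr_ge0 ?exprn_ge0 // mulrAC ler_peMl //.
  by rewrite mulr_ege1 // exprn_ege1 // ler1n.
have E0E : E0 = 482 * cj * (40 ^+ j.+1 * 640 * 2 ^+ j) ^+ D.
  by rewrite /E0 /quotient_const /cj mulrA.
have p640 : 1 <= 640 ^+ D :> R by rewrite exprn_ege1 // ler1n.
have E0rho : 480 * 640 ^+ D <= E0.
  rewrite E0E; apply: ler_pM; rewrite ?exprn_ge0 //.
  by move: cj1; clear; lra.
have rhov : rho <= E0 * v.
  by rewrite /rho; apply: ler_pM; rewrite ?mulr_ge0 ?exprn_ge0 ?(ltW tau0).
have rho1 : rho <= 1 := le_trans rhov hE.
pose M := 482 * cj * 640 ^+ D * tau.
(* [S / G ^ j = (T / G) ^ j - Q] measures how far [T / G = (q - Rm) / Q] is from being a [j]-th root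
   of [Q]. Multiplied by [pin ^ j] it becomes [(q - Rm) ^ j - Q ^ (j + 1)], which is small on
   [[4, 6]]. *)
pose S := T ^+ j - Q * G ^+ j.
have sS : (size S <= (j.+1 * D).+1)%N.
  have sT : (size T <= D.+1)%N by apply: leq_trans (leq_divp _ _) sq.
  have sG' : (size G <= D.+1)%N by rewrite sG ltnS.
  apply: leq_trans (size_polyD _ _) _; rewrite geq_max size_polyN.
  rewrite mulSn size_mul_bound ?size_exp_bound // andbT.
  by apply: leq_trans (size_exp_bound j sT) _; rewrite ltnS leq_addl.
have QE z : Q.[z] = pin.[z] * G.[z] by rewrite defQ hornerM.
have SE z : S.[z] = T.[z] ^+ j - Q.[z] * G.[z] ^+ j.
  by rewrite /S hornerD hornerN hornerM !horner_exp.
have qRm z : q.[z] - Rm.[z] = pin.[z] * T.[z] by rewrite {1}qE hornerD hornerM addrK.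
have Sfar (y : R) : `|y - 5| <= 1 -> cnorm S.[y%:C%C] <= M.
  move=> hy; set z := y%:C%C; have z6 := far6 _ hy; have z8 : cnorm z <= 8 by move: z6; clear; rewrite /z; lra.
  have eS : pin.[z] ^+ j * S.[z] = (q.[z] - Rm.[z]) ^+ j - Q.[z] ^+ j.+1.
    rewrite qRm SE exprMn (exprS Q.[z]) [in X in _ = _ - _ * X]QE exprMn.
    by ring.
  have : cnorm (pin.[z] ^+ j * S.[z]) <= M.
    have -> : pin.[z] ^+ j * S.[z] = ((q.[z] - Rm.[z]) ^+ j - q.[z] ^+ j) +
       ((q.[z] ^+ j - p.[z] ^+ j.+1) + (p.[z] ^+ j.+1 - Q.[z] ^+ j.+1)).
      by rewrite eS; ring.
    have k1 : cnorm ((q.[z] - Rm.[z]) ^+ j - q.[z] ^+ j) <= cj * rho.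
      have h3 : cnorm (q.[z] - Rm.[z]) <= 3.
        by apply: le_trans (cnorm_leB (q2 _ z8) (hRm _ z6)) _; move: rho1; clear; lra.
      have h3' : cnorm q.[z] <= 3 by have := q2 _ z8; clear; lra.
      apply: le_trans (cnorm_subX j h3 h3' _) _; first by rewrite ler1n.
      rewrite addrAC subrr add0r cnormN; apply: ler_pM; rewrite ?mulr_ge0 ?exprn_ge0 ?cnorm_ge0 ?hRm //.
      by rewrite /cj ler_pM ?exprn_ge0 // ?ler_nat // ler_weXn2l // ?ler1n //.
    have k2 := hd _ z8.
    have k3 : cnorm (p.[z] ^+ j.+1 - Q.[z] ^+ j.+1) <= cj * s.
      have h3' : cnorm p.[z] <= 3 by have := p2 _ z8; clear; lra.
      apply: le_trans (cnorm_subX j.+1 h3' (Q3 _ z8) _) _; first by rewrite ler1n.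
      by rewrite /cj Qz opprB addrC subrK ler_wpM2l // mulr_ge0 // exprn_ge0.
    have k4 : s ^+ j.+1 <= tau.
      apply: le_trans s_tau; rewrite exprS ler_piMr ?(ltW s0) // exprn_ile1 // ltW //.
    apply: le_trans (cnorm_leD k1 (cnorm_leD k2 k3)) _.
    have l1 : cj * s <= cj * tau by rewrite ler_wpM2l // (le_trans ler01).
    have l2 : tau <= cj * tau by rewrite ler_peMl // ltW.
    have l3 : cj * tau <= cj * tau * 640 ^+ D.
      by rewrite ler_peMr // mulr_ge0 ?(ltW tau0) // (le_trans ler01).
    have -> : M = 480 * (cj * tau * 640 ^+ D) + 2 * (cj * tau * 640 ^+ D) by rewrite /M; ring.
    have -> : cj * rho = 480 * (cj * tau * 640 ^+ D) by rewrite /rho; ring.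
    by move: l1 l2 l3 k4; clear; lra.
  apply: le_trans; rewrite cnormM ler_peMl ?cnorm_ge0 // cnormX exprn_ege1 //.
  exact: pin_far.
have Snear z : cnorm z <= 1 -> cnorm S.[z] <= 40 ^+ (j.+1 * D) * M.
  move=> hz; apply: (extrapolate (c := 5)) => //.
  by apply: le_trans (cnormB _ _) _; rewrite cnorm_real ger0_norm //; move: hz; clear; lra.
have hGz z (hz : cnorm z <= 1) := outer_factor_bound a hr hz.
have [mu|mu] := ltP (cnorm G.[0]) v.
  left => z hz; have [hG1 _] := hGz z hz; rewrite -Qz defQ hornerM.
  apply: le_trans (_ : (3 ^+ n) * (2 ^+ size r * v) <= _).
    apply: cnorm_leM; last by apply: le_trans hG1 _; rewrite ler_wpM2l ?exprn_ge0 // ltW.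
    rewrite pin_z cnorm_prod -[n in 3 ^+ n]card_ord -prodr_const.
    apply: ler_prod => i _; rewrite cnorm_ge0 /=.
    by apply: le_trans (cnormB _ _) _; move: (x2 i) hz; clear; lra.
  rewrite mulrA ler_wpM2r ?(ltW v0) //; apply: le_trans E0rho.
  apply: le_trans (_ : 3 ^+ D * 2 ^+ D <= _).
    by rewrite ler_pM ?exprn_ge0 // ler_weXn2l // ?ler1n //.
  have -> : 3 ^+ D * 2 ^+ D = 6 ^+ D :> R by rewrite -exprMn -natrM.
  apply: le_trans (_ : 640 ^+ D <= _); first by rewrite lerXn2r ?nnegrE // ler_nat.
  by rewrite ler_peMl ?exprn_ge0 // ler1n.
right.
(* [T / G] is a rational function without poles in the unit disc; replacing [1 / G] by the
   polynomial [I] makes it a polynomial at the cost of an error [4 * v]. *)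
have [I hI] := outer_factor_inverse a0 hr v0.
exists (T * I) => z hz.
have [_ hG2] := hGz z hz.
have Gn0 : 0 < cnorm G.[z].
  have : 0 < 2 ^+ size r * cnorm G.[z] by apply: lt_le_trans hG2; apply: lt_le_trans mu.
  by rewrite pmulr_rgt0 // exprn_gt0.
have Gz0 : G.[z] != 0 by rewrite -cnorm_gt0.
have z8 : cnorm z <= 8 by move: hz; clear; lra.
have z6 : cnorm z <= 6 by move: hz; clear; lra.
set Ft := T.[z] / G.[z].
have QFt : Q.[z] * Ft = q.[z] - Rm.[z].
  by rewrite qRm QE /Ft; field.
have Ftj : cnorm (Ft ^+ j - Q.[z]) <= E0 * v.
  have -> : Ft ^+ j - Q.[z] = S.[z] / G.[z] ^+ j.
    rewrite SE /Ft exprMn exprVn; field.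
    by rewrite expf_neq0.
  rewrite cnormM cnormV cnormX ler_pdivrMr ?exprn_gt0 //.
  apply: le_trans (Snear _ hz) _.
  (* Of the factor [tau = v ^ (2 j)] in [M], one half [v ^ j] pays for the division by [G ^ j] and
     the other half leaves the error [v ^ j <= v]. *)
  have vG : v ^+ j <= 2 ^+ (D * j) * cnorm G.[z] ^+ j.
    rewrite exprM -exprMn lerXn2r ?nnegrE ?mulr_ge0 ?exprn_ge0 ?cnorm_ge0 ?(ltW v0) //.
    apply: le_trans mu _; apply: le_trans hG2 _.
    by rewrite ler_wpM2r ?cnorm_ge0 // ler_weXn2l // ?ler1n //.
  have vj : v ^+ j <= v by rewrite -(prednK j0) exprS ler_piMr ?(ltW v0) // exprn_ile1 // ltW.
  have -> : 40 ^+ (j.+1 * D) * M = (482 * cj * (40 ^+ j.+1 * 640) ^+ D) * (v ^+ j * v ^+ j).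
    rewrite /M Etau mul2n -addnn exprD exprM exprMn; ring.
  have -> : E0 * v * cnorm G.[z] ^+ j =
     (482 * cj * (40 ^+ j.+1 * 640) ^+ D) * (v * (2 ^+ (D * j) * cnorm G.[z] ^+ j)).
    rewrite E0E (mulnC D j) exprM (exprMn _ (_ * 640) (2 ^+ j)); ring.
  have cj0 : 0 <= 482 * cj by rewrite mulr_ge0 // (le_trans ler01).
  rewrite ler_wpM2l //; last by rewrite ler_pM ?exprn_ge0 ?(ltW v0).
  by apply: mulr_ge0 => //; apply: exprn_ge0; apply: mulr_ge0 => //; apply: exprn_ge0.
have Ft4 : cnorm Ft <= 4.
  rewrite -(@ler_pXn2r _ j) ?nnegrE ?cnorm_ge0 //.
  have := cnorm_geB (Ft ^+ j) Q.[z]; have := Q3 _ z8; rewrite cnormX => h1 h2.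
  apply: le_trans (_ : 4 <= _); first by move: h1 h2 Ftj hE; clear; lra.
  by rewrite -(prednK j0) exprS ler_peMr // exprn_ege1 // ler1n.
have FE : (T * I).[z] = Ft * (G.[z] * I.[z]) by rewrite hornerM /Ft; field.
have hIz := hI z hz.
have Fd : cnorm ((T * I).[z] - Ft) <= 4 * v.
  have -> : (T * I).[z] - Ft = Ft * (G.[z] * I.[z] - 1) by rewrite FE; ring.
  exact: cnorm_leM.
have F8 : cnorm (T * I).[z] <= 8.
  have := cnorm_geB (T * I).[z] Ft => h.
  have {}h : cnorm (T * I).[z] <= 4 * v + 4 by move: h Fd Ft4; clear; lra.
  by move: h v1; clear; lra.
rewrite -Qz; split => //.
- have gen (b c d : C) : b - c = (d - c) + (b - d) by ring.
  rewrite (gen _ _ (Ft ^+ j)) mulrDl.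
  apply: cnorm_leD => //.
  have Ft8 : cnorm Ft <= 8 by move: Ft4; clear; lra.
  apply: le_trans (cnorm_subX j F8 Ft8 _) _; first by rewrite ler1n.
  have -> : 4 * j%:R * 8 ^+ j * v = j%:R * 8 ^+ j * (4 * v) by clear; ring.
  by rewrite ler_wpM2l // mulr_ge0 // exprn_ge0.
have gen (b c d e : C) : b - c * d = (b - c * e) - c * (d - e) by ring.
rewrite (gen _ _ _ Ft) QFt subKr.
rewrite mulrDl; apply: cnorm_leB.
  by apply: le_trans (hRm _ z6) _.
have -> : 12 * v = 3 * (4 * v) by ring.
by apply: cnorm_leM => //; apply: Q3.
Qed.
End ApproximateQuotient.

Section ApproximateRoot.
Variable R : archiRcfType.
Local Notation C := R[i].

(** No regularity of [f] is assumed: it enters only through the polynomial approximations of two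
    consecutive powers on the real interval. The exponent [j + 1] in the conclusion is the loss of
    [dist_pow_bound]. *)
Theorem approx_root j : (0 < j)%N -> exists B : R, 1 <= B /\
  forall D (p q : {poly C}) (f : R -> C) (eta v : R),
  (size p <= D.+1)%N -> (size q <= D.+1)%N ->
  (forall k, cnorm p`_k <= 16^-1 ^+ k) -> (forall k, cnorm q`_k <= 16^-1 ^+ k) ->
  0 < v <= 1 -> B ^+ D.+1 * eta <= v ^+ (2 * j * j * j.+1) ->
  (forall x : R, `|x| <= 1 -> cnorm (f x ^+ j - p.[x%:C%C]) <= eta) ->
  (forall x : R, `|x| <= 1 -> cnorm (f x ^+ j.+1 - q.[x%:C%C]) <= eta) ->
  exists F : {poly C}, (forall k, cnorm F`_k <= 8) /\
    forall x : R, `|x| <= 1 -> cnorm (f x - F.[x%:C%C]) ^+ j.+1 <= B ^+ D.+1 * v.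
Proof.
move=> j0.
pose c1 : R := 482 * j.+1%:R * 3 ^+ j.+1.
pose g : R := 40 ^+ j.+1 * 640 * 2 ^+ j.
(* The three summands serve the three cases at the end: [dist_pow_bound] with [A = 8] (so
   [18 = 2 + 2 * 8]), the trivial case [E0 * v > 1] with [|f| <= 3], and the case where [p - w] is
   small on the disc. *)
pose K : R := 2 ^+ j * 18 * (2 + 4 * j%:R * 8 ^+ j + 32) + 3 ^+ j.+1 + 9.
have cj1 : 1 <= j.+1%:R * 3 ^+ j.+1 :> R by rewrite mulr_ege1 ?ler1n // exprn_ege1 // ler1n.
have c11 : 1 <= c1 by rewrite /c1 -mulrA; move: cj1; clear; lra.
have g1 : 1 <= g by rewrite /g !mulr_ege1 // ?exprn_ege1 ?ler1n.
have t1 : 0 <= 4 * j%:R * 8 ^+ j :> R by rewrite mulr_ge0 ?mulr_ge0 ?exprn_ge0.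
have t2 : 0 <= 2 ^+ j * 18 * (2 + 4 * j%:R * 8 ^+ j + 32) :> R.
  by rewrite !mulr_ge0 ?exprn_ge0 //; move: t1; clear; lra.
have t3 : 1 <= 3 ^+ j.+1 :> R by rewrite exprn_ege1 // ler1n.
have K9 : 9 <= K by rewrite /K; move: t2 t3; clear; lra.
have K3 : 3 ^+ j.+1 <= K by rewrite /K; move: t2; clear; lra.
have KE : 2 ^+ j * 18 * (2 + 4 * j%:R * 8 ^+ j + 32) <= K by rewrite /K; move: t3; clear; lra.
have K1 : 1 <= K by move: K9; clear; lra.
have c1E : c1 = 482 * j.+1%:R * 3 ^+ j.+1 by [].
have gE : g = 40 ^+ j.+1 * 640 * 2 ^+ j by [].
clearbody K c1 g; exists (K * c1 * g); split; first by rewrite !mulr_ege1.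
move=> D p q f eta v sp sq hp hq /andP[v0 v1] heta hfp hfq.
have [E0 E0def] : exists E, E = quotient_const R j D by eexists.
have E0E : E0 = c1 * g ^+ D by rewrite E0def c1E gE.

have gD1 : 1 <= g ^+ D by rewrite exprn_ege1.
have E01 : 1 <= E0 by rewrite E0E mulr_ege1.
have BE : K * E0 <= (K * c1 * g) ^+ D.+1.
  rewrite E0E mulrA exprMn; apply: ler_pM; rewrite ?mulr_ge0 ?exprn_ge0 ?(le_trans ler01) //.
    by rewrite -[leLHS]expr1 ler_weXn2l // mulr_ege1.
  by rewrite ler_weXn2l.
set BD := _ ^+ D.+1 in heta BE *.
have BD1 : 1 <= BD by apply: le_trans BE; rewrite mulr_ege1.
have eta0 : 0 <= eta by apply: le_trans (cnorm_ge0 _) (hfp 0 _); rewrite normr0.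
have E0eta : E0 * eta <= v ^+ (2 * j * j * j.+1).
  apply: le_trans heta; rewrite ler_wpM2r //; apply: le_trans BE.
  by rewrite ler_peMl // (le_trans ler01).
have etav : eta <= v.
  apply: le_trans (_ : E0 * eta <= _); first by rewrite ler_peMl.
  by apply: le_trans E0eta _; rewrite -[leRHS]expr1 ler_wiXn2l ?muln_gt0 ?j0 // ltW.
have real8 (x : R) : `|x| <= 1 -> cnorm x%:C%C <= 8 by rewrite cnorm_real; clear; lra.
have p2 z : cnorm z <= 8 -> cnorm p.[z] <= 2.
  move=> hz; rewrite -[leRHS]mulr1; apply: (geometric_poly_bound (b := 16^-1)).
  - by rewrite invr_ge0.
  - by move=> k; rewrite mul1r.
  - by move: hz; clear; lra.
have q2 z : cnorm z <= 8 -> cnorm q.[z] <= 2.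
  move=> hz; rewrite -[leRHS]mulr1; apply: (geometric_poly_bound (b := 16^-1)).
  - by rewrite invr_ge0.
  - by move=> k; rewrite mul1r.
  - by move: hz; clear; lra.
have fj3 x : `|x| <= 1 -> cnorm (f x ^+ j) <= 3.
  move=> hx; have := cnorm_geB (f x ^+ j) p.[x%:C%C].
  by move: (hfp _ hx) (p2 _ (real8 _ hx)) etav v1; clear; lra.
have f3 x : `|x| <= 1 -> cnorm (f x) <= 3.
  move=> hx; rewrite -(@ler_pXn2r _ j) ?nnegrE ?cnorm_ge0 // -cnormX.
  apply: le_trans (fj3 _ hx) _.
  by rewrite -(prednK j0) exprS ler_peMr // exprn_ege1 // ler1n.
have v0' := ltW v0.
(* If [E0 * v > 1], the bound to be proved exceeds [3 ^ (j + 1)] and [F = 0] satisfies it. *)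
have [hE|hE] := leP (E0 * v) 1; last first.
  exists 0; split=> [k|x hx]; first by rewrite coef0 cnorm0.
  rewrite horner0 subr0; apply: le_trans (_ : 3 ^+ j.+1 <= _).
    by rewrite lerXn2r ?nnegrE ?cnorm_ge0 ?f3.
  apply: le_trans (_ : K * (E0 * v) <= _); last by rewrite mulrA ler_wpM2r.
  by apply: le_trans K3 _; rewrite ler_peMr ?(le_trans ler01) // ltW.
(* On the real interval [q ^ j] and [p ^ (j + 1)] are both close to [f ^ (j (j + 1))]; extrapolation
   carries their closeness to the complex disc, where [f] is not defined. *)
have hd z : cnorm z <= 8 -> cnorm (q.[z] ^+ j - p.[z] ^+ j.+1) <= v ^+ (2 * j * j * j.+1).
  move=> hz; apply: le_trans E0eta.
  have -> : q.[z] ^+ j - p.[z] ^+ j.+1 = (q ^+ j - p ^+ j.+1).[z].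
    by rewrite hornerD hornerN !horner_exp.
  have := @extrapolate _ (j.+1 * D) (q ^+ j - p ^+ j.+1) 0 (2 * (j.+1%:R * 3 ^+ j.+1) * eta).
  move=> /(_ _ _ z) h; apply: le_trans (h _ _ _) _.
  - apply: leq_trans (size_polyD _ _) _; rewrite geq_max size_polyN size_exp_bound // andbT.
    by apply: leq_trans (size_exp_bound j sq) _; rewrite ltnS mulSn leq_addl.
  - move=> x; rewrite subr0 => hx; rewrite hornerD hornerN !horner_exp.
    set z' := x%:C%C.
    have h1 : cnorm (q.[z'] ^+ j - (f x ^+ j.+1) ^+ j) <= j.+1%:R * 3 ^+ j.+1 * eta.
      have a1 : cnorm q.[z'] <= 3 by have := q2 _ (real8 _ hx); clear; lra.
      have a2 : cnorm (f x ^+ j.+1) <= 3.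
        have := cnorm_geB (f x ^+ j.+1) q.[z'].
        by move: (hfq _ hx) (q2 _ (real8 _ hx)) etav v1; clear; lra.
      apply: le_trans (cnorm_subX j a1 a2 _) _; first by rewrite ler1n.
      apply: ler_pM; rewrite ?mulr_ge0 ?exprn_ge0 ?cnorm_ge0 //.
        by rewrite ler_pM ?exprn_ge0 ?ler_nat // ler_weXn2l // ler1n.
      by rewrite cnorm_dist hfq.
    have h2 : cnorm ((f x ^+ j) ^+ j.+1 - p.[z'] ^+ j.+1) <= j.+1%:R * 3 ^+ j.+1 * eta.
      have a1 : cnorm p.[z'] <= 3 by have := p2 _ (real8 _ hx); clear; lra.
      apply: le_trans (cnorm_subX j.+1 (fj3 _ hx) a1 _) _; first by rewrite ler1n.
      by apply: ler_wpM2l; rewrite ?mulr_ge0 ?exprn_ge0 ?hfp.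
    have -> : q.[z'] ^+ j - p.[z'] ^+ j.+1 =
      (q.[z'] ^+ j - (f x ^+ j.+1) ^+ j) + ((f x ^+ j) ^+ j.+1 - p.[z'] ^+ j.+1).
      by rewrite -!exprM mulnC addrA subrK.
    by apply: le_trans (cnorm_leD h1 h2) _; clear; lra.
  - by rewrite subr0.
  rewrite mulrA ler_wpM2r // E0E mulrC; apply: ler_pM; rewrite ?mulr_ge0 ?exprn_ge0 //.
    by rewrite c1E -mulrA; move: cj1; clear; lra.
  by rewrite exprM lerXn2r ?nnegrE ?exprn_ge0 ?(le_trans ler01 g1) // gE -mulrA ler_peMr ?exprn_ge0 // mulr_ege1 ?exprn_ege1 ?ler1n.
rewrite E0def in hE.
have [w [hw hcase]] := approx_quotient j0 sp sq hp hq (introT andP (conj v0 v1)) hd hE.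
have real1 (x : R) : `|x| <= 1 -> cnorm x%:C%C <= 1 by rewrite cnorm_real.
(* In the first alternative [p - w], and with it [f ^ j], is of size [E0 * v], so [F = 0] is close
   enough. *)
case: hcase => [h|[F hF]].
  exists 0; split=> [k|x hx]; first by rewrite coef0 cnorm0.
  rewrite horner0 subr0 exprSr -cnormX.
  apply: le_trans (_ : (K * E0) * v <= _); last by rewrite ler_wpM2r.
  apply: le_trans (_ : ((E0 + 2) * v) * 3 <= _).
    apply: ler_pM; rewrite ?cnorm_ge0 ?f3 //.
    have := cnorm_geB (f x ^+ j) p.[x%:C%C]; have := cnorm_geB p.[x%:C%C] w.
    by move: (hfp _ hx) (h _ (real1 _ hx)) etav hw; rewrite -E0def; clear; lra.
  rewrite mulrAC ler_wpM2r //; apply: le_trans (_ : 9 * E0 <= _).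
    by move: E01; clear; lra.
  by rewrite ler_wpM2r // (le_trans ler01).
exists F; split.
  by apply: cauchy_estimate => z hz; have [] := hF z hz.
move=> x hx; have [F8 hFj hFq] := hF _ (real1 _ hx); rewrite -E0def in hFj hFq.
set z := x%:C%C in F8 hFj hFq *.
pose e := (2 + 4 * j%:R * 8 ^+ j + 32) * (E0 * v).
have f8 : cnorm (f x) <= 8 by have := f3 _ hx; clear; lra.
have vE : v <= E0 * v by rewrite ler_peMl.
have E0v0 : 0 <= E0 * v by rewrite mulr_ge0 // (le_trans ler01).
have t5 : 4 * j%:R * 8 ^+ j * v <= 4 * j%:R * 8 ^+ j * (E0 * v) by rewrite ler_wpM2l.
have gen (a b c : C) : a - b = (a - c) - (b - c) by ring.
have h1 : cnorm (F.[z] ^+ j - f x ^+ j) <= e.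
  rewrite (gen _ _ (p.[z] - w)) -[f x ^+ j - _]opprB opprK.
  have -> : p.[z] - w - f x ^+ j = - ((f x ^+ j - p.[z]) + w) by ring.
  apply: le_trans (cnorm_leD hFj (_ : _ <= eta + v)) _.
    by rewrite cnormN; apply: cnorm_leD hw; apply: hfp.
  by rewrite /e; move: vE E0v0 t5 etav; clear; lra.
have h2 : cnorm (f x ^+ j * (f x - F.[z])) <= e.
  have -> : f x ^+ j * (f x - F.[z]) = (f x ^+ j.+1 - q.[z]) +
     ((q.[z] - (p.[z] - w) * F.[z]) - ((f x ^+ j - p.[z]) + w) * F.[z]).
    by rewrite exprSr; ring.
  apply: le_trans (cnorm_leD (hfq _ hx) (cnorm_leB hFq (cnorm_leM (cnorm_leD (hfp _ hx) hw) F8))) _.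
  have t6 : 0 <= 4 * j%:R * 8 ^+ j * (E0 * v) by rewrite mulr_ge0.
  by rewrite /e; move: vE E0v0 t6 etav; clear; lra.
have e0 : 0 <= e by apply: le_trans h1; exact: cnorm_ge0.
apply: le_trans (dist_pow_bound f8 F8 _ e0 h1 h2) _; first by rewrite ler1n.
apply: le_trans (_ : (K * E0) * v <= _); last by rewrite ler_wpM2r.
have -> : 2 ^+ j * (2 + 2 * 8) * e = 2 ^+ j * 18 * (2 + 4 * j%:R * 8 ^+ j + 32) * (E0 * v).
  by rewrite /e; ring.
by rewrite -[leRHS]mulrA ler_wpM2r.
Qed.
End ApproximateRoot.

(** * Transfer to the complex numbers of Coquelicot *)

Definition toc (z : CC.C) : R[i] := Complex (fst z) (snd z).

Definition ofc (z : R[i]) : CC.C := (complex.Re z, complex.Im z).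

Lemma ofcK z : toc (ofc z) = z. Proof. by case: z. Qed.

Lemma tocD a b : toc (CC.Cplus a b) = toc a + toc b. Proof. by case: a b => [a1 a2] [b1 b2]. Qed.

Lemma tocN a : toc (CC.Copp a) = - toc a. Proof. by case: a => [a1 a2]. Qed.

Lemma tocB a b : toc (CC.Cminus a b) = toc a - toc b. Proof. by rewrite /CC.Cminus tocD tocN. Qed.

Lemma tocM a b : toc (CC.Cmult a b) = toc a * toc b.
Proof. by case: a b => [a1 a2] [b1 b2]; rewrite /CC.Cmult /toc /=; congr Complex; rewrite RplusE addrC. Qed.

Lemma tocR (x : R) : toc (CC.RtoC x) = x%:C%C. Proof. by []. Qed.

Lemma toc_pow a n : toc (CC.Cpow a n) = toc a ^+ n.
Proof. by elim: n => [|n IH] //; rewrite exprS -IH -tocM. Qed.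

Lemma toc_Cmod a : cnorm (toc a) = CC.Cmod a.
Proof. by case: a => [a1 a2]; rewrite /CC.Cmod RsqrtE !RpowE. Qed.

Lemma toc_psum c x m : toc (psum c x m) = (\poly_(k < m) toc (c k)).[x%:C%C].
Proof.
rewrite horner_poly; elim: m => [|m IH]; first by rewrite big_ord0.
by rewrite big_ord_recr /= tocD tocM IH tocR RpowE rmorphXn.
Qed.

Lemma psum_ofc (P : {poly R[i]}) (x : R) :
  toc (psum (fun k => ofc P`_k) x (size P)) = P.[x%:C%C].
Proof.
rewrite toc_psum; congr horner; rewrite -[RHS]coefK.
by apply/polyP => k; rewrite !coef_poly ofcK.
Qed.

Lemma psum_coef_bound (c : nat -> CC.C) (m : nat) (M : R) :
  (forall x, Rle (Rabs x) (IZR 1) -> Rle (CC.Cmod (psum c x m)) M) ->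
  forall k, Peano.lt k m -> Rle (CC.Cmod (c k)) (Rmult (pow (IZR 40) m) M).
Proof.
move=> h k /ssrnat.ltP km; apply/RleP; rewrite -toc_Cmod.
have M0 : 0 <= M by apply/RleP; apply: Rle_trans (h 0 _); [exact: CC.Cmod_ge_0 | rewrite Rabs_R0; exact: Rle_0_1].
have := @coef_bound_interval _ m (\poly_(k < m) toc (c k)) M.
rewrite (leq_trans (size_poly _ _)) // => /(_ isT _ k).
rewrite coef_poly km RpowE => H.
have -> : IZR 40 = 40%:R by rewrite IZRposE INRE.
apply: H => x /RleP hx; rewrite -toc_psum toc_Cmod; apply/RleP; exact: h.
Qed.

(** A polynomial of degree at most [i + 1] expanded around [h] has [c i + (i + 1) * c (i + 1) * h]
    as coefficient of order [i]. With [M] of order [|h| ^ (i + 2)] the conclusion is a difference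
    quotient with quadratic error. *)
Lemma psum_recenter (c d : nat -> CC.C) (i : nat) (h M : R) : Rlt (IZR 0) (Rabs h) ->
  (forall y, Rle (Rabs y) (Rabs h) ->
     Rle (CC.Cmod (CC.Cminus (psum c (Rplus h y) i.+2) (psum d y i.+2))) M) ->
  Rle (Rmult (CC.Cmod (CC.Cminus (CC.Cplus (c i) (CC.Cmult (c i.+1) (CC.RtoC (Rmult (INR i.+1) h)))) (d i)))
       (pow (Rabs h) i)) (Rmult (pow (IZR 40) i.+2) M).
Proof.
move=> h0 hM; set t := Rabs h in h0 hM *.
pose P := \poly_(k < i.+2) toc (c k).
pose U := \poly_(l < i.+2) ((P^`N(l).[h%:C%C] - toc (d l)) * t%:C%C ^+ l).
have sP : (size P <= i.+2)%N by exact: size_poly.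
have UE (y : R) : U.[y%:C%C] = P.[(h + t * y)%:C%C] - (\poly_(k < i.+2) toc (d k)).[(t * y)%:C%C].
  rewrite rmorphD (@nderiv_taylor_wide _ i.+2) //; last exact: mulrC.
  rewrite /U !horner_poly -sumrB; apply: eq_bigr => l _.
  by rewrite -mulrBl rmorphM exprMn mulrA.
have hU (y : R) : `|y| <= 1 -> cnorm U.[y%:C%C] <= M.
  move=> hy; rewrite UE -!toc_psum -tocB toc_Cmod; apply/RleP.
  apply: hM; apply/RleP; rewrite RabsE normrM (ger0_norm (x := t)).
    by rewrite ler_piMr // ltW //; apply/RltP.
  by apply: ltW; apply/RltP.
have := @coef_bound_interval _ i.+2 U M (leq_trans (size_poly _ _) (leqnSn _)) hU i.
rewrite coef_poly ltnW //.
have -> : P^`N(i).[h%:C%C] = toc (c i) + toc (c i.+1) * (i.+1%:R * h)%:C%C.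
  have s2 : (size (P^`N(i)) <= 2)%N.
    by apply/leq_sizeP => l hl; rewrite coef_nderivn nth_default ?mul0rn // (leq_trans sP) // -addn2 leq_add2l.
  rewrite (horner_coef_wide _ s2) big_ord_recl big_ord1 expr0 mulr1 !coef_nderivn expr1.
  rewrite addn0 binn mulr1n addn1 binSn !coef_poly ltnSn ltnW //.
  by rewrite rmorphM rmorph_nat mulrA mulr_natr.
rewrite -[in X in X -> _]tocR.
rewrite cnormM cnormX cnorm_real.
have -> : `|t| = t by rewrite ger0_norm //; apply/ltW/RltP.
rewrite -[i.+1%:R]INRE -tocM -tocD -tocB toc_Cmod -!RpowE => H.
have -> : IZR 40 = 40%:R by rewrite IZRposE INRE.
exact/RleP.
Qed.

Theorem psum_approx_root (j : nat) : Peano.le 1 j -> exists B : R, Rle (IZR 1) B /\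
  forall D (p q : nat -> CC.C) (f : R -> CC.C) (eta v : R),
  (forall k, Rle (CC.Cmod (p k)) (pow (Rinv (IZR 16)) k)) -> (forall k, Rle (CC.Cmod (q k)) (pow (Rinv (IZR 16)) k)) ->
  Rlt (IZR 0) v -> Rle v (IZR 1) ->
  Rle (Rmult (pow B D.+1) eta) (pow v (Nat.mul (Nat.mul (Nat.mul 2 j) j) j.+1)) ->
  (forall x, Rle (Rabs x) (IZR 1) -> Rle (CC.Cmod (CC.Cminus (CC.Cpow (f x) j) (psum p x D.+1))) eta) ->
  (forall x, Rle (Rabs x) (IZR 1) -> Rle (CC.Cmod (CC.Cminus (CC.Cpow (f x) j.+1) (psum q x D.+1))) eta) ->
  exists m F, (forall k, Rle (CC.Cmod (F k)) (IZR 8)) /\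
    forall x, Rle (Rabs x) (IZR 1) -> Rle (pow (CC.Cmod (CC.Cminus (f x) (psum F x m))) j.+1) (Rmult (pow B D.+1) v).
Proof.
move=> /ssrnat.leP j0; have [B [B1 hB]] := @approx_root R j j0.
exists B; split; first exact/RleP.
move=> D p q f eta v hp hq v0 v1 he hfp hfq.
pose P (p : nat -> CC.C) : {poly R[i]} := \poly_(k < D.+1) toc (p k).
have i16 : Rinv (IZR 16) = 16^-1 by rewrite RinvE IZRposE INRE.
have hP p0 : (forall k, Rle (CC.Cmod (p0 k)) (pow (Rinv (IZR 16)) k)) -> forall k, cnorm (P p0)`_k <= 16^-1 ^+ k.
  move=> h k; rewrite coef_poly; case: ifP => _; last by rewrite cnorm0 exprn_ge0 ?invr_ge0.
  by rewrite toc_Cmod -i16 -RpowE; apply/RleP.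
have hf p0 n : (forall x, Rle (Rabs x) (IZR 1) -> Rle (CC.Cmod (CC.Cminus (CC.Cpow (f x) n) (psum p0 x D.+1))) eta) ->
   forall x : R, `|x| <= 1 -> cnorm (toc (f x) ^+ n - (P p0).[x%:C%C]) <= eta.
  by move=> h x /RleP hx; rewrite -toc_psum -toc_pow -tocB toc_Cmod; apply/RleP; apply: h.
have v01 : 0 < v <= 1 by apply/andP; split; [apply/RltP|apply/RleP].
have he' : B ^+ D.+1 * eta <= v ^+ (2 * j * j * j.+1)%N by rewrite -!RpowE; apply/RleP.
have [F [F8 hF]] := hB D (P p) (P q) (fun x => toc (f x)) eta v (size_poly _ _) (size_poly _ _)
  (hP _ hp) (hP _ hq) v01 he' (hf _ _ hfp) (hf _ _ hfq).
exists (size F), (fun k => ofc F`_k); split=> [k|x /RleP hx].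
  by rewrite -toc_Cmod ofcK; apply/RleP; rewrite IZRposE INRE; apply: F8.
rewrite -toc_Cmod tocB psum_ofc !RpowE; apply/RleP; exact: hF.
Qed.
End PolynomialRoots.

Notation psum := PolynomialRoots.psum.

(** * Weight functions *)

(** The weight matrix of [w]. By [Mw_upper] and [Mw_least] it is the supremum over [r >= 1] of
    [r ^ n * exp (- w r / rho)], the form in which it is used. *)
Definition Mw (w : R -> R) (rho : R) (n : nat) : R := exp (phi_star w (rho * INR n) / rho).

Lemma exp_le_mono x y : x <= y -> exp x <= exp y.
Proof. intros [h | ->]; [left; now apply exp_increasing | lra]. Qed.

Lemma pow_exp x n : 0 < x -> x ^ n = exp (INR n * ln x).
Proof. intros hx; rewrite <- (exp_ln (x ^ n)) by now apply pow_lt. now rewrite ln_pow. Qed.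

Lemma pow_div_fact_le_exp x k : 0 <= x -> x ^ k / INR (fact k) <= exp x.
Proof.
intros hx.
assert (H : is_series (fun n => x ^ n / INR (fact n)) (exp x)).
{ pose proof (is_exp_Reals x) as h; apply is_pseries_R in h.
  revert h; apply is_series_ext; intros n. unfold Rdiv; apply Rmult_comm. }
assert (pos : forall n, 0 <= x ^ n / INR (fact n)).
{ intros n; apply Rdiv_le_0_compat; [now apply pow_le | apply lt_0_INR, lt_O_fact]. }
apply Rle_trans with (sum_n (fun n => x ^ n / INR (fact n)) k).
- destruct k; [rewrite sum_O; lra |].
  rewrite sum_Sn; change plus with Rplus.
  assert (0 <= sum_n (fun n => x ^ n / INR (fact n)) k).
  { rewrite sum_n_Reals; now apply cond_pos_sum. }
  lra.
- rewrite sum_n_Reals. apply sum_incr; [|exact pos].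
  now apply is_series_Reals in H.
Qed.

Section Weight.
Variable w : R -> R.
Hypothesis Hw : weight_function w.

Lemma w_nonneg t : 0 <= t -> 0 <= w t.
Proof. apply Hw. Qed.

Lemma w_mono s t : 0 <= s -> s <= t -> w s <= w t.
Proof. apply Hw. Qed.

Lemma w_log eps : 0 < eps -> exists T, 1 <= T /\ forall t, T <= t -> ln t <= eps * w t.
Proof.
intros he; destruct Hw as (h0 & _ & _ & _ & _ & h & _).
destruct (h eps he) as [T hT]; exists (Rmax 1 T); split; [apply Rmax_l|].
intros t ht. assert (T <= t /\ 1 <= t) as [h1 h2].
{ split; (eapply Rle_trans; [|exact ht]); [apply Rmax_r | apply Rmax_l]. }
specialize (hT t h1). rewrite (Rabs_right (w t)) in hT by (apply Rle_ge, h0; lra).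
pose proof (Rle_abs (ln t)); lra.
Qed.

Lemma w_unbounded L : exists T, 1 <= T /\ forall t, T <= t -> L <= w t.
Proof.
destruct (w_log 1 Rlt_0_1) as [T [hT h]].
exists (Rmax T (exp L)); split; [apply Rle_trans with T; [lra | apply Rmax_l] |].
intros t ht. pose proof (Rmax_l T (exp L)); pose proof (Rmax_r T (exp L)).
specialize (h t ltac:(lra)).
assert (L <= ln t); [|lra].
rewrite <- (ln_exp L); apply ln_le; [apply exp_pos | lra].
Qed.

(** Since [ln t = o(w t)], one has [(s + 1) t <= phi_w t] for large [t], so the least upper bound is
    finite; for an infinite one [real] would return a meaningless 0. *)
Lemma phi_star_spec s : 0 <= s ->
  (forall t, 0 <= t -> s * t - phi_w w t <= phi_star w s) /\
  (forall b, (forall t, 0 <= t -> s * t - phi_w w t <= b) -> phi_star w s <= b).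
Proof.
intros hs. unfold phi_star. set (E := fun y => _).
destruct (Lub_Rbar_correct E) as [ub lub].
destruct (w_log (/ (s + 1))) as [T [T1 hT]]; [apply Rinv_0_lt_compat; lra|].
assert (bnd : forall y, E y -> y <= s * ln T).
{ intros y [t [ht ->]]. unfold phi_w.
  destruct (Rle_lt_dec T (exp t)) as [h | h].
  - specialize (hT _ h); rewrite ln_exp in hT.
    assert (hle : (s + 1) * t <= w (exp t)).
    { replace (w (exp t)) with ((s + 1) * (/ (s + 1) * w (exp t))) by (field; lra).
      apply Rmult_le_compat_l; lra. }
    assert (0 <= s * ln T).
    { apply Rmult_le_pos; [lra|]. rewrite <- ln_1; apply ln_le; lra. }
    lra.
  - assert (t <= ln T).
    { rewrite <- (ln_exp t); apply ln_le; [apply exp_pos | lra]. }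
    assert (s * t <= s * ln T) by (apply Rmult_le_compat_l; lra).
    assert (0 <= w (exp t)) by (apply w_nonneg, Rlt_le, exp_pos). lra. }
assert (hub : Rbar_le (Lub_Rbar E) (s * ln T)) by (apply lub; intros y hy; apply bnd, hy).
assert (E0 : E (s * 0 - phi_w w 0)) by (exists 0; split; [lra | reflexivity]).
pose proof (ub _ E0) as hlb.
destruct (Lub_Rbar E) as [l | |]; simpl in *; try contradiction.
split.
- intros t ht; apply (ub (s * t - phi_w w t)); exists t; now split.
- intros b hb; apply (lub (Finite b)); intros y [t [ht ->]]; simpl; now apply hb.
Qed.

Lemma Mw_upper rho n r : 0 < rho -> 1 <= r -> r ^ n * exp (- w r / rho) <= Mw w rho n.
Proof.
intros hr h1. rewrite pow_exp by lra. rewrite <- exp_plus. apply exp_le_mono.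
destruct (phi_star_spec (rho * INR n)) as [h _].
{ apply Rmult_le_pos; [lra | apply pos_INR]. }
assert (0 <= ln r) by (rewrite <- ln_1; apply ln_le; lra).
specialize (h (ln r) H); unfold phi_w in h; rewrite exp_ln in h by lra.
apply Rmult_le_reg_l with rho; [lra|].
replace (rho * (phi_star w (rho * INR n) / rho)) with (phi_star w (rho * INR n)) by (field; lra).
replace (rho * (INR n * ln r + - w r / rho)) with (rho * INR n * ln r - w r) by (field; lra).
exact h.
Qed.

Lemma Mw_least rho n K : 0 < rho -> (forall r, 1 <= r -> r ^ n * exp (- w r / rho) <= K) ->
  Mw w rho n <= K.
Proof.
intros hr h. assert (K0 : 0 < K).
{ eapply Rlt_le_trans; [|apply (h 1); lra]. rewrite pow1, Rmult_1_l; apply exp_pos. }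
rewrite <- (exp_ln K K0). apply exp_le_mono.
apply Rmult_le_reg_l with rho; [lra|].
replace (rho * (phi_star w (rho * INR n) / rho)) with (phi_star w (rho * INR n)) by (field; lra).
apply phi_star_spec; [apply Rmult_le_pos; [lra | apply pos_INR]|].
intros t ht. unfold phi_w.
assert (he : 1 <= exp t) by (rewrite <- exp_0; now apply exp_le_mono).
specialize (h _ he). rewrite pow_exp, ln_exp, <- exp_plus in h by lra.
apply ln_le in h; [|apply exp_pos]. rewrite ln_exp in h.
replace (rho * INR n * t - w (exp t)) with (rho * (INR n * t + - w (exp t) / rho)) by (field; lra).
apply Rmult_le_compat_l; lra.
Qed.

Lemma Mw_pos rho n : 0 < Mw w rho n.
Proof. apply exp_pos. Qed.

Lemma Mw_mono rho rho' n : 0 < rho -> rho <= rho' -> Mw w rho n <= Mw w rho' n.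
Proof.
intros h0 h. apply Mw_least; [lra|]. intros r hr.
eapply Rle_trans; [|apply (Mw_upper rho' n r); lra].
apply Rmult_le_compat_l; [apply pow_le; lra|]. apply exp_le_mono.
unfold Rdiv. assert (0 <= w r) by (apply w_nonneg; lra).
assert (/ rho' <= / rho) by (apply Rinv_le_contravar; lra). nra.
Qed.

Hypothesis Hc : concave_nonneg w.

Lemma w_concave_scale A r : 1 <= A -> 0 <= r -> w (A * r) <= A * w r.
Proof.
intros hA hr.
assert (hi : 0 < / A <= 1).
{ split; [apply Rinv_0_lt_compat; lra | rewrite <- Rinv_1; apply Rinv_le_contravar; lra]. }
assert (h := Hc (A * r) 0 (/ A) ltac:(nra) (Rle_refl 0) ltac:(lra)).
replace (/ A * (A * r) + (1 - / A) * 0) with r in h by (field; lra).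
assert (0 <= w 0) by (apply w_nonneg; lra).
assert (h2 : / A * w (A * r) <= w r) by nra.
replace (w (A * r)) with (A * (/ A * w (A * r))) by (field; lra).
apply Rmult_le_compat_l; lra.
Qed.

(** Substituting [A * r] for [r] in the supremum. This is how a geometric factor [A ^ n] is absorbed
    by a larger [rho]. *)
Lemma Mw_scale A rho n : 1 <= A -> 0 < rho -> A ^ n * Mw w rho n <= Mw w (A * rho) n.
Proof.
intros hA hr. assert (An : 0 < A ^ n) by (apply pow_lt; lra).
assert (h : Mw w rho n <= Mw w (A * rho) n / A ^ n).
{ apply Mw_least; [lra|]. intros r h1.
  apply Rmult_le_reg_l with (A ^ n); [lra|].
  replace (A ^ n * (Mw w (A * rho) n / A ^ n)) with (Mw w (A * rho) n) by (field; lra).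
  eapply Rle_trans; [|apply (Mw_upper (A * rho) n (A * r)); nra].
  rewrite Rpow_mult_distr, Rmult_assoc.
  apply Rmult_le_compat_l; [lra|]. apply Rmult_le_compat_l; [apply pow_le; lra|].
  apply exp_le_mono. pose proof (w_concave_scale A r hA ltac:(lra)).
  replace (- w r / rho) with (- (A * w r) / (A * rho)) by (field; lra).
  unfold Rdiv. apply Rmult_le_compat_r; [|lra].
  left; apply Rinv_0_lt_compat; nra. }
replace (Mw w (A * rho) n) with (A ^ n * (Mw w (A * rho) n / A ^ n)) by (field; lra).
apply Rmult_le_compat_l; lra.
Qed.

(** [s] is a supergradient of [w] at [t]; it replaces the derivative, which need not exist. *)
Definition tangent (s t : R) := 0 <= t /\ forall r, 0 <= r -> w r <= w t + s * (r - t).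

Lemma exists_tangent s : 0 < s -> exists t, tangent s t.
Proof.
intros hs. destruct Hw as (_ & hcont & _ & _ & ho & _).
destruct (ho s hs) as [T hT].
set (b := Rmax 0 T).
assert (hb : 0 <= b) by apply Rmax_l.
(* Continuity of [w] is known only from the right at 0; the even extension makes it two-sided
   there. *)
set (F := fun r => w (Rabs r) - s * r).
assert (cF : forall c, 0 <= c <= b -> continuity_pt F c).
{ intros c hc. apply continuity_pt_minus.
  - intros e he. destruct (hcont (Rabs c) (Rabs_pos c) e he) as [d [hd h]].
    exists d; split; [lra|]. intros x [_ hx]. simpl in *. unfold Rdist in *.
    apply h; [apply Rabs_pos|].
    eapply Rle_lt_trans; [apply Rabs_triang_inv2 | exact hx].
  - apply derivable_continuous_pt. reg. }
destruct (continuity_ab_maj F 0 b hb cF) as [t [ht htb]].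
exists t; split; [lra|]. intros r hr.
assert (Fpos : forall x, 0 <= x -> F x = w x - s * x).
{ intros x hx; unfold F; now rewrite Rabs_right by lra. }
destruct (Rle_lt_dec r b) as [h|h].
- specialize (ht r ltac:(lra)). rewrite !Fpos in ht by lra. lra.
- specialize (ht 0 ltac:(lra)). rewrite !Fpos in ht by lra.
  assert (T <= r) by (unfold b in h; pose proof (Rmax_r 0 T); lra).
  specialize (hT r H). rewrite !Rabs_right in hT; try lra.
  + pose proof (w_nonneg 0 (Rle_refl 0)). lra.
  + apply Rle_ge, w_nonneg; lra.
Qed.

(** The tangent inequality at [r = 0] and at [r = 1 / s]. The second bound makes [w t] tend to
    infinity as [s] tends to 0. *)
Lemma tangent_lower_bounds s t : 0 < s -> tangent s t -> s * t <= w t /\ w (/ s) - 1 <= w t.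
Proof.
intros hs [ht h]. split.
- pose proof (h 0 (Rle_refl 0)). pose proof (w_nonneg 0 (Rle_refl 0)). lra.
- assert (0 < / s) by now apply Rinv_0_lt_compat.
  pose proof (h (/ s) ltac:(lra)). replace (s * (/ s - t)) with (1 - s * t) in H0 by (field; lra).
  assert (0 <= s * t) by (apply Rmult_le_pos; lra). lra.
Qed.

Lemma tangent_large L : exists s0, 0 < s0 /\ forall s t, 0 < s <= s0 -> tangent s t -> L < t /\ L < w t.
Proof.
set (L' := Rmax 0 L).
destruct (w_unbounded (w L' + Rmax 0 L + 2)) as [T [T1 hT]].
exists (/ T). split; [apply Rinv_0_lt_compat; lra|].
intros s t [s0 sT] htan.
destruct (tangent_lower_bounds s t s0 htan) as [_ h].
assert (T <= / s).
{ rewrite <- (Rinv_inv T). apply Rinv_le_contravar; lra. }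
specialize (hT _ H). pose proof (Rmax_r 0 L). pose proof (Rmax_l 0 L).
pose proof (w_nonneg L' (Rmax_l 0 L)).
split; [|lra].
destruct (Rle_lt_dec t L) as [h'|]; [|assumption].
exfalso. assert (w t <= w L').
{ apply w_mono; [apply htan|]. unfold L'; lra. }
lra.
Qed.

(* Convexity of [phi_w] together with the upper tangent at [t] forces the lower
   logarithmic tangent: [w] is squeezed between the two, so both slopes agree. *)
Lemma tangent_log_lower s t r : 0 < s -> tangent s t -> 1 < t -> 1 <= r ->
  w t + s * t * ln (r / t) <= w r.
Proof.
intros hs [_ htan] ht hr.
destruct Hw as (_ & _ & _ & _ & _ & _ & hconv).
set (u0 := ln t). set (u := ln r).
assert (hu0 : 0 < u0) by (unfold u0; rewrite <- ln_1; apply ln_increasing; lra).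
assert (hu : 0 <= u) by (unfold u; rewrite <- ln_1; apply ln_le; lra).
replace (ln (r / t)) with (u - u0) by (unfold u, u0; rewrite ln_div by lra; reflexivity).
assert (ew : w r = phi_w w u) by (unfold phi_w, u; now rewrite exp_ln by lra).
assert (et : w t = phi_w w u0) by (unfold phi_w, u0; now rewrite exp_ln by lra).
assert (hst : 0 < s * t) by nra.
rewrite ew, et in *.
set (d := u - u0).
(* Convexity with [u0] placed between [u] and [u0 - h * d], a point slightly beyond [u0] where the
   tangent bounds [phi_w] from above. The error is quadratic in [h], so after division by [h] it
   vanishes as [h] tends to 0. *)
assert (key : forall h, 0 < h -> h * Rabs d <= / 2 -> h * Rabs d <= u0 ->
   s * t * d - 2 * h * (s * t * (d * d)) <= phi_w w u - phi_w w u0).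
{ intros h h0 h1 h2.
  assert (hd : - (h * Rabs d) <= h * d <= h * Rabs d).
  { pose proof (Rle_abs d). pose proof (Rle_abs (- d)). rewrite Rabs_Ropp in H0. nra. }
  assert (hth : 0 <= h / (1 + h) <= 1).
  { split; [apply Rdiv_le_0_compat; lra|]. apply Rle_div_l; lra. }
  pose proof (hconv u (u0 - h * d) (h / (1 + h)) hu ltac:(lra) hth) as hc.
  replace (h / (1 + h) * u + (1 - h / (1 + h)) * (u0 - h * d)) with u0 in hc
    by (unfold d; field; lra).
  assert (hc' : (1 + h) * phi_w w u0 <= h * phi_w w u + phi_w w (u0 - h * d)).
  { apply Rmult_le_compat_l with (r := 1 + h) in hc; [|lra].
    replace ((1 + h) * (h / (1 + h) * phi_w w u + (1 - h / (1 + h)) * phi_w w (u0 - h * d)))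
      with (h * phi_w w u + phi_w w (u0 - h * d)) in hc by (field; lra). exact hc. }
  assert (hh : phi_w w (u0 - h * d) <= phi_w w u0 + s * t * (exp (- (h * d)) - 1)).
  { unfold phi_w. unfold Rminus at 1. rewrite exp_plus. unfold u0; rewrite exp_ln by lra.
    pose proof (exp_pos (- (h * d))).
    pose proof (htan (t * exp (- (h * d))) ltac:(nra)). lra. }
  assert (he : exp (- (h * d)) - 1 <= - (h * d) + 2 * (h * d * (h * d))).
  { pose proof (exp_ineq1_le (h * d)).
    assert (exp (- (h * d)) * exp (h * d) = 1).
    { rewrite <- exp_plus. replace (- (h * d) + h * d) with 0 by ring. apply exp_0. }
    pose proof (exp_pos (- (h * d))).
    set (y := h * d) in *. set (E := exp (- y)) in *.
    assert (E * (1 + y) <= 1) by nra.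
    assert (1 <= (1 - y + 2 * (y * y)) * (1 + y)).
    { replace ((1 - y + 2 * (y * y)) * (1 + y)) with (1 + y * y * (1 + 2 * y)) by ring.
      assert (0 <= y * y) by nra. nra. }
    nra. }
  assert (s * t * (exp (- (h * d)) - 1) <= s * t * (- (h * d) + 2 * (h * d * (h * d)))).
  { apply Rmult_le_compat_l; lra. }
  apply Rmult_le_reg_l with h; [lra|]. lra. }
destruct (Rle_lt_dec (phi_w w u0 + s * t * d) (phi_w w u)) as [|hlt]; [assumption|].
exfalso. set (gap := phi_w w u0 + s * t * d - phi_w w u).
assert (hg : 0 < gap) by (unfold gap; lra).
set (K := 2 * (s * t * (d * d)) + 1).
assert (hK : 0 < K) by (unfold K; assert (0 <= d * d) by nra; nra).
set (h := Rmin (gap / (2 * K)) (Rmin (/ 2) u0 / (Rabs d + 1))).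
assert (hm : 0 < Rmin (/ 2) u0) by (apply Rmin_pos; lra).
pose proof (Rabs_pos d) as hd0.
assert (h0 : 0 < h).
{ unfold h; apply Rmin_pos; apply Rdiv_lt_0_compat; lra. }
assert (h1 : h * Rabs d <= Rmin (/ 2) u0).
{ apply Rle_trans with (h * (Rabs d + 1)); [nra|].
  apply Rle_div_r; [lra|]. apply Rmin_r. }
pose proof (Rmin_l (/ 2) u0). pose proof (Rmin_r (/ 2) u0).
pose proof (key h h0 ltac:(lra) ltac:(lra)).
assert (h * K <= gap / 2).
{ apply Rle_trans with (gap / (2 * K) * K); [|right; field; lra].
  apply Rmult_le_compat_r; [lra | apply Rmin_l]. }
unfold K in *. unfold gap in *. nra.
Qed.

(* The two cases [r <= t] and [t <= r] use respectively the concavity of [w]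
   and the logarithmic lower tangent. *)
Lemma Mw_small_order rho s t kap k : 0 < rho -> 0 < s -> 0 < kap -> tangent s t -> 1 < t ->
  INR k <= s * t / rho ->
  Mw w rho k * (kap * s / rho) ^ k / INR (fact k) <= kap ^ k.
Proof.
intros hr hs hk htan ht hkn.
destruct (tangent_lower_bounds s t hs htan) as [hst _].
assert (hf : 0 < INR (fact k)) by apply lt_0_INR, lt_O_fact.
assert (hx : 0 < s / rho) by now apply Rdiv_lt_0_compat.
assert (hxk : 0 < (s / rho) ^ k) by now apply pow_lt.
assert (hkk : 0 < kap ^ k) by now apply pow_lt.
replace (kap * s / rho) with (kap * (s / rho)) by (field; lra).
rewrite Rpow_mult_distr.
(* By [Mw_least] this amounts to [(r * s / rho) ^ k / k! <= exp (w r / rho)] for all [r >= 1]. *)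
assert (h : Mw w rho k <= INR (fact k) / (s / rho) ^ k).
2:{ apply Rle_trans with (INR (fact k) / (s / rho) ^ k * (kap ^ k * (s / rho) ^ k) / INR (fact k)).
    - unfold Rdiv. apply Rmult_le_compat_r; [left; now apply Rinv_0_lt_compat|].
      apply Rmult_le_compat_r; [|exact h]. left; now apply Rmult_lt_0_compat.
    - right; field. split; lra. }
apply Mw_least; [exact hr|]. intros r h1.
apply (proj1 (Rle_div_r _ _ _ hxk)).
replace (r ^ k * exp (- w r / rho) * (s / rho) ^ k)
  with ((r * (s / rho)) ^ k / INR (fact k) * exp (- w r / rho) * INR (fact k))
  by (rewrite Rpow_mult_distr; field; lra).
apply Rle_trans with (1 * INR (fact k)); [|lra].
apply Rmult_le_compat_r; [lra|].
apply Rle_trans with (exp (w r / rho) * exp (- w r / rho)).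
2:{ rewrite <- exp_plus. replace (w r / rho + - w r / rho) with 0 by (field; lra). rewrite exp_0; lra. }
apply Rmult_le_compat_r; [left; apply exp_pos|].
destruct (Rle_lt_dec r t) as [hrt | hrt].
- apply Rle_trans with (exp (r * (s / rho))).
  { apply pow_div_fact_le_exp. nra. }
  apply exp_le_mono.
  assert (r * s <= w r).
  { assert (hth : 0 <= r / t <= 1) by (split; [apply Rdiv_le_0_compat; lra | apply Rle_div_l; lra]).
    pose proof (Hc t 0 (r / t) ltac:(lra) (Rle_refl 0) hth) as hc.
    replace (r / t * t + (1 - r / t) * 0) with r in hc by (field; lra).
    pose proof (w_nonneg 0 (Rle_refl 0)).
    assert (r / t * (s * t) <= r / t * w t) by (apply Rmult_le_compat_l; lra).
    replace (r / t * (s * t)) with (r * s) in H0 by (field; lra). nra. }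
  apply Rmult_le_reg_r with rho; [lra|].
  replace (r * (s / rho) * rho) with (r * s) by (field; lra).
  replace (w r / rho * rho) with (w r) by (field; lra). exact H.
- set (nu := s * t / rho) in *.
  assert (hnu : 0 < nu) by (unfold nu; apply Rdiv_lt_0_compat; nra).
  replace (r * (s / rho)) with ((r / t) * nu) by (unfold nu; field; lra).
  assert (hq : 1 < r / t) by (apply Rlt_div_r; lra).
  assert (hl : 0 <= ln (r / t)) by (rewrite <- ln_1; apply ln_le; lra).
  rewrite Rpow_mult_distr. unfold Rdiv at 1. rewrite Rmult_assoc.
  apply Rle_trans with (exp (INR k * ln (r / t)) * exp nu).
  { apply Rmult_le_compat.
    - apply pow_le; lra.
    - apply Rdiv_le_0_compat; [apply pow_le; lra | exact hf].
    - right; apply pow_exp; lra.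
    - apply pow_div_fact_le_exp; lra. }
  rewrite <- exp_plus. apply exp_le_mono.
  pose proof (tangent_log_lower s t r hs htan ht h1) as hlow.
  apply Rmult_le_reg_r with rho; [lra|].
  replace (w r / rho * rho) with (w r) by (field; lra).
  assert (e1 : nu * rho = s * t) by (unfold nu; field; lra).
  assert (INR k * ln (r / t) <= nu * ln (r / t)) by (apply Rmult_le_compat_r; lra).
  assert (INR k * ln (r / t) * rho <= s * t * ln (r / t)).
  { rewrite <- e1. replace (nu * rho * ln (r / t)) with (nu * ln (r / t) * rho) by ring.
    apply Rmult_le_compat_r; lra. }
  lra.
Qed.

(** At order about [nu = s t / rho] the supremum defining [Mw] is reached near [r = t]. The factor
    [kap ^ N <= exp (- N)] cancels [nu ^ N / N! <= exp nu] up to [exp 1], which leaves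
    [exp (- w t / rho)]; half of this exponent is spent on a factor [t]. *)
Lemma Mw_critical_order rho s t kap N : 0 < rho -> 0 < s -> 0 < kap -> kap <= exp (-1) ->
  tangent s t -> 1 < t -> ln t <= w t / (2 * rho) ->
  INR N <= s * t / rho < INR N + 1 ->
  Mw w rho N * (kap * s / rho) ^ N / INR (fact N) <= exp 1 * exp (- (w t / (2 * rho))).
Proof.
intros hr hs hk hk1 htan ht hlt [hN1 hN2].
set (nu := s * t / rho) in *.
assert (hnu : 0 < nu) by (unfold nu; apply Rdiv_lt_0_compat; nra).
assert (hf : 0 < INR (fact N)) by apply lt_0_INR, lt_O_fact.
assert (hx : 0 < kap * s / rho) by (apply Rdiv_lt_0_compat; nra).
assert (hxN : 0 < (kap * s / rho) ^ N) by now apply pow_lt.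
replace (Mw w rho N * (kap * s / rho) ^ N / INR (fact N))
  with (Mw w rho N * ((kap * s / rho) ^ N / INR (fact N))) by (field; lra).
assert (hxf : 0 < (kap * s / rho) ^ N / INR (fact N)) by now apply Rdiv_lt_0_compat.
apply (proj2 (Rle_div_r _ _ _ hxf)).
apply Mw_least; [exact hr|]. intros r h1.
apply (proj1 (Rle_div_r _ _ _ hxf)).
pose proof (tangent_log_lower s t r hs htan ht h1) as hlow.
assert (hq : 0 < r / t) by (apply Rdiv_lt_0_compat; lra).
replace (r ^ N * exp (- w r / rho) * ((kap * s / rho) ^ N / INR (fact N)))
  with (kap ^ N * (nu ^ N / INR (fact N)) * (r / t) ^ N * exp (- w r / rho)).
2:{ replace (kap * s / rho) with (kap * nu * / t) by (unfold nu; field; lra).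
    unfold Rdiv. rewrite !Rpow_mult_distr.
    rewrite pow_inv. field. repeat split; try lra; apply pow_nonzero; lra. }
assert (hkN : kap ^ N <= exp (- INR N)).
{ apply Rle_trans with (exp (-1) ^ N); [apply pow_incr; lra|].
  rewrite pow_exp by apply exp_pos. rewrite ln_exp. right; f_equal; ring. }
apply Rle_trans with (exp (- INR N) * exp nu * exp (INR N * ln (r / t)) * exp (- w r / rho)).
{ apply Rmult_le_compat_r; [left; apply exp_pos|].
  rewrite pow_exp with (x := r / t) by lra.
  apply Rmult_le_compat_r; [left; apply exp_pos|].
  apply Rmult_le_compat; [apply pow_le; lra | apply Rdiv_le_0_compat; [apply pow_le; lra | lra] | exact hkN |].
  apply pow_div_fact_le_exp; lra. }
rewrite <- !exp_plus. apply exp_le_mono.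
assert (hw2 : - w r / rho <= - (w t / rho) - nu * ln (r / t)).
{ apply Rmult_le_reg_r with rho; [lra|].
  replace (- w r / rho * rho) with (- w r) by (field; lra).
  replace ((- (w t / rho) - nu * ln (r / t)) * rho) with (- w t - s * t * ln (r / t))
    by (unfold nu; field; lra). lra. }
assert (hww : w t / rho = 2 * (w t / (2 * rho))) by (field; lra).
(* for [r < t] the missing fractional power costs at most a factor [t] *)
assert (hfrac : (INR N - nu) * ln (r / t) <= ln t).
{ destruct (Rle_lt_dec 0 (ln (r / t))) as [h | h].
  - assert (0 <= ln t) by (rewrite <- ln_1; apply ln_le; lra). nra.
  - apply Rle_trans with (- ln (r / t)); [nra|].
    rewrite ln_div by lra. assert (0 <= ln r) by (rewrite <- ln_1; apply ln_le; lra). lra. }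
lra.
Qed.
End Weight.

(** * Taylor expansions of complex-valued functions *)

Lemma norm_C (z : C) : norm (K := R_AbsRing) (V := C_R_NormedModule) z = Cmod z.
Proof.
unfold Cmod. change (sqrt (Rabs (fst z) ^ 2 + Rabs (snd z) ^ 2) = sqrt (fst z ^ 2 + snd z ^ 2)).
now rewrite !pow2_abs.
Qed.

Lemma is_derive_fst (g : R -> C) x l : is_derive (V := C_R_NormedModule) g x l -> is_derive (fun y => fst (g y)) x (fst l).
Proof.
intros h. unfold is_derive.
refine (filterdiff_ext_lin (K := R_AbsRing) (U := AbsRing_NormedModule R_AbsRing) (V := R_NormedModule)
  (fun y => fst (g y)) (fun y => fst (scal (V := C_R_NormedModule) y l)) _ _ (fun y => eq_refl)).
apply (@filterdiff_comp' R_AbsRing (AbsRing_NormedModule R_AbsRing) C_R_NormedModule R_NormedModule g (fun z => fst z) x _ (fun z => fst z) h).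
apply filterdiff_linear, is_linear_fst.
Qed.

Lemma is_derive_snd (g : R -> C) x l : is_derive (V := C_R_NormedModule) g x l -> is_derive (fun y => snd (g y)) x (snd l).
Proof.
intros h. unfold is_derive.
refine (filterdiff_ext_lin (K := R_AbsRing) (U := AbsRing_NormedModule R_AbsRing) (V := R_NormedModule)
  (fun y => snd (g y)) (fun y => snd (scal (V := C_R_NormedModule) y l)) _ _ (fun y => eq_refl)).
apply (@filterdiff_comp' R_AbsRing (AbsRing_NormedModule R_AbsRing) C_R_NormedModule R_NormedModule g (fun z => snd z) x _ (fun z => snd z) h).
apply filterdiff_linear, is_linear_snd.
Qed.

Lemma is_derive_C_of_quadratic (g : R -> C) x l K r : 0 < r ->
  (forall h, Rabs h < r -> Cmod (Cminus (Cminus (g (x + h)) (g x)) (Cmult h l)) <= K * h ^ 2) ->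
  is_derive (V := C_R_NormedModule) g x l.
Proof.
intros hr h. split; [apply is_linear_scal_l|].
intros y hy. pose proof (is_filter_lim_locally_unique (K := R_AbsRing) (V := AbsRing_NormedModule R_AbsRing) x y hy) as e. clear hy. subst y.
intros eps.
assert (hd : 0 < Rmin r (eps / (Rabs K + 1))).
{ apply Rmin_pos; [lra|]. apply Rdiv_lt_0_compat; [apply eps | pose proof (Rabs_pos K); lra]. }
exists (mkposreal _ hd).
assert (main : forall y : R, Rabs (y - x) < Rmin r (eps / (Rabs K + 1)) ->
  norm (K := R_AbsRing) (V := C_R_NormedModule)
    (minus (minus (g y) (g x)) (scal (V := C_R_NormedModule) (y - x) l)) <= eps * Rabs (y - x)).
2: exact main.
intros y hy. rewrite norm_C.
assert (h1 : Rabs (y - x) < r) by (eapply Rlt_le_trans; [exact hy | apply Rmin_l]).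
assert (h2 : Rabs (y - x) < eps / (Rabs K + 1)) by (eapply Rlt_le_trans; [exact hy | apply Rmin_r]).
specialize (h (y - x) h1). replace (x + (y - x)) with y in h by ring.
eapply Rle_trans; [|eapply Rle_trans; [exact h|]].
- right; f_equal. apply injective_projections; simpl;
  unfold minus, plus, opp, scal; simpl; unfold mult; simpl; unfold prod_scal, scal; simpl; unfold mult; simpl; ring.
- rewrite <- pow2_abs. simpl (_ ^ 2). rewrite Rmult_1_r, <- Rmult_assoc.
  apply Rmult_le_compat_r; [apply Rabs_pos|].
  pose proof (Rabs_pos (y - x)). pose proof (Rle_abs K). pose proof (Rabs_pos K).
  assert (Rabs (y - x) * (Rabs K + 1) <= eps) by (apply Rle_div_r; lra).
  nra.
Qed.

Fixpoint taylor_sum (a : nat -> R) (h : R) (n : nat) : R :=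
  match n with O => 0 | S k => taylor_sum a h k + a k * h ^ k / INR (fact k) end.

Lemma taylor_sum_0 a n : taylor_sum a 0 (S n) = a O.
Proof.
induction n as [|n IH]; [simpl; field|].
change (taylor_sum a 0 (S n) + a (S n) * 0 ^ S n / INR (fact (S n)) = a O). rewrite IH, pow_ne_zero by lia.
unfold Rdiv; ring.
Qed.

Lemma pow_div_fact_derive b h n :
  is_derive (fun h => b * h ^ S n / INR (fact (S n))) h (b * h ^ n / INR (fact n)).
Proof.
pose proof (lt_0_INR _ (lt_O_fact n)) as hf.
assert (hn : 0 < INR (S n)) by (apply lt_0_INR; lia).
assert (e : INR (fact (S n)) = INR (S n) * INR (fact n)) by (rewrite <- mult_INR; reflexivity).
rewrite e. set (F := INR (fact n)) in *.
evar_last; [auto_derive; trivial|].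
change (b * (1 * (INR (S n) * h ^ n)) * / (INR (S n) * F) = b * h ^ n / F).
set (N := INR (S n)) in *. field. split; lra.
Qed.

Lemma taylor_sum_derive a h n :
  is_derive (fun h => taylor_sum a h (S n)) h (taylor_sum (fun k => a (S k)) h n).
Proof.
induction n as [|n IH].
- simpl. auto_derive; [trivial | ring].
- apply (is_derive_ext (fun h => taylor_sum a h (S n) + a (S n) * h ^ S n / INR (fact (S n)))); [reflexivity|].
  change (taylor_sum (fun k => a (S k)) h (S n))
    with (plus (taylor_sum (fun k => a (S k)) h n) (a (S n) * h ^ n / INR (fact n))).
  refine (is_derive_plus (V := R_NormedModule) _ _ _ _ _ IH _).
  apply pow_div_fact_derive.
Qed.

(* Comparison along the segment [x0 + tau h], tau in [0, 1]. *)
Lemma real_taylor_bound (c d M : R) D : forall v : nat -> R -> R,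
  (forall n y, c < y < d -> is_derive (v n) y (v (S n) y)) ->
  (forall y, c < y < d -> Rabs (v D y) <= M) ->
  forall x0 h, c < x0 < d -> c < x0 + h < d ->
  Rabs (v O (x0 + h) - taylor_sum (fun k => v k x0) h D) <= M * Rabs h ^ D / INR (fact D).
Proof.
induction D as [|D IH]; intros v hv hM x0 h h0 h1.
- simpl. rewrite Rminus_0_r. replace (M * 1 / 1) with M by field. now apply hM.
- set (T := fun y => v O (x0 + y) - taylor_sum (fun k => v k x0) y (S D)).
  set (T' := fun y => v 1%nat (x0 + y) - taylor_sum (fun k => v (S k) x0) y D).
  assert (hseg : forall tau, 0 <= tau <= 1 -> c < x0 + tau * h < d).
  { intros tau ht. destruct (Rle_lt_dec 0 h).
    - assert (0 <= tau * h <= h) by (split; nra). lra.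
    - assert (h <= tau * h <= 0) by (split; nra). lra. }
  assert (dT : forall tau, 0 <= tau <= 1 -> is_derive (fun s => T (s * h)) tau (h * T' (tau * h))).
  { intros tau ht. apply (is_derive_comp T (fun s => s * h)).
    - unfold T, T'. refine (is_derive_minus (V := R_NormedModule) _ _ _ _ _ _ (taylor_sum_derive _ _ _)).
      replace (v 1%nat (x0 + tau * h)) with (1 * v 1%nat (x0 + tau * h)) by ring.
      apply (is_derive_comp (v O) (fun y => x0 + y)); [apply hv, hseg, ht|].
      auto_derive; [trivial | ring].
    - auto_derive; [trivial | ring]. }
  assert (bT' : forall tau, 0 <= tau <= 1 ->
     Rabs (h * T' (tau * h)) <= M * Rabs h ^ S D * tau ^ D / INR (fact D)).
  { intros tau ht. rewrite Rabs_mult.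
    pose proof (IH (fun n => v (S n)) (fun n => hv (S n)) hM x0 (tau * h) h0 (hseg tau ht)) as hb.
    rewrite Rabs_mult, (Rabs_right tau), Rpow_mult_distr in hb by lra.
    apply Rle_trans with (Rabs h * (M * (tau ^ D * Rabs h ^ D) / INR (fact D))).
    - apply Rmult_le_compat_l; [apply Rabs_pos | exact hb].
    - right; simpl; field. apply INR_fact_neq_0. }
  assert (dG : forall tau, is_derive (fun s => M * Rabs h ^ S D * s ^ S D / INR (fact (S D))) tau
     (M * Rabs h ^ S D * tau ^ D / INR (fact D))).
  { intros tau. apply pow_div_fact_derive. }
  assert (T0 : T (0 * h) = 0).
  { unfold T. rewrite Rmult_0_l, taylor_sum_0, Rplus_0_r. ring. }
  (* The sign [sg] treats the upper and the lower bound at once: [G] below vanishes at 0 and has a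
     nonnegative derivative. *)
  assert (main : forall sg : R, sg = 1 \/ sg = -1 ->
     sg * T (1 * h) <= M * Rabs h ^ S D / INR (fact (S D))).
  { intros sg hsg.
    set (G := fun s => M * Rabs h ^ S D * s ^ S D / INR (fact (S D)) - sg * T (s * h)).
    set (G' := fun s => M * Rabs h ^ S D * s ^ D / INR (fact D) - sg * (h * T' (s * h))).
    assert (dGG : forall s, 0 <= s <= 1 -> is_derive G s (G' s)).
    { intros s hs. unfold G, G'. refine (is_derive_minus (V := R_NormedModule) _ _ _ _ _ (dG s) _).
      refine (is_derive_scal _ _ _ _ _). now apply dT. }
    destruct (MVT_gen G 0 1 G') as [s [hs e]].
    - intros s. rewrite Rmin_left, Rmax_right by lra. intros hs; apply dGG; lra.
    - intros s. rewrite Rmin_left, Rmax_right by lra. intros hs.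
      apply derivable_continuous_pt. exists (G' s). apply is_derive_Reals. now apply dGG.
    - rewrite Rmin_left, Rmax_right in hs by lra.
      assert (0 <= G' s).
      { unfold G'. pose proof (bT' s hs). pose proof (Rle_abs (h * T' (s * h))).
        pose proof (Rle_abs (- (h * T' (s * h)))). rewrite Rabs_Ropp in H1.
        destruct hsg; subst sg; lra. }
      assert (eG0 : G 0 = 0).
      { unfold G. rewrite T0, pow_ne_zero by lia. unfold Rdiv; ring. }
      assert (eG1 : G 1 = M * Rabs h ^ S D / INR (fact (S D)) - sg * T (1 * h)).
      { unfold G. rewrite pow1. now rewrite Rmult_1_r. }
      rewrite eG0, eG1 in e. lra. }
  pose proof (main 1 (or_introl eq_refl)). pose proof (main (-1) (or_intror eq_refl)).
  rewrite Rmult_1_l with (r := h) in *.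
  change (v O (x0 + h) - taylor_sum (fun k => v k x0) h (S D)) with (T h).
  apply Rabs_le. lra.
Qed.

Lemma complex_taylor_bound (c d M : R) D (g : nat -> R -> C) :
  (forall n y, c < y < d -> is_derive (V := C_R_NormedModule) (g n) y (g (S n) y)) ->
  (forall y, c < y < d -> Cmod (g D y) <= M) ->
  forall x0 h, c < x0 < d -> c < x0 + h < d ->
  Cmod (Cminus (g O (x0 + h)) (psum (fun k => Cmult (g k x0) (RtoC (/ INR (fact k)))) h D))
   <= 2 * (M * Rabs h ^ D / INR (fact D)).
Proof.
intros hg hM x0 h h0 h1.
assert (e : forall D, psum (fun k => Cmult (g k x0) (RtoC (/ INR (fact k)))) h D
   = (taylor_sum (fun k => fst (g k x0)) h D, taylor_sum (fun k => snd (g k x0)) h D)).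
{ clear; induction D as [|D IH]; [reflexivity|].
  simpl. rewrite IH. apply injective_projections; simpl; unfold Rdiv; ring. }
rewrite e.
pose proof (real_taylor_bound c d M D (fun n y => fst (g n y))
  (fun n y hy => is_derive_fst _ _ _ (hg n y hy))
  (fun y hy => Rle_trans _ _ _ (Rle_trans _ _ _ (Rmax_l _ _) (Rmax_Cmod (g D y))) (hM y hy)) x0 h h0 h1) as b1.
pose proof (real_taylor_bound c d M D (fun n y => snd (g n y))
  (fun n y hy => is_derive_snd _ _ _ (hg n y hy))
  (fun y hy => Rle_trans _ _ _ (Rle_trans _ _ _ (Rmax_r _ _) (Rmax_Cmod (g D y))) (hM y hy)) x0 h h0 h1) as b2.
eapply Rle_trans; [apply Cmod_2Rmax|].
assert (s2 : sqrt 2 <= 2).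
{ rewrite <- (sqrt_square 2) at 2 by lra. apply sqrt_le_1; lra. }
apply Rmult_le_compat.
- apply sqrt_pos.
- eapply Rle_trans; [apply Rabs_pos | apply Rmax_l].
- exact s2.
- apply Rmax_lub; [exact b1 | exact b2].
Qed.

(** * Local approximation of the root *)

Lemma psum_ext c c' x n : (forall k, (k < n)%nat -> c k = c' k) -> psum c x n = psum c' x n.
Proof.
induction n as [|n IH]; intros h; [reflexivity|]. simpl.
rewrite IH, h by (intros; try apply h; lia). reflexivity.
Qed.

Lemma psum_scale c e y n : psum c (e * y) n = psum (fun k => Cmult (c k) (RtoC (e ^ k))) y n.
Proof.
induction n as [|n IH]; [reflexivity|]. simpl. rewrite IH, Rpow_mult_distr, RtoC_mult. ring.
Qed.

Lemma pow_lt_S x y n : 0 <= x -> x < y -> x ^ S n < y ^ S n.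
Proof.
intros hx hxy. induction n as [|n IH]; [simpl; lra|].
change (x * x ^ S n < y * y ^ S n).
pose proof (pow_le x (S n) hx). apply Rmult_le_0_lt_compat; lra.
Qed.

Lemma exp_pow x n : exp x ^ n = exp (INR n * x).
Proof. rewrite pow_exp by apply exp_pos. now rewrite ln_exp. Qed.

(** [D] is the smaller of the integer parts of [s t / rho] and [theta * E]. In the first case the
    order is critical. In the second the decay [exp (- D / theta)] of the coefficients alone yields
    [exp (- E)], because [D + 1 > theta * E]. *)
Lemma exists_truncation w rho theta s t :
  weight_function w -> concave_nonneg w -> 0 < rho -> 0 < theta <= 1 -> 0 < s ->
  tangent w s t -> 1 < t -> ln t <= w t / (2 * rho) ->
  let E := w t / (2 * rho) in
  let eps := exp (- / theta) * s / rho in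
  exists D, INR D <= theta * E /\
    (forall k, (k < D)%nat -> Mw w rho k * eps ^ k / INR (fact k) <= exp (- / theta) ^ k) /\
    Mw w rho D * eps ^ D / INR (fact D) <= exp (/ theta) * exp (- E).
Proof.
intros Hw Hc hr [th0 th1] hs htan ht hlt E eps.
destruct (tangent_lower_bounds w Hw s t hs htan) as [hst _].
assert (hE : 0 < E) by (unfold E; apply Rdiv_lt_0_compat; nra).
destruct (nfloor_ex (s * t / rho)) as [N hN]; [apply Rdiv_le_0_compat; nra|].
destruct (nfloor_ex (theta * E)) as [M hM]; [nra|].
assert (hth : 1 <= / theta) by (rewrite <- Rinv_1; apply Rinv_le_contravar; lra).
destruct (Nat.le_gt_cases N M) as [h | h].
- exists N. split; [|split].
  + apply le_INR in h. lra.
  + intros k hk. apply (Mw_small_order w Hw Hc rho s t); try assumption; [apply exp_pos|].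
    apply lt_INR in hk; lra.
  + eapply Rle_trans; [apply (Mw_critical_order w Hw rho s t); try assumption; [apply exp_pos | apply exp_le_mono; lra]|].
    apply Rmult_le_compat_r; [left; apply exp_pos | apply exp_le_mono; lra].
- exists M. split; [lra|split].
  + intros k hk. apply (Mw_small_order w Hw Hc rho s t); try assumption; [apply exp_pos|].
    apply lt_INR in hk. apply lt_INR in h. lra.
  + eapply Rle_trans; [apply (Mw_small_order w Hw Hc rho s t); try assumption; [apply exp_pos|]|].
    * apply lt_INR in h; lra.
    * rewrite exp_pow, <- exp_plus. apply exp_le_mono.
      assert (h1 : theta * E * / theta <= (INR M + 1) * / theta) by (apply Rmult_le_compat_r; lra).
      replace (theta * E * / theta) with E in h1 by (field; lra). lra.
Qed.

Definition bounded_derivs (a b : R) (u : R -> C) (M : nat -> R) : Prop :=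
  exists g : nat -> R -> C,
    (forall x, a < x < b -> g O x = u x) /\
    (forall n x, a < x < b -> is_derive (V := C_R_NormedModule) (g n) x (g (S n) x)) /\
    (forall n x, a < x < b -> Cmod (g n x) <= M n).

Lemma truncated_taylor w rho theta D eps a b u : 0 < rho -> 0 < theta <= / 4 -> 0 < eps ->
  (forall k, (k < D)%nat -> Mw w rho k * eps ^ k / INR (fact k) <= exp (- / theta) ^ k) ->
  bounded_derivs a b u (Mw w rho) ->
  forall x0, a < x0 - eps -> x0 + eps < b ->
  exists p : nat -> C, (forall k, Cmod (p k) <= (/ 16) ^ k) /\
   forall y, Rabs y <= 1 -> Cmod (Cminus (u (x0 + eps * y)) (psum p y (S D)))
     <= 2 * (Mw w rho D * eps ^ D / INR (fact D)).
Proof.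
intros hr hth he hD [g [g0 [gd gM]]] x0 h1 h2.
set (c := fun k => Cmult (Cmult (g k x0) (RtoC (/ INR (fact k)))) (RtoC (eps ^ k))).
(* The Taylor polynomial has [D] terms; its coefficient of index [D] is set to 0 because
   [psum_approx_root] sums [D + 1] terms. *)
exists (fun k => if Nat.ltb k D then c k else RtoC 0). split.
- intros k. destruct (Nat.ltb_spec k D) as [hk | hk].
  2:{ rewrite Cmod_0. apply pow_le; lra. }
  assert (hf : 0 < INR (fact k)) by apply lt_0_INR, lt_O_fact.
  unfold c. rewrite !Cmod_mult, !Cmod_R, (Rabs_right (eps ^ k)), Rabs_right.
  2:{ left; now apply Rinv_0_lt_compat. } 2:{ apply Rle_ge, pow_le; lra. }
  eapply Rle_trans with (Mw w rho k * eps ^ k / INR (fact k)).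
  { replace (Mw w rho k * eps ^ k / INR (fact k)) with (Mw w rho k * / INR (fact k) * eps ^ k) by (field; lra).
    apply Rmult_le_compat_r; [apply pow_le; lra|].
    apply Rmult_le_compat_r; [left; now apply Rinv_0_lt_compat|]. apply gM; lra. }
  eapply Rle_trans; [now apply hD|]. apply pow_incr. split; [left; apply exp_pos|].
  apply Rle_trans with (/ exp 4).
  { rewrite <- exp_Ropp. apply exp_le_mono. assert (/ / 4 <= / theta) by (apply Rinv_le_contravar; lra). rewrite Rinv_inv in H; lra. }
  apply Rinv_le_contravar; [lra|].
  replace 4 with (1 + 1 + (1 + 1)) by ring. rewrite !exp_plus.
  pose proof (exp_ineq1_le 1). assert (4 <= exp 1 * exp 1) by nra. nra.
- intros y hy.
  assert (hb : - eps <= eps * y <= eps).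
  { apply Rabs_le_between in hy. split; nra. }
  pose proof (complex_taylor_bound a b (Mw w rho D) D g gd (fun z => gM D z) x0 (eps * y) ltac:(lra) ltac:(lra)) as ht.
  rewrite g0 in ht by lra.
  rewrite psum_scale in ht. fold c in ht.
  change (psum ?p y (S D)) with (Cplus (psum p y D) (Cmult (p D) (RtoC (y ^ D)))).
  cbv beta. rewrite Nat.ltb_irrefl, Cmult_0_l, Cplus_0_r.
  rewrite (psum_ext _ c).
  2:{ intros k hk. apply Nat.ltb_lt in hk. now rewrite hk. }
  eapply Rle_trans; [exact ht|].
  apply Rmult_le_compat_l; [lra|]. unfold Rdiv. apply Rmult_le_compat_r.
  { left; apply Rinv_0_lt_compat, lt_0_INR, lt_O_fact. }
  apply Rmult_le_compat_l; [left; apply exp_pos|].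
  apply pow_incr. split; [apply Rabs_pos|]. apply Rabs_le; lra.
Qed.

Theorem local_approx j : (1 <= j)%nat ->
  exists theta c E0, 0 < theta <= / 4 /\ 0 < c /\ 0 < E0 /\
  forall w rho s t a b f, weight_function w -> concave_nonneg w -> 0 < rho -> 0 < s ->
  tangent w s t -> 1 < t -> ln t <= w t / (2 * rho) -> E0 <= w t / (2 * rho) ->
  bounded_derivs a b (fun x => Cpow (f x) j) (Mw w rho) ->
  bounded_derivs a b (fun x => Cpow (f x) (S j)) (Mw w rho) ->
  let eps := exp (- / theta) * s / rho in
  forall x0, a < x0 - eps -> x0 + eps < b ->
  exists m F, (forall k, Cmod (F k) <= 8) /\
   forall y, Rabs y <= 1 -> Cmod (Cminus (f (x0 + eps * y)) (psum F y m)) <= exp (- (c * (w t / (2 * rho)))).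
Proof.
intros hj. destruct (PolynomialRoots.psum_approx_root hj) as [B [B1 hB]].
set (a := INR (2 * j * j * S j)).
assert (a1 : 1 <= a).
{ unfold a. change 1 with (INR 1). apply le_INR. nia. }
assert (lB : 0 <= ln B) by (rewrite <- ln_1; apply ln_le; lra).
(* With [D <= theta * E] this makes [B ^ D] at most [exp (E / (8 * a))]. *)
set (theta := / (8 * a * (ln B + 1))).
assert (hden : 8 <= 8 * a * (ln B + 1)) by nra.
assert (hth : 0 < theta <= / 4).
{ unfold theta; split; [apply Rinv_0_lt_compat; lra | apply Rinv_le_contravar; lra]. }
set (c := / (4 * a * INR (S j))).
assert (hj0 : 0 < INR (S j)) by (apply lt_0_INR; lia).
exists theta, c, (8 * a * (ln B + / theta + 1)).
assert (hth' : 0 < / theta) by (apply Rinv_0_lt_compat; lra).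
split; [exact hth|]. split; [unfold c; apply Rinv_0_lt_compat; nra|]. split; [nra|].
intros w rho s t lo hi f Hw Hc hr hs htan ht hlt hE hg hh eps x0 h1 h2.
set (E := w t / (2 * rho)) in *.
assert (heps : 0 < eps).
{ unfold eps. apply Rdiv_lt_0_compat; [|lra]. apply Rmult_lt_0_compat; [apply exp_pos | lra]. }
destruct (exists_truncation w rho theta s t Hw Hc hr ltac:(lra) hs htan ht hlt) as [D [hD [hDk hDD]]].
fold E in hD, hDD. fold eps in hDk, hDD.
destruct (truncated_taylor w rho theta D eps lo hi _ hr hth heps hDk hg x0 h1 h2) as [p [p16 hp]].
destruct (truncated_taylor w rho theta D eps lo hi _ hr hth heps hDk hh x0 h1 h2) as [q [q16 hq]].
(* [v ^ a = exp (- E / 2)] dominates [B ^ (D + 1) * eta], while [B ^ (D + 1) * v] is still at most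
   [exp (- E / (4 * a))], whose root of order [j + 1] is [exp (- c * E)]. *)
set (v := exp (- (E / (2 * a)))).
set (eta := 2 * (exp (/ theta) * exp (- E))).
assert (E8 : ln B + / theta + 1 <= E / (8 * a)).
{ apply Rle_div_r; [lra|]. rewrite Rmult_comm. lra. }
assert (ltE : theta * E * ln B <= E / (8 * a)).
{ replace (theta * E * ln B) with (E / (8 * a) * (ln B / (ln B + 1))).
  2:{ unfold theta; field. split; lra. }
  assert (ln B / (ln B + 1) <= 1) by (apply Rle_div_l; lra).
  assert (0 < E / (8 * a)) by nra. nra. }
assert (BD : B ^ S D <= exp (E / (8 * a) + E / (8 * a))).
{ rewrite pow_exp by lra. apply exp_le_mono. rewrite S_INR.
  assert (INR D * ln B <= theta * E * ln B) by (apply Rmult_le_compat_r; lra). lra. }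
assert (E8' : E / (8 * a) <= E / 8).
{ apply Rle_div_l; [lra|]. assert (0 <= E) by nra. nra. }
assert (e2 : 2 <= exp 1) by (pose proof (exp_ineq1_le 1); lra).
assert (hv0 : 0 < v) by apply exp_pos.
assert (hE0 : 0 <= E / (8 * a)) by lra.
assert (hv1 : v <= 1).
{ unfold v. rewrite <- exp_0. apply exp_le_mono.
  replace (E / (2 * a)) with (4 * (E / (8 * a))) by (field; lra). lra. }
destruct (hB D p q (fun y => f (x0 + eps * y)) eta v p16 q16 hv0 hv1) as [m [F [F8 hF]]].
- unfold v, eta. rewrite exp_pow. fold a.
  replace (a * - (E / (2 * a))) with (- (E / 2)) by (field; lra).
  apply Rle_trans with (exp (E / (8 * a) + E / (8 * a)) * (exp 1 * (exp (/ theta) * exp (- E)))).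
  { apply Rmult_le_compat; [apply pow_le; lra | | exact BD |].
    - pose proof (exp_pos (/ theta)); pose proof (exp_pos (- E)); nra.
    - apply Rmult_le_compat_r; [|exact e2]. pose proof (exp_pos (/ theta)); pose proof (exp_pos (- E)); nra. }
  rewrite <- !exp_plus. apply exp_le_mono. lra.
- intros y hy. eapply Rle_trans; [now apply hp|]. unfold eta; lra.
- intros y hy. eapply Rle_trans; [now apply hq|]. unfold eta; lra.
- exists m, F. split; [exact F8|]. intros y hy. specialize (hF y hy).
  set (d := Cmod _) in *. assert (d0 : 0 <= d) by apply Cmod_ge_0.
  apply Rnot_lt_le. intros hlt'.
  assert (hc : exp (- (c * E)) ^ S j < d ^ S j).
  { apply pow_lt_S; [left; apply exp_pos | exact hlt']. }
  rewrite exp_pow in hc.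
  assert (B ^ S D * v <= exp (INR (S j) * - (c * E))).
  { apply Rle_trans with (exp (E / (8 * a) + E / (8 * a)) * v); [apply Rmult_le_compat_r; lra|].
    unfold v. rewrite <- exp_plus. apply exp_le_mono. unfold c. right. field. split; lra. }
  lra.
Qed.

(** * From local approximations to derivatives *)

Lemma Cmod_triangle3 (x y z : C) : Cmod (Cminus x z) <= Cmod (Cminus x y) + Cmod (Cminus y z).
Proof. replace (Cminus x z) with (Cplus (Cminus x y) (Cminus y z)) by ring. apply Cmod_triangle. Qed.

Lemma Cmod_minus_sym (x y : C) : Cmod (Cminus x y) = Cmod (Cminus y x).
Proof. replace (Cminus x y) with (Copp (Cminus y x)) by ring. apply Cmod_opp. Qed.

Lemma Cmod_minus_le (x y : C) : Cmod (Cminus x y) <= Cmod x + Cmod y.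
Proof. unfold Cminus. rewrite <- (Cmod_opp y). apply Cmod_triangle. Qed.

Lemma psum_tail c y n M K : (n <= M)%nat -> 0 <= K -> (forall i, (i < M)%nat -> Cmod (c i) <= K) ->
  Rabs y <= / 2 -> Cmod (Cminus (psum c y M) (psum c y n)) <= 2 * K * Rabs y ^ n.
Proof.
intros hn hK hc hy.
assert (h : Cmod (Cminus (psum c y M) (psum c y n)) <= 2 * K * (Rabs y ^ n - Rabs y ^ M)).
{ induction hn as [|M hn IH].
  - replace (Cminus (psum c y n) (psum c y n)) with (RtoC 0) by ring. rewrite Cmod_0; lra.
  - simpl (psum c y (S M)).
    replace (Cminus (Cplus (psum c y M) (Cmult (c M) (RtoC (y ^ M)))) (psum c y n))
      with (Cplus (Cminus (psum c y M) (psum c y n)) (Cmult (c M) (RtoC (y ^ M)))) by ring.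
    eapply Rle_trans; [apply Cmod_triangle|].
    specialize (IH ltac:(intros; apply hc; lia)).
    rewrite Cmod_mult, Cmod_R, <- RPow_abs.
    pose proof (Rabs_pos y). pose proof (pow_le (Rabs y) M H).
    assert (Cmod (c M) * Rabs y ^ M <= K * Rabs y ^ M) by (apply Rmult_le_compat_r; [assumption | apply hc; lia]).
    simpl (Rabs y ^ S M).
    assert (K * Rabs y ^ M <= 2 * (K * Rabs y ^ M) * (1 - Rabs y)); [|lra].
    assert (0 <= K * Rabs y ^ M) by (apply Rmult_le_pos; lra). nra. }
pose proof (pow_le (Rabs y) M (Rabs_pos y)). assert (0 <= K * Rabs y ^ M) by (apply Rmult_le_pos; lra). lra.
Qed.

Lemma psum_bound c y M K : 0 <= K -> (forall i, (i < M)%nat -> Cmod (c i) <= K) ->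
  Rabs y <= / 2 -> Cmod (psum c y M) <= 2 * K.
Proof.
intros hK hc hy. pose proof (psum_tail c y 0 M K ltac:(lia) hK hc hy) as h.
replace (psum c y M) with (Cminus (psum c y M) (psum c y 0)) by (change (psum c y 0) with (RtoC 0); ring).
rewrite pow_O, Rmult_1_r in h. exact h.
Qed.

Lemma psum_minus c d y M : Cminus (psum c y M) (psum d y M) = psum (fun i => Cminus (c i) (d i)) y M.
Proof. induction M as [|M IH]; [change (Cminus (RtoC 0) (RtoC 0) = RtoC 0); ring | simpl]. rewrite <- IH. ring. Qed.

Lemma psum_extend c y m M : (m <= M)%nat -> (forall i, (m <= i)%nat -> c i = RtoC 0) ->
  psum c y M = psum c y m.
Proof.
intros h hc. induction h as [|M h IH]; [reflexivity|]. simpl. rewrite IH, hc by lia. ring.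
Qed.

(* Only the first [l] coefficients are recovered from the values on a real
   interval (at the cost of a factor [40 ^ l]); the others are absorbed by the
   geometric factor [40 ^ (2 i)]. *)
Lemma coef_small (e : nat -> C) (m l : nat) :
  (forall i, Cmod (e i) <= 16) -> (forall i, (m <= i)%nat -> e i = RtoC 0) ->
  (forall y, Rabs y <= 1 -> Cmod (psum e y m) <= 2 * (/ 40) ^ (2 * l)) ->
  forall i, Cmod (e i) <= 34 * 1600 ^ i * (/ 40) ^ l.
Proof.
intros he hz hs i.
set (b := / 40) in *. assert (hb : 0 < b < 1) by (unfold b; lra).
assert (bl : 0 < b ^ l) by (apply pow_lt; lra).
destruct (Nat.le_gt_cases l i) as [hli | hil].
- apply Rle_trans with 16; [apply he|].
  assert (1 <= 1600 ^ i * b ^ l); [|nra].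
  apply Rle_trans with (1600 ^ l * b ^ l).
  + rewrite <- Rpow_mult_distr. apply pow_R1_Rle. unfold b; lra.
  + apply Rmult_le_compat_r; [lra|]. apply Rle_pow; [lra | lia].
(* Shrinking the variable by [b * b = 1 / 1600] makes the terms of index at least [l] contribute at
   most [32 * b ^ (2 l)]; with the hypothesis this is [34 * b ^ (2 l)], and only [l] coefficients
   remain to be extrapolated. *)
- assert (hp : forall y, Rabs y <= 1 ->
     Cmod (psum (fun k => Cmult (e k) (RtoC ((b * b) ^ k))) y l) <= 34 * b ^ (2 * l)).
  { intros y hy. rewrite <- psum_scale.
    assert (hy' : Rabs (b * b * y) <= b * b).
    { rewrite Rabs_mult, (Rabs_right (b * b)) by nra. nra. }
    set (M := Nat.max l m).
    replace (psum e (b * b * y) l) with (Cminus (psum e (b * b * y) M) (Cminus (psum e (b * b * y) M) (psum e (b * b * y) l))) by ring.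
    eapply Rle_trans; [apply Cmod_minus_le|].
    rewrite (psum_extend e _ m M) at 1 by (auto; unfold M; lia).
    pose proof (hs (b * b * y) ltac:(nra)).
    pose proof (psum_tail e (b * b * y) l M 16 ltac:(unfold M; lia) ltac:(lra) (fun i _ => he i) ltac:(unfold b in *; lra)).
    assert (Rabs (b * b * y) ^ l <= b ^ (2 * l)).
    { rewrite pow_mult. apply pow_incr. split; [apply Rabs_pos|]. simpl. lra. }
    lra. }
  pose proof (PolynomialRoots.psum_coef_bound (m := l) hp hil) as h.
  cbv beta in h. rewrite Cmod_mult, Cmod_R, Rabs_right in h by (apply Rle_ge, pow_le; nra).
  assert (e1 : 40 ^ l * (34 * b ^ (2 * l)) = 34 * b ^ l).
  { replace (2 * l)%nat with (l + l)%nat by lia. rewrite pow_add.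
    replace (40 ^ l * (34 * (b ^ l * b ^ l))) with (34 * b ^ l * (40 ^ l * b ^ l)) by ring.
    rewrite <- Rpow_mult_distr. replace (40 * b) with 1 by (unfold b; field). rewrite pow1; ring. }
  rewrite e1 in h.
  replace (34 * 1600 ^ i * b ^ l) with (34 * b ^ l * 1600 ^ i) by ring.
  apply Rle_trans with (Cmod (e i) * (b * b) ^ i * 1600 ^ i).
  + rewrite Rmult_assoc, <- Rpow_mult_distr. replace (b * b * 1600) with 1 by (unfold b; field).
    rewrite pow1; lra.
  + apply Rmult_le_compat_r; [apply pow_le; lra | exact h].
Qed.

(** The limit is fixed before the rate: the same [L] is used later with several constants [W] and
    starting indices [k]. *)
Lemma geometric_limit (u : nat -> C) W0 :
  (forall k, Cmod (Cminus (u (S k)) (u k)) <= W0 / 2 ^ S k) ->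
  exists L, forall W k, 0 <= W ->
   (forall k', (k <= k')%nat -> Cmod (Cminus (u (S k')) (u k')) <= W / 2 ^ S k') ->
   Cmod (Cminus L (u k)) <= W / 2 ^ k.
Proof.
intros hu.
assert (tele : forall W k p, 0 <= W ->
   (forall k', (k <= k')%nat -> Cmod (Cminus (u (S k')) (u k')) <= W / 2 ^ S k') ->
   Cmod (Cminus (u (k + p)%nat) (u k)) <= W / 2 ^ k - W / 2 ^ (k + p)).
{ intros W k p hW h. induction p as [|p IH].
  - rewrite Nat.add_0_r. replace (Cminus (u k) (u k)) with (RtoC 0) by ring. rewrite Cmod_0. lra.
  - rewrite Nat.add_succ_r. eapply Rle_trans; [apply (Cmod_triangle3 _ (u (k + p)%nat))|].
    specialize (h (k + p)%nat ltac:(lia)). simpl (2 ^ S (k + p)) in *.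
    assert (2 ^ (k + p) <> 0) by (apply pow_nonzero; lra).
    replace (W / (2 * 2 ^ (k + p))) with (W / 2 ^ (k + p) / 2) in * by (field; lra). lra. }
assert (hW0 : 0 <= W0).
{ pose proof (hu O). pose proof (Cmod_ge_0 (Cminus (u 1%nat) (u 0%nat))). simpl in H. lra. }
assert (geo : forall eps, 0 < eps -> exists N, forall k, (N <= k)%nat -> W0 / 2 ^ k < eps).
{ intros eps heps.
  destruct (pow_lt_1_zero (/ 2) ltac:(rewrite Rabs_right; lra) (eps / (W0 + 1)) ltac:(apply Rdiv_lt_0_compat; lra)) as [N hN].
  exists N. intros k hk. specialize (hN k hk). rewrite Rabs_right in hN by (apply Rle_ge, pow_le; lra).
  rewrite pow_inv in hN. apply Rle_lt_trans with ((W0 + 1) * / 2 ^ k).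
  - unfold Rdiv. apply Rmult_le_compat_r; [|lra]. left; apply Rinv_0_lt_compat, pow_lt; lra.
  - apply Rmult_lt_compat_l with (r := W0 + 1) in hN; [|lra].
    replace ((W0 + 1) * (eps / (W0 + 1))) with eps in hN by (field; lra). exact hN. }
assert (cau : forall (p : C -> R), (forall x y, Rabs (p x - p y) <= Cmod (Cminus x y)) ->
   exists l, Un_cv (fun k => p (u k)) l).
{ intros p hp. destruct (Rcomplete.R_complete (fun k => p (u k))) as [l hl]; [|now exists l].
  assert (half : forall eps, 0 < eps -> exists N, forall n, (n >= N)%nat -> Rabs (p (u n) - p (u N)) < eps).
  { intros eps heps. destruct (geo eps heps) as [N hN]. exists N. intros n hn.
    eapply Rle_lt_trans; [apply hp|].
    pose proof (tele W0 N (n - N)%nat hW0 (fun k' _ => hu k')) as ht.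
    replace (N + (n - N))%nat with n in ht by lia.
    specialize (hN N ltac:(lia)). assert (0 <= W0 / 2 ^ n).
    { apply Rdiv_le_0_compat; [lra | apply pow_lt; lra]. } lra. }
  intros eps heps. destruct (half (eps / 2) ltac:(lra)) as [N hN]. exists N. intros n1 n2 h1 h2.
  unfold Rdist. pose proof (hN n1 h1). pose proof (hN n2 h2).
  replace (p (u n1) - p (u n2)) with ((p (u n1) - p (u N)) - (p (u n2) - p (u N))) by ring.
  eapply Rle_lt_trans; [apply Rabs_triang|]. rewrite Rabs_Ropp. lra. }
destruct (cau fst) as [l1 h1].
{ intros x y. eapply Rle_trans; [|apply Rmax_Cmod]. apply Rmax_l. }
destruct (cau snd) as [l2 h2].
{ intros x y. eapply Rle_trans; [|apply Rmax_Cmod]. apply Rmax_r. }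
exists (l1, l2). intros W k hW h.
apply le_epsilon. intros eps heps.
destruct (h1 (eps / 2) ltac:(lra)) as [N1 hN1]. destruct (h2 (eps / 2) ltac:(lra)) as [N2 hN2].
set (p := (N1 + N2)%nat).
specialize (hN1 (k + p)%nat ltac:(unfold p; lia)). specialize (hN2 (k + p)%nat ltac:(unfold p; lia)).
unfold Rdist in *.
eapply Rle_trans; [apply (Cmod_triangle3 _ (u (k + p)%nat))|].
pose proof (tele W k p hW h).
assert (0 <= W / 2 ^ (k + p)) by (apply Rdiv_le_0_compat; [lra | apply pow_lt; lra]).
assert (Cmod (Cminus (l1, l2) (u (k + p)%nat)) <= eps); [|lra].
replace (Cminus (l1, l2) (u (k + p)%nat)) with
  (Cplus (RtoC (l1 - fst (u (k + p)%nat))) (Cmult (RtoC (l2 - snd (u (k + p)%nat))) Ci)).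
2:{ apply injective_projections; simpl; ring. }
eapply Rle_trans; [apply Cmod_triangle|]. rewrite Cmod_mult, !Cmod_R.
assert (Cmod Ci = 1) as ->.
{ unfold Cmod, Ci; simpl. replace (0 * (0 * 1) + 1 * (1 * 1)) with 1 by ring. apply sqrt_1. }
rewrite <- (Rabs_Ropp (l1 - _)), <- (Rabs_Ropp (l2 - _)), !Ropp_minus_distr. lra.
Qed.

(** The coefficients vanish from index [m] on, so that polynomials of different lengths can be
    subtracted termwise. *)
Definition approximates (f : R -> C) (x eps delta : R) (m : nat) (F : nat -> C) : Prop :=
  (forall i, Cmod (F i) <= 8) /\ (forall i, (m <= i)%nat -> F i = RtoC 0) /\
  forall y, Rabs y <= 1 -> Cmod (Cminus (f (x + eps * y)) (psum F y m)) <= delta.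

Lemma le_div_of_mul_le a b c : 0 < c -> a * c <= b -> a <= b / c.
Proof. intros hc h. now apply (proj1 (Rle_div_r a b c hc)). Qed.

Lemma psum_0 c n : (1 <= n)%nat -> psum c 0 n = c O.
Proof.
destruct n as [|n]; [lia|]. intros _. induction n as [|n IH].
- change (Cplus (RtoC 0) (Cmult (c 0%nat) (RtoC 1)) = c 0%nat). ring.
- change (Cplus (psum c 0 (S n)) (Cmult (c (S n)) (RtoC (0 ^ S n))) = c 0%nat).
  rewrite IH, pow_ne_zero by lia. ring.
Qed.

Lemma finite_max (c : nat -> R) n : exists U, 0 <= U /\ forall i, (i < n)%nat -> c i <= U.
Proof.
induction n as [|n [U [U0 hU]]]; [exists 0; split; [lra | intros; lia]|].
exists (Rmax U (c n)). split; [eapply Rle_trans; [exact U0 | apply Rmax_l]|].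
intros i hi. destruct (Nat.eq_dec i n) as [-> | h]; [apply Rmax_r|].
eapply Rle_trans; [apply hU; lia | apply Rmax_l].
Qed.

(** * Gluing the approximations at the scales [eps0 / 2 ^ k] into jets *)

Section Glue.
Variables (f : R -> C) (eps0 : R) (l : nat -> nat).
Hypothesis heps0 : 0 < eps0 <= / 2.
Hypothesis hl : forall k, (l k <= l (S k))%nat.
(** The errors are smaller than every power of the scale; this is the source of differentiability of
    all orders. *)
Hypothesis hsuper : forall n, exists K, 0 <= K /\ forall k, (2 ^ n) ^ k * (/ 40) ^ l k <= K.

(** The bound of [coef_small] expressed in the unscaled variable: the possible change of the [i]-th
    coefficient between the scales [k] and [k + 1]. *)
Definition increment_bound (i k : nat) : R := 34 * (1600 * 2 ^ S k / eps0) ^ i * (/ 40) ^ l k.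

Lemma pow2_pos k : 0 < 2 ^ k.
Proof. apply pow_lt; lra. Qed.

Lemma rate i n : exists K, 0 <= K /\ forall k, increment_bound i k <= K / (2 ^ n) ^ k / 2 ^ S k.
Proof.
destruct (hsuper (i + n + 1)) as [K [K0 hK]].
assert (h1 : 0 < (3200 / eps0) ^ i) by (apply pow_lt, Rdiv_lt_0_compat; lra).
exists (34 * (3200 / eps0) ^ i * 2 * K). split; [nra|]. intros k. specialize (hK k).
pose proof (pow2_pos k) as hk. pose proof (pow_lt _ k (pow2_pos n)) as hnk.
apply le_div_of_mul_le; [apply pow2_pos|]. apply le_div_of_mul_le; [exact hnk|].
unfold increment_bound.
replace (34 * (1600 * 2 ^ S k / eps0) ^ i * (/ 40) ^ l k * 2 ^ S k * (2 ^ n) ^ k)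
  with (34 * (3200 / eps0) ^ i * 2 * ((2 ^ (i + n + 1)) ^ k * (/ 40) ^ l k)).
- apply Rmult_le_compat_l; [nra | exact hK].
- replace (1600 * 2 ^ S k / eps0) with (3200 / eps0 * 2 ^ k) by (simpl; field; lra).
  rewrite Rpow_mult_distr, !pow_add, !Rpow_mult_distr, <- !pow_mult, (Nat.mul_comm k i).
  rewrite Nat.mul_1_l. simpl (2 ^ S k). ring.
Qed.

Lemma increment_step x k F F' m m' :
  approximates f x (eps0 / 2 ^ k) ((/ 40) ^ (2 * l k)) m F ->
  approximates f x (eps0 / 2 ^ S k) ((/ 40) ^ (2 * l (S k))) m' F' -> forall i,
  Cmod (Cminus (Cmult (F' i) (RtoC ((2 ^ S k / eps0) ^ i))) (Cmult (F i) (RtoC ((2 ^ k / eps0) ^ i))))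
    <= increment_bound i k.
Proof.
intros [F8 [Fz hF]] [F8' [Fz' hF']] i.
pose proof (pow2_pos k) as hk.
set (e := fun i => Cminus (Cmult (F i) (RtoC ((/ 2) ^ i))) (F' i)).
assert (half : forall i, 0 <= (/ 2) ^ i <= 1).
{ intros i'. split; [apply pow_le; lra|]. rewrite <- (pow1 i'). apply pow_incr; lra. }
pose proof (coef_small e (Nat.max m m') (l k)) as h.
assert (hi : Cmod (e i) <= 34 * 1600 ^ i * (/ 40) ^ l k).
{ apply h; clear h.
  - intros i'. unfold e. eapply Rle_trans; [apply Cmod_minus_le|].
    rewrite Cmod_mult, Cmod_R, Rabs_right by (apply Rle_ge, half).
    pose proof (F8 i'). pose proof (F8' i'). pose proof (half i'). pose proof (Cmod_ge_0 (F i')). nra.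
  - intros i' hi'. unfold e. rewrite Fz, Fz' by lia. ring.
  - intros y hy.
    assert (hy2 : Rabs (/ 2 * y) <= 1) by (rewrite Rabs_mult, Rabs_right; lra).
    assert (ee : psum e y (Nat.max m m') = Cminus (psum F (/ 2 * y) m) (psum F' y m')).
    { rewrite <- (psum_extend F (/ 2 * y) m (Nat.max m m')) by (auto; lia).
      rewrite <- (psum_extend F' y m' (Nat.max m m')) by (auto; lia).
      rewrite psum_scale, psum_minus. reflexivity. }
    rewrite ee. eapply Rle_trans; [apply (Cmod_triangle3 _ (f (x + eps0 / 2 ^ S k * y)))|].
    specialize (hF _ hy2). specialize (hF' _ hy).
    replace (x + eps0 / 2 ^ k * (/ 2 * y)) with (x + eps0 / 2 ^ S k * y) in hF by (simpl; field; lra).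
    rewrite Cmod_minus_sym in hF.
    assert ((/ 40) ^ (2 * l (S k)) <= (/ 40) ^ (2 * l k)); [|lra].
    rewrite !pow_inv. apply Rinv_le_contravar; [apply pow_lt; lra|].
    apply Rle_pow; [lra|]. specialize (hl k). lia. }
replace (Cminus (Cmult (F' i) (RtoC ((2 ^ S k / eps0) ^ i))) (Cmult (F i) (RtoC ((2 ^ k / eps0) ^ i))))
  with (Copp (Cmult (e i) (RtoC ((2 ^ S k / eps0) ^ i)))).
- assert (hp : 0 <= (2 ^ S k / eps0) ^ i).
  { apply pow_le, Rdiv_le_0_compat; [left; apply pow2_pos | lra]. }
  rewrite Cmod_opp, Cmod_mult, Cmod_R, Rabs_right by now apply Rle_ge.
  unfold increment_bound. replace (1600 * 2 ^ S k / eps0) with (1600 * (2 ^ S k / eps0)) by (field; lra).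
  rewrite Rpow_mult_distr.
  replace (34 * (1600 ^ i * (2 ^ S k / eps0) ^ i) * (/ 40) ^ l k)
    with (34 * 1600 ^ i * (/ 40) ^ l k * (2 ^ S k / eps0) ^ i) by ring.
  now apply Rmult_le_compat_r.
- unfold e. replace ((2 ^ k / eps0) ^ i) with ((/ 2) ^ i * (2 ^ S k / eps0) ^ i).
  + rewrite RtoC_mult. ring.
  + rewrite <- Rpow_mult_distr. f_equal. simpl. field. lra.
Qed.

(** [al i] is the limit over [k] of the [i]-th coefficient of [F k] in the unscaled variable, so
    [al] is the Taylor jet of [f] at [x]. The second clause holds for any [W], to give both fast
    decay and sharp bounds. *)
Definition jet_data (x : R) (al : nat -> C) (m : nat -> nat) (F : nat -> nat -> C) : Prop :=
  (forall k, approximates f x (eps0 / 2 ^ k) ((/ 40) ^ (2 * l k)) (m k) (F k)) /\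
  forall i W k, 0 <= W -> (forall k', (k <= k')%nat -> increment_bound i k' <= W / 2 ^ S k') ->
    Cmod (Cminus (al i) (Cmult (F k i) (RtoC ((2 ^ k / eps0) ^ i)))) <= W / 2 ^ k.

Lemma jet_data_exists x :
  (forall k, exists m F, approximates f x (eps0 / 2 ^ k) ((/ 40) ^ (2 * l k)) m F) ->
  exists al m F, jet_data x al m F.
Proof.
intros h.
destruct (choice (fun k mF => approximates f x (eps0 / 2 ^ k) ((/ 40) ^ (2 * l k)) (fst mF) (snd mF))) as [G hG].
{ intros k. destruct (h k) as [m [F hF]]. now exists (m, F). }
assert (lim : forall i, exists L, forall W k, 0 <= W ->
  (forall k', (k <= k')%nat -> increment_bound i k' <= W / 2 ^ S k') ->
    Cmod (Cminus L (Cmult (snd (G k) i) (RtoC ((2 ^ k / eps0) ^ i)))) <= W / 2 ^ k).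
{ intros i. destruct (rate i 0) as [W0 [hW0 hr]].
  destruct (geometric_limit (fun k => Cmult (snd (G k) i) (RtoC ((2 ^ k / eps0) ^ i))) W0) as [L hL].
  - intros k. eapply Rle_trans; [apply (increment_step x k _ _ _ _ (hG k) (hG (S k)))|].
    specialize (hr k). simpl (2 ^ 0) in hr. rewrite pow1, Rdiv_1_r in hr. exact hr.
  - exists L. intros W k hW hb. apply hL; [exact hW|]. intros k' hk'.
    eapply Rle_trans; [apply (increment_step x k' _ _ _ _ (hG k') (hG (S k')))|]. now apply hb. }
destruct (choice _ lim) as [al hal].
exists al, (fun k => fst (G k)), (fun k => snd (G k)). split; [exact hG|]. intros; now apply hal.
Qed.

(** [K] does not depend on [x]: recentering compares the jets at two different points. *)
Lemma jet_rate i n : exists K, 0 <= K /\ forall x al m F, jet_data x al m F ->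
  forall k, Cmod (Cminus (al i) (Cmult (F k i) (RtoC ((2 ^ k / eps0) ^ i)))) <= K / (2 ^ n) ^ k.
Proof.
destruct (rate i n) as [K [K0 hK]]. exists K. split; [exact K0|].
intros x al m F [_ h] k.
pose proof (pow_lt _ k (pow2_pos n)) as hnk.
eapply Rle_trans; [apply (h i (K / (2 ^ n) ^ k) k)|].
- apply Rdiv_le_0_compat; lra.
- intros k' hk'. eapply Rle_trans; [apply hK|].
  unfold Rdiv. apply Rmult_le_compat_r; [left; apply Rinv_0_lt_compat, pow2_pos|].
  apply Rmult_le_compat_l; [exact K0|]. apply Rinv_le_contravar; [exact hnk|].
  apply Rle_pow; [|exact hk']. apply pow_R1_Rle; lra.
- pose proof (pow_R1_Rle 2 k ltac:(lra)). apply Rle_div_l; [apply pow2_pos|].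
  assert (0 <= K / (2 ^ n) ^ k) by (apply Rdiv_le_0_compat; lra). nra.
Qed.

Lemma jet_value x al m F : jet_data x al m F -> al O = f x.
Proof.
intros h. destruct (jet_rate 0 1) as [K [K0 hK]]. specialize (hK x al m F h).
destruct (hsuper 1) as [K' [K0' hK']].
assert (hz : Cmod (Cminus (al O) (f x)) <= 0).
{ apply le_epsilon. intros e he.
  destruct (pow_lt_1_zero (/ 2) ltac:(rewrite Rabs_right; lra) (e / (K + K' + 1)) ltac:(apply Rdiv_lt_0_compat; lra)) as [N hN].
  specialize (hN N ltac:(lia)). rewrite Rabs_right, pow_inv in hN by (apply Rle_ge, pow_le; lra).
  pose proof (pow2_pos N) as hp.
  specialize (hK N). specialize (hK' N). rewrite !pow_1 in hK, hK'.
  destruct h as [ha _]. destruct (ha N) as [_ [Fz hF]].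
  specialize (hF 0 ltac:(rewrite Rabs_R0; lra)). rewrite Rmult_0_r, Rplus_0_r in hF.
  assert (e0 : psum (F N) 0 (m N) = F N O).
  { destruct (m N) as [|mm].
    - rewrite Fz by lia. reflexivity.
    - apply psum_0. lia. }
  rewrite e0, Cmod_minus_sym in hF.
  rewrite pow_O, Cmult_1_r in hK.
  eapply Rle_trans; [apply (Cmod_triangle3 _ (F N O))|].
  assert (hb : (/ 40) ^ (2 * l N) <= K' / 2 ^ N).
  { apply le_div_of_mul_le; [exact hp|]. eapply Rle_trans; [|exact hK'].
    rewrite Rmult_comm. apply Rmult_le_compat_l; [lra|].
    rewrite !pow_inv. apply Rinv_le_contravar; [apply pow_lt; lra|]. apply Rle_pow; [lra | lia]. }
  assert ((K + K' + 1) * / 2 ^ N <= e).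
  { apply Rmult_lt_compat_l with (r := K + K' + 1) in hN; [|lra].
    replace ((K + K' + 1) * (e / (K + K' + 1))) with e in hN by (field; lra). lra. }
  unfold Rdiv in *. assert (0 < / 2 ^ N) by now apply Rinv_0_lt_compat. lra. }
pose proof (Cmod_ge_0 (Cminus (al O) (f x))).
assert (e : Cminus (al O) (f x) = RtoC 0) by (apply Cmod_eq_0; lra).
replace (al O) with (Cplus (Cminus (al O) (f x)) (f x)) by ring. rewrite e. ring.
Qed.

(** The increment is matched with the square of the scale. Then [y = h * 2 ^ k / eps0] satisfies
    [y ^ 2 <= |h|], and cutting after [2 n] terms leaves only [O(|h| ^ n)]. *)
Lemma scale_selection h : 0 < h <= eps0 ^ 2 ->
  exists k, eps0 ^ 2 / (4 * (2 ^ k) ^ 2) < h <= eps0 ^ 2 / (2 ^ k) ^ 2.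
Proof.
intros [h0 h1].
assert (main : forall N, eps0 ^ 2 / (2 ^ N) ^ 2 < h ->
  exists k, eps0 ^ 2 / (4 * (2 ^ k) ^ 2) < h <= eps0 ^ 2 / (2 ^ k) ^ 2).
{ induction N as [|N IH]; intros hN.
  - simpl in hN. rewrite !Rmult_1_r, Rdiv_1_r in hN. simpl in h1. rewrite Rmult_1_r in h1. lra.
  - destruct (Rlt_le_dec (eps0 ^ 2 / (2 ^ N) ^ 2) h) as [h2 | h2]; [now apply IH|].
    exists N. split; [|exact h2]. pose proof (pow2_pos N).
    replace (4 * (2 ^ N) ^ 2) with ((2 ^ S N) ^ 2) by (simpl; ring). exact hN. }
destruct (pow_lt_1_zero (/ 2) ltac:(rewrite Rabs_right; lra) h h0) as [N hN].
specialize (hN N ltac:(lia)). rewrite Rabs_right, pow_inv in hN by (apply Rle_ge, pow_le; lra).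
apply (main N). eapply Rle_lt_trans; [|exact hN].
pose proof (pow_R1_Rle 2 N ltac:(lra)). set (q := 2 ^ N) in *.
apply Rle_div_l; [nra|]. replace (/ q * q ^ 2) with q by (field; lra).
apply Rle_trans with 1; [|lra]. simpl. nra.
Qed.

(** Four comparisons, each [O(|h| ^ n)] at the scale chosen for [h]: [f] with its approximant, the
    approximant with its first [2 n] terms, these with the first [n] terms, and the coefficients
    with their limits. The powers [(2 ^ k) ^ (2 n)] in the rates are comparable to [|h| ^ (- n)]. *)
Lemma jet_peano n : (1 <= n)%nat -> exists K, 0 <= K /\ forall x al m F, jet_data x al m F ->
  forall h, Rabs h <= eps0 ^ 2 -> Cmod (Cminus (f (x + h)) (psum al h n)) <= K * Rabs h ^ n.
Proof.
intros hn.
destruct (choice _ (fun i => jet_rate i (2 * n))) as [Kr hKr].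
destruct (finite_max Kr (2 * n)) as [U1 [U10 hU1]].
destruct (finite_max (fun i => 8 * (1 / eps0) ^ i + 2 * Kr i) (2 * n)) as [U2 [U20 hU2]].
destruct (hsuper (2 * n)) as [K3 [K30 hK3]].
set (G := (4 / eps0 ^ 2) ^ n).
assert (he2 : 0 < eps0 ^ 2 <= / 4) by (simpl; nra).
assert (hG : 0 < G) by (apply pow_lt, Rdiv_lt_0_compat; lra).
exists (K3 * G + 16 + 2 * U2 + 2 * U1 * G). split; [nra|].
intros x al m F hdata h hh.
destruct (Req_dec h 0) as [-> | hne].
{ rewrite psum_0, Rplus_0_r, (jet_value x al m F hdata) by assumption.
  replace (Cminus (f x) (f x)) with (RtoC 0) by ring. rewrite Cmod_0, Rabs_R0.
  rewrite pow_ne_zero by lia. lra. }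
assert (hpos : 0 < Rabs h) by now apply Rabs_pos_lt.
destruct (scale_selection (Rabs h) ltac:(lra)) as [k [hk1 hk2]].
pose proof (pow_R1_Rle 2 k ltac:(lra)) as hq.
destruct hdata as [ha hlim] eqn:Ed. clear Ed.
destruct (ha k) as [F8 [Fz hF]].
assert (hq2 : (2 ^ (2 * n)) ^ k = ((2 ^ k) ^ 2) ^ n).
{ rewrite <- !pow_mult. f_equal. lia. }
set (q := 2 ^ k) in *.
assert (hq2pos : 0 < (q ^ 2) ^ n) by (apply pow_lt; simpl; nra).
assert (hinv : / (q ^ 2) ^ n <= G * Rabs h ^ n).
{ unfold G. rewrite <- Rpow_mult_distr, <- pow_inv. apply pow_incr. split.
  - left; apply Rinv_0_lt_compat; simpl; nra.
  - apply Rle_trans with (4 / eps0 ^ 2 * (eps0 ^ 2 / (4 * q ^ 2))).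
    + right. field. split; lra.
    + apply Rmult_le_compat_l; [apply Rdiv_le_0_compat; lra | lra]. }
set (y := h * q / eps0).
assert (hy2 : Rabs y ^ 2 <= Rabs h).
{ unfold y. unfold Rdiv. rewrite !Rabs_mult, (Rabs_right q), (Rabs_right (/ eps0)).
  2:{ apply Rle_ge; left; apply Rinv_0_lt_compat; lra. } 2: lra.
  replace ((Rabs h * q * / eps0) ^ 2) with (Rabs h * (Rabs h * (q ^ 2 / eps0 ^ 2))) by (field; lra).
  rewrite <- (Rmult_1_r (Rabs h)) at 3. apply Rmult_le_compat_l; [lra|].
  apply Rle_trans with (eps0 ^ 2 / q ^ 2 * (q ^ 2 / eps0 ^ 2)).
  - apply Rmult_le_compat_r; [|exact hk2]. apply Rdiv_le_0_compat; [simpl; nra | lra].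
  - right. field. split; lra. }
assert (hy : Rabs y <= / 2).
{ apply Rnot_lt_le. intros hlt. pose proof (Rabs_pos y). simpl in hy2. nra. }
assert (hh2 : Rabs h <= / 2) by lra.
assert (T1 : Cmod (Cminus (f (x + h)) (psum (F k) y (m k))) <= K3 * G * Rabs h ^ n).
{ specialize (hF y ltac:(lra)).
  replace (x + eps0 / q * y) with (x + h) in hF by (unfold y; field; lra).
  eapply Rle_trans; [exact hF|].
  apply Rle_trans with (K3 * / (q ^ 2) ^ n).
  - apply le_div_of_mul_le; [exact hq2pos|].
    rewrite <- hq2, Rmult_comm. eapply Rle_trans; [|apply (hK3 k)].
    apply Rmult_le_compat_l; [apply pow_le, pow_le; lra|].
    rewrite !pow_inv. apply Rinv_le_contravar; [apply pow_lt; lra|]. apply Rle_pow; [lra | lia].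
  - rewrite Rmult_assoc. apply Rmult_le_compat_l; assumption. }
assert (T2 : Cmod (Cminus (psum (F k) y (m k)) (psum (F k) y (2 * n))) <= 16 * Rabs h ^ n).
{ rewrite <- (psum_extend (F k) y (m k) (Nat.max (m k) (2 * n))) by (auto; lia).
  eapply Rle_trans; [apply (psum_tail _ _ _ _ 8); auto; [lia | lra]|].
  rewrite pow_mult. replace (2 * 8) with 16 by ring. apply Rmult_le_compat_l; [lra|].
  apply pow_incr. split; [apply pow_le, Rabs_pos | exact hy2]. }
set (u := fun i => Cmult (F k i) (RtoC ((q / eps0) ^ i))).
assert (eu : psum (F k) y (2 * n) = psum u h (2 * n)).
{ unfold y. replace (h * q / eps0) with (q / eps0 * h) by (field; lra). apply psum_scale. }
assert (hdist : forall i, (i < 2 * n)%nat -> Cmod (Cminus (al i) (u i)) <= U1 * / (q ^ 2) ^ n).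
{ intros i hi. destruct (hKr i) as [Ki0 hKi]. eapply Rle_trans; [apply (hKi x al m F hdata k)|].
  rewrite hq2. apply Rmult_le_compat_r; [left; now apply Rinv_0_lt_compat | now apply hU1]. }
assert (hu : forall i, (i < 2 * n)%nat -> Cmod (u i) <= U2).
{ intros i hi. eapply Rle_trans; [|apply (hU2 i hi)].
  destruct (hKr i) as [Ki0 hKi].
  pose proof (hKi x al m F hdata k) as d1. pose proof (hKi x al m F hdata O) as d2.
  assert (d1' : Cmod (Cminus (al i) (u i)) <= Kr i).
  { eapply Rle_trans; [exact d1|]. apply Rle_div_l; [rewrite hq2; exact hq2pos|].
    rewrite hq2. assert (1 <= (q ^ 2) ^ n) by (apply pow_R1_Rle; simpl; nra). nra. }
  rewrite pow_O, pow_O, Rdiv_1_r in d2.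
  set (u0 := Cmult (F 0%nat i) (RtoC ((1 / eps0) ^ i))) in *.
  assert (hu0 : Cmod u0 <= 8 * (1 / eps0) ^ i).
  { unfold u0. assert (0 <= (1 / eps0) ^ i) by (apply pow_le, Rdiv_le_0_compat; lra).
    rewrite Cmod_mult, Cmod_R, Rabs_right by lra.
    apply Rmult_le_compat_r; [assumption|]. apply (ha O). }
  replace (u i) with (Cplus u0 (Cminus (Cminus (al i) u0) (Cminus (al i) (u i)))) by ring.
  eapply Rle_trans; [apply Cmod_triangle|].
  pose proof (Cmod_minus_le (Cminus (al i) u0) (Cminus (al i) (u i))). lra. }
assert (T3 : Cmod (Cminus (psum u h (2 * n)) (psum u h n)) <= 2 * U2 * Rabs h ^ n).
{ apply psum_tail; auto; lia. }
assert (T4 : Cmod (Cminus (psum u h n) (psum al h n)) <= 2 * U1 * G * Rabs h ^ n).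
{ rewrite Cmod_minus_sym, psum_minus.
  eapply Rle_trans; [apply (psum_bound _ _ _ (U1 * / (q ^ 2) ^ n))|].
  - apply Rmult_le_pos; [exact U10 | left; now apply Rinv_0_lt_compat].
  - intros i hi. apply hdist. lia.
  - exact hh2.
  - rewrite !Rmult_assoc. apply Rmult_le_compat_l; [lra|].
    apply Rmult_le_compat_l; [exact U10 | exact hinv]. }
rewrite eu in T2.
pose proof (Cmod_triangle3 (f (x + h)) (psum (F k) y (m k)) (psum al h n)).
pose proof (Cmod_triangle3 (psum (F k) y (m k)) (psum u h (2 * n)) (psum al h n)).
pose proof (Cmod_triangle3 (psum u h (2 * n)) (psum u h n) (psum al h n)).
lra.
Qed.

(* Converse of Taylor's theorem: the jets at [x] and at [x + h] both describe [f]
   near [x + h], and recentering the former compares their coefficients. *)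
Lemma jet_derive a b (al : R -> nat -> C) i :
  (forall x, a < x < b -> exists m F, jet_data x (al x) m F) ->
  forall x, a < x < b -> is_derive (V := C_R_NormedModule)
    (fun x => Cmult (al x i) (RtoC (INR (fact i)))) x (Cmult (al x (S i)) (RtoC (INR (fact (S i))))).
Proof.
intros hal x hx.
destruct (jet_peano (S (S i)) ltac:(lia)) as [K [K0 hK]].
assert (he2 : 0 < eps0 ^ 2) by (simpl; nra).
set (r := Rmin (Rmin (x - a) (b - x)) (eps0 ^ 2 / 2)).
assert (hr : 0 < r) by (repeat apply Rmin_pos; lra).
set (K' := 40 ^ S (S i) * (K * (2 ^ S (S i) + 1))).
apply (is_derive_C_of_quadratic _ _ _ (K' * INR (fact i)) r hr).
intros h hh.
assert (hh1 : Rabs h < eps0 ^ 2 / 2) by (eapply Rlt_le_trans; [exact hh | apply Rmin_r]).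
assert (hh2 : Rabs h < x - a /\ Rabs h < b - x).
{ split; (eapply Rlt_le_trans; [exact hh | eapply Rle_trans; [apply Rmin_l|]]); [apply Rmin_l | apply Rmin_r]. }
pose proof (Rle_abs h) as ha1. pose proof (Rle_abs (- h)) as ha2. rewrite Rabs_Ropp in ha2.
assert (hf : 0 < INR (fact i)) by apply lt_0_INR, lt_O_fact.
destruct (Req_dec h 0) as [-> | hne].
{ rewrite Rplus_0_r.
  match goal with |- Cmod ?z <= _ => replace z with (RtoC 0) by ring end.
  rewrite Cmod_0. simpl. lra. }
assert (hpos : 0 < Rabs h) by now apply Rabs_pos_lt.
destruct (hal x hx) as [m [F hd]]. destruct (hal (x + h) ltac:(lra)) as [m' [F' hd']].
set (M := K * (2 ^ S (S i) + 1) * Rabs h ^ S (S i)).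
assert (hM : forall y, Rabs y <= Rabs h ->
  Cmod (Cminus (psum (al x) (h + y) (S (S i))) (psum (al (x + h)) y (S (S i)))) <= M).
{ intros y hy. pose proof (Rabs_triang h y).
  pose proof (hK _ _ _ _ hd (h + y) ltac:(lra)) as e1.
  pose proof (hK _ _ _ _ hd' y ltac:(lra)) as e2.
  replace (x + (h + y)) with (x + h + y) in e1 by ring.
  rewrite Cmod_minus_sym in e1.
  eapply Rle_trans; [apply (Cmod_triangle3 _ (f (x + h + y)))|].
  assert (p1 : Rabs (h + y) ^ S (S i) <= (2 * Rabs h) ^ S (S i)).
  { apply pow_incr. split; [apply Rabs_pos | lra]. }
  assert (p2 : Rabs y ^ S (S i) <= Rabs h ^ S (S i)).
  { apply pow_incr. split; [apply Rabs_pos | lra]. }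
  rewrite Rpow_mult_distr in p1. unfold M.
  assert (K * Rabs (h + y) ^ S (S i) <= K * (2 ^ S (S i) * Rabs h ^ S (S i))) by now apply Rmult_le_compat_l.
  assert (K * Rabs y ^ S (S i) <= K * Rabs h ^ S (S i)) by now apply Rmult_le_compat_l.
  lra. }
pose proof (PolynomialRoots.psum_recenter (i := i) hpos hM) as hrec.
set (z := Cminus (Cplus (al x i) (Cmult (al x (S i)) (RtoC (INR (S i) * h)))) (al (x + h) i)) in *.
change (Cmod z * Rabs h ^ i <= 40 ^ S (S i) * M) in hrec.
assert (hz : Cmod z <= K' * h ^ 2).
{ assert (hpi : 0 < Rabs h ^ i) by now apply pow_lt.
  apply Rmult_le_reg_r with (Rabs h ^ i); [exact hpi|].
  eapply Rle_trans; [exact hrec|]. right. unfold M, K'. rewrite <- pow2_abs. simpl. ring. }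
match goal with |- Cmod ?d <= _ => replace d with (Copp (Cmult z (RtoC (INR (fact i))))) end.
2:{ unfold z. rewrite fact_simpl, mult_INR, !RtoC_mult. ring. }
rewrite Cmod_opp, Cmod_mult, Cmod_R, Rabs_right by lra.
replace (K' * INR (fact i) * h ^ 2) with (K' * h ^ 2 * INR (fact i)) by ring.
apply Rmult_le_compat_r; [lra | exact hz].
Qed.

(** The [i]-th Taylor coefficient is that of the coarsest approximant, at most [V i], plus
    increments that sum to at most [V i]. *)
Theorem bounded_derivs_of_approximation a b (V : nat -> R) :
  (forall x, a < x < b -> forall k, exists m F,
     approximates f x (eps0 / 2 ^ k) ((/ 40) ^ (2 * l k)) m F) ->
  (forall i, 8 * (1 / eps0) ^ i <= V i) ->
  (forall i k, increment_bound i k <= V i / 2 ^ S k) ->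
  bounded_derivs a b f (fun i => 2 * V i * INR (fact i)).
Proof.
intros happ hV hinc.
assert (hex : forall x, exists al, a < x < b -> exists m F, jet_data x al m F).
{ intros x. destruct (classic (a < x < b)) as [hx | hx].
  - destruct (jet_data_exists x (happ x hx)) as [al h]. now exists al.
  - exists (fun _ => RtoC 0). tauto. }
destruct (choice _ hex) as [al hal].
exists (fun i x => Cmult (al x i) (RtoC (INR (fact i)))). split; [|split].
- intros x hx. destruct (hal x hx) as [m [F hd]]. rewrite (jet_value x _ m F hd).
  change (INR (fact 0)) with 1. ring.
- intros i x hx. now apply (jet_derive a b al i hal).
- intros i x hx. destruct (hal x hx) as [m [F hd]].
  assert (hf : 0 < INR (fact i)) by apply lt_0_INR, lt_O_fact.
  rewrite Cmod_mult, Cmod_R, Rabs_right by lra.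
  apply Rmult_le_compat_r; [lra|].
  assert (hp : 0 <= (1 / eps0) ^ i) by (apply pow_le, Rdiv_le_0_compat; lra).
  destruct hd as [ha h]. specialize (h i (V i) O ltac:(pose proof (hV i); lra) (fun k' _ => hinc i k')).
  rewrite pow_O, Rdiv_1_r in h. destruct (ha O) as [F8 _].
  set (u0 := Cmult (F 0%nat i) (RtoC ((1 / eps0) ^ i))) in *.
  assert (Cmod u0 <= V i).
  { unfold u0. rewrite Cmod_mult, Cmod_R, Rabs_right by lra.
    eapply Rle_trans; [|apply hV]. now apply Rmult_le_compat_r. }
  replace (al x i) with (Cplus u0 (Cminus (al x i) u0)) by ring.
  eapply Rle_trans; [apply Cmod_triangle|]. lra.
Qed.
End Glue.

(** * Quantitative roots and germs *)

Lemma fact_le_pow i : INR (fact i) <= INR i ^ i.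
Proof.
assert (h : (fact i <= i ^ i)%nat); [|rewrite <- pow_INR; now apply le_INR].
induction i as [|i IH]; [simpl; lia|].
change (fact (S i)) with (S i * fact i)%nat. rewrite Nat.pow_succ_r'.
apply Nat.mul_le_mono_l. eapply Nat.le_trans; [exact IH|]. apply Nat.pow_le_mono_l. lia.
Qed.

(** [i! / beta ^ i] is at most [r ^ i] for [r = max 1 (i / beta)], hence at most
    [Mw w rho i * exp (w r / rho)]. The tangent gives [w r <= w t + s r <= w t + 1 + rho * i], and
    the excess [exp i <= 3 ^ i] is absorbed by tripling [rho]. *)
Lemma fact_scale_bound w s t beta rho i : weight_function w -> concave_nonneg w ->
  0 < s <= 1 -> tangent w s t -> 0 < beta -> 0 < rho -> s / beta <= rho ->
  INR (fact i) * (/ beta) ^ i <= Mw w (3 * rho) i * exp ((1 + w t) / rho).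
Proof.
intros Hw Hc hs htan hb hr hsb.
set (r := Rmax 1 (INR i / beta)).
assert (hib : 0 <= INR i / beta) by (apply Rdiv_le_0_compat; [apply pos_INR | lra]).
assert (hr1 : 1 <= r) by apply Rmax_l.
assert (hr2 : r <= 1 + INR i / beta) by (unfold r; apply Rmax_lub; lra).
assert (h1 : INR (fact i) * (/ beta) ^ i <= r ^ i).
{ apply Rle_trans with ((INR i / beta) ^ i).
  - unfold Rdiv. rewrite Rpow_mult_distr. apply Rmult_le_compat_r; [|apply fact_le_pow].
    apply pow_le; left; now apply Rinv_0_lt_compat.
  - apply pow_incr. split; [exact hib | apply Rmax_r]. }
assert (hwr : w r / rho <= (1 + w t) / rho + INR i).
{ destruct htan as [t0 h]. specialize (h r ltac:(lra)).
  assert (s * r <= s + s / beta * INR i).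
  { apply Rle_trans with (s * (1 + INR i / beta)); [apply Rmult_le_compat_l; lra|].
    right. field. lra. }
  assert (s / beta * INR i <= rho * INR i) by (apply Rmult_le_compat_r; [apply pos_INR | lra]).
  apply Rle_div_l; [lra|].
  replace (((1 + w t) / rho + INR i) * rho) with (1 + w t + rho * INR i) by (field; lra).
  assert (0 <= s * t) by (apply Rmult_le_pos; lra). lra. }
pose proof (Mw_upper w Hw rho i r hr hr1) as hu.
eapply Rle_trans; [exact h1|].
apply Rle_trans with (Mw w rho i * exp (w r / rho)).
{ apply Rle_trans with (r ^ i * exp (- w r / rho) * exp (w r / rho)).
  - rewrite Rmult_assoc, <- exp_plus. replace (- w r / rho + w r / rho) with 0 by (field; lra).
    rewrite exp_0; lra.
  - apply Rmult_le_compat_r; [left; apply exp_pos | exact hu]. }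
apply Rle_trans with (Mw w rho i * (exp ((1 + w t) / rho) * 3 ^ i)).
{ apply Rmult_le_compat_l; [left; apply exp_pos|].
  eapply Rle_trans; [apply exp_le_mono, hwr|]. rewrite exp_plus.
  apply Rmult_le_compat_l; [left; apply exp_pos|].
  rewrite <- (Rmult_1_r (INR i)), <- exp_pow. apply pow_incr.
  split; [left; apply exp_pos | apply exp_le_3]. }
pose proof (Mw_scale w Hw Hc 3 rho i ltac:(lra) hr) as hm.
replace (Mw w rho i * (exp ((1 + w t) / rho) * 3 ^ i)) with (3 ^ i * Mw w rho i * exp ((1 + w t) / rho)) by ring.
apply Rmult_le_compat_r; [left; apply exp_pos | exact hm].
Qed.

Lemma tangent_antitone w s s' t t' : tangent w s t -> tangent w s' t' -> s' < s -> t <= t'.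
Proof.
intros [h0 h] [h0' h'] hs. specialize (h t' h0'). specialize (h' t h0).
apply Rnot_lt_le. intros hlt. assert (0 < (s - s') * (t - t')) by (apply Rmult_lt_0_compat; lra). lra.
Qed.

Lemma w_log_lower w A : weight_function w -> 0 < A ->
  exists K, 0 <= K /\ forall r, 1 <= r -> A * ln r - K <= w r.
Proof.
intros Hw hA. destruct (w_log w Hw (/ A)) as [T [T1 hT]]; [now apply Rinv_0_lt_compat|].
assert (hlT : 0 <= ln T) by (rewrite <- ln_1; apply ln_le; lra).
exists (A * ln T). split; [nra|]. intros r hr.
destruct (Rle_lt_dec T r) as [h | h].
- specialize (hT r h). assert (A * ln r <= A * (/ A * w r)) by (apply Rmult_le_compat_l; lra).
  replace (A * (/ A * w r)) with (w r) in H by (field; lra). nra.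
- assert (ln r <= ln T) by (apply ln_le; lra).
  pose proof (w_nonneg w Hw r ltac:(lra)). nra.
Qed.

(** The slope [s0 / 2 ^ k] forces [w (t k) >= w (2 ^ k / s0) - 1], and [w] exceeds every multiple of
    the logarithm up to a constant. *)
Lemma tangent_superpolynomial w s0 (t : nat -> R) c n : weight_function w -> 0 < s0 <= 1 -> 0 < c ->
  (forall k, tangent w (s0 / 2 ^ k) (t k)) ->
  exists K, 0 <= K /\ forall k, (2 ^ n) ^ k * exp (- (c * w (t k))) <= K.
Proof.
intros Hw hs hc ht.
assert (hn : 0 < INR (S n)) by (apply lt_0_INR; lia).
destruct (w_log_lower w (INR (S n) / c) Hw) as [K [K0 hK]]; [now apply Rdiv_lt_0_compat|].
exists (exp (c * (K + 1))). split; [left; apply exp_pos|]. intros k.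
pose proof (pow2_pos k) as hk. pose proof (pow_R1_Rle 2 k ltac:(lra)) as hk1.
assert (hsk : 0 < s0 / 2 ^ k <= 1).
{ split; [apply Rdiv_lt_0_compat; lra | apply Rle_div_l; lra]. }
destruct (tangent_lower_bounds w Hw _ _ (proj1 hsk) (ht k)) as [_ h2].
assert (hi : 2 ^ k <= / (s0 / 2 ^ k)).
{ rewrite Rinv_div. apply le_div_of_mul_le; [lra|]. nra. }
specialize (hK (/ (s0 / 2 ^ k)) ltac:(lra)).
assert (hln : ln (2 ^ k) <= ln (/ (s0 / 2 ^ k))) by (apply ln_le; lra).
rewrite <- pow_mult, Nat.mul_comm, pow_mult, pow_exp with (x := 2 ^ k) by lra.
rewrite <- exp_plus. apply exp_le_mono.
assert (h0 : 0 <= ln (2 ^ k)) by (rewrite <- ln_1; apply ln_le; lra).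
assert (INR (S n) / c * ln (2 ^ k) <= w (t k) + K + 1).
{ assert (INR (S n) / c * ln (2 ^ k) <= INR (S n) / c * ln (/ (s0 / 2 ^ k))); [|lra].
  apply Rmult_le_compat_l; [left; now apply Rdiv_lt_0_compat | exact hln]. }
assert (INR (S n) * ln (2 ^ k) <= c * (w (t k) + K + 1)).
{ replace (INR (S n) * ln (2 ^ k)) with (c * (INR (S n) / c * ln (2 ^ k))) by (field; lra).
  apply Rmult_le_compat_l; lra. }
rewrite S_INR in H0. lra.
Qed.

Theorem quantitative_root j : (1 <= j)%nat ->
  exists C0, 0 < C0 /\ forall w rho a b f, weight_function w -> concave_nonneg w -> 0 < rho ->
  bounded_derivs a b (fun x => Cpow (f x) j) (Mw w rho) ->
  bounded_derivs a b (fun x => Cpow (f x) (S j)) (Mw w rho) ->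
  forall a' b', a < a' -> b' < b ->
  exists K, bounded_derivs a' b' f (fun n => K * Mw w (C0 * rho) n).
Proof.
intros hj. destruct (local_approx j hj) as [theta [c [E0 [hth [hc [hE0 happ]]]]]].
set (kap := exp (- / theta)). assert (hkap : 0 < kap) by apply exp_pos.
(* The first summand meets the condition on [s / beta] in [fact_scale_bound], the second makes the
   loss [exp (w t / rho1)] there at most [exp (c * E / 4)]. *)
set (C1 := 3200 / kap + 8 / c).
assert (hp1 : 0 < 3200 / kap) by (apply Rdiv_lt_0_compat; lra).
assert (hp2 : 0 < 8 / c) by (apply Rdiv_lt_0_compat; lra).
exists (3 * C1). split; [unfold C1; lra|].
intros w rho a b f Hw Hc hr hg hh a' b' ha hb.
set (rho1 := C1 * rho). assert (hrho1 : 0 < rho1) by (unfold rho1, C1; nra).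
replace (3 * C1 * rho) with (3 * rho1) by (unfold rho1; ring).
destruct (w_log w Hw (/ (2 * rho))) as [T0 [T1 hT]]; [apply Rinv_0_lt_compat; lra|].
(* One threshold for two conditions of [local_approx]: [t > T0] gives the logarithmic bound on [t],
   and [w t > 2 * rho * E0] gives [E >= E0]. *)
destruct (tangent_large w Hw (T0 + 2 * rho * E0)) as [s1 [s1p hs1]].
set (d := Rmin (/ 2) (Rmin (a' - a) (b - b') / 2)).
assert (hd : 0 < d).
{ unfold d. apply Rmin_pos; [lra|]. assert (0 < Rmin (a' - a) (b - b')) by (apply Rmin_pos; lra). lra. }
set (s0 := Rmin (Rmin 1 s1) (d * rho / kap)).
assert (hs0 : 0 < s0).
{ unfold s0. repeat apply Rmin_pos; try lra. apply Rdiv_lt_0_compat; nra. }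
assert (hs01 : s0 <= 1) by (unfold s0; eapply Rle_trans; [apply Rmin_l | apply Rmin_l]).
assert (hs0s1 : s0 <= s1) by (unfold s0; eapply Rle_trans; [apply Rmin_l | apply Rmin_r]).
set (eps0 := kap * s0 / rho).
assert (heps0 : 0 < eps0) by (unfold eps0; apply Rdiv_lt_0_compat; nra).
assert (heps0d : eps0 <= d).
{ unfold eps0. apply Rle_div_l; [lra|].
  apply Rle_trans with (kap * (d * rho / kap)); [apply Rmult_le_compat_l; [lra | apply Rmin_r]|].
  right. field. lra. }
assert (heps0h : eps0 <= / 2) by (eapply Rle_trans; [exact heps0d | apply Rmin_l]).
assert (hmar : eps0 < a' - a /\ eps0 < b - b').
{ assert (h2 : d <= Rmin (a' - a) (b - b') / 2) by apply Rmin_r.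
  pose proof (Rmin_l (a' - a) (b - b')). pose proof (Rmin_r (a' - a) (b - b')). lra. }
assert (hsk : forall k, 0 < s0 / 2 ^ k <= s0).
{ intros k. pose proof (pow_R1_Rle 2 k ltac:(lra)). split; [apply Rdiv_lt_0_compat; lra|].
  apply Rle_div_l; [lra|]. nra. }
destruct (choice (fun k t => tangent w (s0 / 2 ^ k) t)) as [t ht].
{ intros k. apply exists_tangent; [exact Hw | apply hsk]. }
set (E := fun k => w (t k) / (2 * rho)).
assert (htk : forall k, T0 + 2 * rho * E0 < t k /\ T0 + 2 * rho * E0 < w (t k)).
{ intros k. apply (hs1 (s0 / 2 ^ k)); [|apply ht]. pose proof (hsk k). lra. }
assert (hrE : 0 < 2 * rho * E0) by nra.
assert (hE : forall k, E0 <= E k).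
{ intros k. unfold E. apply le_div_of_mul_le; [lra|]. destruct (htk k). lra. }
assert (hwE : forall k, w (t k) = 2 * rho * E k) by (intros k; unfold E; field; lra).
assert (Emono : forall k, E k <= E (S k)).
{ intros k. unfold E, Rdiv. apply Rmult_le_compat_r; [left; apply Rinv_0_lt_compat; lra|].
  apply (w_mono w Hw); [apply (ht k)|].
  apply (tangent_antitone w _ _ _ _ (ht k) (ht (S k))).
  pose proof (pow2_pos k). simpl. replace (s0 / (2 * 2 ^ k)) with (s0 / 2 ^ k / 2) by (field; lra).
  pose proof (hsk k). lra. }
assert (hln40 : 0 < ln 40) by (rewrite <- ln_1; apply ln_increasing; lra).
(* [l k] is the largest integer with [exp (- c * E k) <= 40 ^ (- 2 * l k)], so nothing but a factor
   40 is lost in [40 ^ (- l k) <= 40 * exp (- c * E k / 2)]. *)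
destruct (choice (fun k n => INR n <= c * E k / (2 * ln 40) < INR n + 1)) as [l hl].
{ intros k. destruct (nfloor_ex (c * E k / (2 * ln 40))) as [n hn]; [|now exists n].
  apply Rdiv_le_0_compat; [|lra]. pose proof (hE k). nra. }
assert (lmono : forall k, (l k <= l (S k))%nat).
{ intros k. destruct (hl k) as [h1 _]. destruct (hl (S k)) as [_ h2].
  assert (c * E k / (2 * ln 40) <= c * E (S k) / (2 * ln 40)).
  { unfold Rdiv. apply Rmult_le_compat_r; [left; apply Rinv_0_lt_compat; lra|].
    apply Rmult_le_compat_l; [lra | apply Emono]. }
  assert (h3 : INR (l k) < INR (S (l (S k)))) by (rewrite S_INR; lra).
  apply INR_lt in h3. lia. }
assert (inv40 : forall n, (/ 40) ^ n = exp (- (INR n * ln 40))).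
{ intros n. rewrite pow_exp by lra. rewrite ln_Rinv by lra. f_equal; ring. }
assert (hlow : forall k, exp (- (c * E k)) <= (/ 40) ^ (2 * l k)).
{ intros k. rewrite inv40, mult_INR. apply exp_le_mono. destruct (hl k) as [h1 _].
  apply Rmult_le_compat_r with (r := 2 * ln 40) in h1; [|lra].
  replace (c * E k / (2 * ln 40) * (2 * ln 40)) with (c * E k) in h1 by (field; lra).
  simpl (INR 2). lra. }
assert (hup : forall k, (/ 40) ^ l k <= 40 * exp (- (c * E k / 2))).
{ intros k. rewrite inv40. rewrite <- (exp_ln 40) at 2 by lra. rewrite <- exp_plus. apply exp_le_mono.
  destruct (hl k) as [_ h2].
  apply Rmult_lt_compat_r with (r := ln 40) in h2; [|lra].
  replace (c * E k / (2 * ln 40) * ln 40) with (c * E k / 2) in h2 by (field; lra). lra. }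
assert (hsup : forall n, exists K, 0 <= K /\ forall k, (2 ^ n) ^ k * (/ 40) ^ l k <= K).
{ intros n.
  destruct (tangent_superpolynomial w s0 t (c / (4 * rho)) n Hw ltac:(lra) ltac:(apply Rdiv_lt_0_compat; lra) ht) as [K [K0 hK]].
  exists (40 * K). split; [lra|]. intros k. specialize (hK k).
  rewrite hwE in hK. replace (c / (4 * rho) * (2 * rho * E k)) with (c * E k / 2) in hK by (field; lra).
  apply Rle_trans with ((2 ^ n) ^ k * (40 * exp (- (c * E k / 2)))); [|lra].
  apply Rmult_le_compat_l; [apply pow_le, pow_le; lra | apply hup]. }
assert (h4 : exists K, 0 <= K /\ forall k, 2 ^ k * exp (- (c * E k / 4)) <= K).
{ destruct (tangent_superpolynomial w s0 t (c / (8 * rho)) 1 Hw ltac:(lra) ltac:(apply Rdiv_lt_0_compat; lra) ht) as [K [K0 hK]].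
  exists K. split; [exact K0|]. intros k. specialize (hK k).
  rewrite pow_1, hwE in hK. now replace (c / (8 * rho) * (2 * rho * E k)) with (c * E k / 4) in hK by (field; lra). }
destruct h4 as [K4 [K40 hK4]].
assert (hbound : forall i k, INR (fact i) * (1600 * 2 ^ S k / eps0) ^ i
    <= Mw w (3 * rho1) i * (exp (/ rho1) * exp (c * E k / 4))).
{ intros i k. pose proof (pow2_pos k) as h2k.
  set (beta := eps0 / (1600 * 2 ^ S k)).
  assert (hbeta : 0 < beta) by (unfold beta; apply Rdiv_lt_0_compat; [lra | simpl; lra]).
  replace (1600 * 2 ^ S k / eps0) with (/ beta) by (unfold beta; simpl; field; lra).
  eapply Rle_trans; [apply (fact_scale_bound w (s0 / 2 ^ k) (t k) beta rho1 i Hw Hc); auto|].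
  - pose proof (hsk k). lra.
  - replace (s0 / 2 ^ k / beta) with (3200 / kap * rho).
    + unfold rho1, C1. apply Rmult_le_compat_r; lra.
    + unfold beta, eps0. simpl. field. repeat split; lra.
  - apply Rmult_le_compat_l; [left; apply exp_pos|]. rewrite <- exp_plus. apply exp_le_mono.
    rewrite hwE. unfold Rdiv at 1. rewrite Rmult_plus_distr_r, Rmult_1_l.
    apply Rplus_le_compat_l. apply (Rle_div_l _ _ _ hrho1).
    assert (8 / c * rho <= rho1) by (unfold rho1, C1; apply Rmult_le_compat_r; lra).
    pose proof (hE k).
    apply Rle_trans with (c * E k / 4 * (8 / c * rho)); [right; field; lra|].
    apply Rmult_le_compat_l; [|assumption]. assert (0 <= c * E k) by nra. lra. }
set (K1 := 8 * (exp (/ rho1) * exp (c * E O / 4)) + 34 * exp (/ rho1) * 40 * 2 * K4).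
set (V := fun i => K1 * Mw w (3 * rho1) i / INR (fact i)).
exists (2 * K1).
assert (epos : forall x, 0 < exp x) by apply exp_pos.
assert (hfact : forall i, 0 < INR (fact i)) by (intros; apply lt_0_INR, lt_O_fact).
assert (hfin : bounded_derivs a' b' f (fun i => 2 * V i * INR (fact i))).
{ apply (bounded_derivs_of_approximation f eps0 l ltac:(lra) lmono hsup a' b' V).
  - intros x hx k.
    destruct (happ w rho (s0 / 2 ^ k) (t k) a b f Hw Hc hr (proj1 (hsk k)) (ht k)) with (x0 := x)
      as [m [F [F8 hF]]]; auto.
    + destruct (htk k); lra.
    + destruct (htk k) as [h _]. specialize (hT (t k) ltac:(lra)). unfold Rdiv. lra.
    + apply hE.
    + fold kap. assert (kap * (s0 / 2 ^ k) / rho <= eps0).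
      { unfold eps0, Rdiv. apply Rmult_le_compat_r; [left; now apply Rinv_0_lt_compat|].
        apply Rmult_le_compat_l; [lra|]. apply hsk. } lra.
    + fold kap. assert (kap * (s0 / 2 ^ k) / rho <= eps0).
      { unfold eps0, Rdiv. apply Rmult_le_compat_r; [left; now apply Rinv_0_lt_compat|].
        apply Rmult_le_compat_l; [lra|]. apply hsk. } lra.
    + fold kap in hF.
      exists m, (fun i => if Nat.ltb i m then F i else RtoC 0). split; [|split].
      * intros i. destruct (Nat.ltb i m); [apply F8 | rewrite Cmod_0; lra].
      * intros i hi. apply Nat.ltb_ge in hi. now rewrite hi.
      * intros y hy. eapply Rle_trans; [|apply hlow]. eapply Rle_trans; [|apply (hF y hy)].
        rewrite (psum_ext _ F); [|intros i hi; apply Nat.ltb_lt in hi; now rewrite hi].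
        replace (eps0 / 2 ^ k) with (kap * (s0 / 2 ^ k) / rho); [apply Rle_refl|].
        unfold eps0. pose proof (pow2_pos k). field. lra.
  - intros i. unfold V. apply le_div_of_mul_le; [apply hfact|].
    specialize (hbound i O).
    apply Rle_trans with (8 * (INR (fact i) * (1600 * 2 ^ 1 / eps0) ^ i)).
    + replace (8 * (1 / eps0) ^ i * INR (fact i)) with (8 * (INR (fact i) * (1 / eps0) ^ i)) by ring.
      apply Rmult_le_compat_l; [lra|]. apply Rmult_le_compat_l; [left; apply hfact|].
      apply pow_incr. split; [apply Rdiv_le_0_compat; lra|].
      unfold Rdiv. apply Rmult_le_compat_r; [left; now apply Rinv_0_lt_compat | lra].
    + apply Rle_trans with (8 * (Mw w (3 * rho1) i * (exp (/ rho1) * exp (c * E O / 4)))); [lra|].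
      unfold K1. pose proof (Mw_pos w (3 * rho1) i).
      assert (0 <= 34 * exp (/ rho1) * 40 * 2 * K4).
      { apply Rmult_le_pos; [|exact K40]. pose proof (epos (/ rho1)). lra. }
      assert (0 <= Mw w (3 * rho1) i * (34 * exp (/ rho1) * 40 * 2 * K4)) by (apply Rmult_le_pos; lra).
      lra.
  - intros i k. unfold increment_bound, V. apply le_div_of_mul_le; [apply pow2_pos|].
    apply le_div_of_mul_le; [apply hfact|].
    specialize (hbound i k). specialize (hup k). specialize (hK4 k).
    pose proof (pow2_pos k) as h2k. pose proof (Mw_pos w (3 * rho1) i) as hM.
    apply Rle_trans with (34 * (Mw w (3 * rho1) i * (exp (/ rho1) * exp (c * E k / 4)))
       * (40 * exp (- (c * E k / 2))) * 2 ^ S k).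
    + replace (34 * (1600 * 2 ^ S k / eps0) ^ i * (/ 40) ^ l k * 2 ^ S k * INR (fact i))
        with (34 * (INR (fact i) * (1600 * 2 ^ S k / eps0) ^ i) * (/ 40) ^ l k * 2 ^ S k) by ring.
      apply Rmult_le_compat_r; [left; apply pow2_pos|].
      apply Rmult_le_compat; [|apply pow_le; lra | lra | exact hup].
      apply Rmult_le_pos; [lra|]. apply Rmult_le_pos; [left; apply hfact|].
      apply pow_le, Rdiv_le_0_compat; [|lra]. pose proof (pow2_pos (S k)); lra.
    (* Half of the gain [exp (- c * E / 2)] cancels the loss [exp (c * E / 4)] coming from the
       factorial; the other half beats [2 ^ k]. *)
    + replace (exp (- (c * E k / 2))) with (exp (- (c * E k / 4)) * exp (- (c * E k / 4))).
      2:{ rewrite <- exp_plus. f_equal. field. }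
      assert (e1 : exp (c * E k / 4) * exp (- (c * E k / 4)) = 1).
      { rewrite <- exp_plus. replace (c * E k / 4 + - (c * E k / 4)) with 0 by ring. apply exp_0. }
      replace (34 * (Mw w (3 * rho1) i * (exp (/ rho1) * exp (c * E k / 4))) *
        (40 * (exp (- (c * E k / 4)) * exp (- (c * E k / 4)))) * 2 ^ S k)
      with (Mw w (3 * rho1) i * (34 * exp (/ rho1) * 40 * 2) *
        (exp (c * E k / 4) * exp (- (c * E k / 4))) * (2 ^ k * exp (- (c * E k / 4)))) by (simpl; ring).
      rewrite e1, Rmult_1_r.
      assert (hc2 : 0 <= Mw w (3 * rho1) i * (34 * exp (/ rho1) * 40 * 2)).
      { apply Rmult_le_pos; [lra|]. pose proof (epos (/ rho1)); lra. }
      apply Rle_trans with (Mw w (3 * rho1) i * (34 * exp (/ rho1) * 40 * 2) * K4).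
      { now apply Rmult_le_compat_l. }
      unfold K1.
      assert (0 <= Mw w (3 * rho1) i * (8 * (exp (/ rho1) * exp (c * E 0%nat / 4)))).
      { apply Rmult_le_pos; [lra|]. pose proof (epos (/ rho1)); pose proof (epos (c * E 0%nat / 4)). nra. }
      lra. }
destruct hfin as [g [h0 [h1 h2]]]. exists g. split; [exact h0 | split; [exact h1|]].
intros n x hx. eapply Rle_trans; [now apply h2|]. right. unfold V. field.
apply Rgt_not_eq, hfact.
Qed.

(** * From intervals to germs *)

Lemma is_derive_Cmult_real (c : R) (g : R -> C) x l : is_derive (V := C_R_NormedModule) g x l ->
  is_derive (V := C_R_NormedModule) (fun y => Cmult (RtoC c) (g y)) x (Cmult (RtoC c) l).
Proof.
intros h.
assert (e : forall z : C, Cmult (RtoC c) z = scal (V := C_R_NormedModule) c z).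
{ intros z. apply injective_projections; unfold scal; simpl; unfold prod_scal, scal; simpl; unfold mult; simpl; ring. }
apply (is_derive_ext (V := C_R_NormedModule) (fun y => scal (V := C_R_NormedModule) c (g y))).
{ intros y. symmetry. apply e. }
rewrite e. unfold is_derive.
refine (filterdiff_ext_lin (K := R_AbsRing) (U := AbsRing_NormedModule R_AbsRing) (V := C_R_NormedModule)
  (fun y => scal (V := C_R_NormedModule) c (g y))
  (fun y => scal (V := C_R_NormedModule) c (scal (V := C_R_NormedModule) y l)) _ _ _).
- apply (@filterdiff_comp' R_AbsRing (AbsRing_NormedModule R_AbsRing) C_R_NormedModule C_R_NormedModule g
    (fun z => scal (V := C_R_NormedModule) c z) x _ (fun z => scal (V := C_R_NormedModule) c z) h).
  apply filterdiff_linear. apply is_linear_scal_r. intros a b. apply Rmult_comm.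
- intros y. rewrite !scal_assoc. f_equal. apply Rmult_comm.
Qed.

Lemma bounded_derivs_scale a b u M c : 0 <= c ->
  bounded_derivs a b u M -> bounded_derivs a b (fun x => Cmult (RtoC c) (u x)) (fun n => c * M n).
Proof.
intros hc [g [h0 [h1 h2]]]. exists (fun n x => Cmult (RtoC c) (g n x)). split; [|split].
- intros x hx. now rewrite h0.
- intros n x hx. now apply is_derive_Cmult_real, h1.
- intros n x hx. rewrite Cmod_mult, Cmod_R, Rabs_right by lra. apply Rmult_le_compat_l; [exact hc | now apply h2].
Qed.

Lemma bounded_derivs_weaken a b u M u' M' :
  (forall x, u x = u' x) -> (forall n, M n <= M' n) -> bounded_derivs a b u M -> bounded_derivs a b u' M'.
Proof.
intros hu hM [g [h0 [h1 h2]]]. exists g. split; [|split; [exact h1|]].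
- intros x hx. now rewrite <- hu, h0.
- intros n x hx. eapply Rle_trans; [now apply h2 | apply hM].
Qed.

Lemma in_B_bounded_derivs w rho r u : 0 < rho -> in_B w rho (fun x => - r < x < r) u ->
  exists M, 0 <= M /\ bounded_derivs (- r) r u (fun n => M * Mw w rho n).
Proof.
intros hr [g [[h0 h1] [M hM]]]. exists (Rabs M). split; [apply Rabs_pos|].
exists g. split; [exact h0 | split; [exact h1|]].
intros n x hx. specialize (hM x n hx).
assert (e : Mw w rho n * exp (- phi_star w (rho * INR n) / rho) = 1).
{ unfold Mw. rewrite <- exp_plus. replace (_ + _) with 0 by (field; lra). apply exp_0. }
assert (hp : 0 < Mw w rho n) by apply exp_pos.
apply Rle_trans with (M * Mw w rho n); [|apply Rmult_le_compat_r; [lra | apply Rle_abs]].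
apply Rmult_le_compat_r with (r := Mw w rho n) in hM; [|lra].
rewrite Rmult_assoc, (Rmult_comm (exp _)), e, Rmult_1_r in hM. exact hM.
Qed.

Lemma bounded_derivs_in_B w rho rho' r u K (V : R -> Prop) : weight_function w -> 0 < rho <= rho' -> 0 <= K ->
  (forall x, V x -> - r < x < r) ->
  bounded_derivs (- r) r u (fun n => K * Mw w rho n) -> in_B w rho' V u.
Proof.
intros Hw hr hK hV [g [h0 [h1 h2]]]. exists g. split; [split; auto|].
exists K. intros x n hx. specialize (h2 n x (hV x hx)).
assert (e : Mw w rho' n * exp (- phi_star w (rho' * INR n) / rho') = 1).
{ unfold Mw. rewrite <- exp_plus. replace (_ + _) with 0 by (field; lra). apply exp_0. }
pose proof (Mw_mono w Hw rho rho' n ltac:(lra) ltac:(lra)).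
apply Rle_trans with (K * Mw w rho' n * exp (- phi_star w (rho' * INR n) / rho')).
- apply Rmult_le_compat_r; [left; apply exp_pos|]. eapply Rle_trans; [exact h2|].
  now apply Rmult_le_compat_l.
- rewrite Rmult_assoc, e. lra.
Qed.

(* Dividing [f] by a large constant makes the constants in both hypotheses 1. *)
Lemma local_root j : (1 <= j)%nat -> exists C0, 0 < C0 /\
  forall w rho rho' r f (V : R -> Prop), weight_function w -> concave_nonneg w -> 0 < rho -> 0 < r ->
  C0 * rho <= rho' -> (forall x, V x -> - r < x < r) ->
  in_B w rho (fun x => - (2 * r) < x < 2 * r) (fun x => Cpow (f x) j) ->
  in_B w rho (fun x => - (2 * r) < x < 2 * r) (fun x => Cpow (f x) (S j)) ->
  in_B w rho' V f.
Proof.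
intros hj. destruct (quantitative_root j hj) as [C0 [hC0 hroot]].
exists C0. split; [exact hC0|]. intros w rho rho' r f V Hw Hc hr hr0 hrho hV hg hh.
destruct (in_B_bounded_derivs w rho (2 * r) _ hr hg) as [M1 [M10 b1]].
destruct (in_B_bounded_derivs w rho (2 * r) _ hr hh) as [M2 [M20 b2]].
set (lam := 1 + M1 + M2). assert (hlam : 1 <= lam) by (unfold lam; lra).
assert (hlam0 : 0 < / lam) by (apply Rinv_0_lt_compat; lra).
assert (hpow : forall i M, (1 <= i)%nat -> 0 <= M <= lam -> (/ lam) ^ i * M <= 1).
{ intros i M hi hM. destruct i as [|i]; [lia|].
  rewrite pow_inv. rewrite Rmult_comm. apply Rle_div_l; [apply pow_lt; lra|].
  rewrite Rmult_1_l. simpl. pose proof (pow_R1_Rle lam i hlam). nra. }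
assert (hpos : forall i, 0 <= (/ lam) ^ i) by (intros; apply pow_le; lra).
assert (hsc : forall i, forall x, Cmult (RtoC ((/ lam) ^ i)) (Cpow (f x) i) = Cpow (Cmult (RtoC (/ lam)) (f x)) i).
{ intros i x. rewrite Cpow_mult_l. f_equal. clear. induction i as [|i IH]; [reflexivity|].
  simpl. now rewrite RtoC_mult, IH. }
assert (c1 : bounded_derivs (- (2 * r)) (2 * r) (fun x => Cpow (Cmult (RtoC (/ lam)) (f x)) j) (Mw w rho)).
{ apply (bounded_derivs_weaken _ _ _ _ _ _ (hsc j)) with (2 := bounded_derivs_scale _ _ _ _ _ (hpos j) b1).
  intros n. cbv beta. rewrite <- Rmult_assoc. pose proof (hpow j M1 hj ltac:(unfold lam; lra)).
  pose proof (Mw_pos w rho n). nra. }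
assert (c2 : bounded_derivs (- (2 * r)) (2 * r) (fun x => Cpow (Cmult (RtoC (/ lam)) (f x)) (S j)) (Mw w rho)).
{ apply (bounded_derivs_weaken _ _ _ _ _ _ (hsc (S j))) with (2 := bounded_derivs_scale _ _ _ _ _ (hpos (S j)) b2).
  intros n. cbv beta. rewrite <- Rmult_assoc. pose proof (hpow (S j) M2 ltac:(lia) ltac:(unfold lam; lra)).
  pose proof (Mw_pos w rho n). nra. }
destruct (hroot w rho _ _ _ Hw Hc hr c1 c2 (- r) r ltac:(lra) ltac:(lra)) as [K hK].
apply (bounded_derivs_scale _ _ _ _ lam ltac:(lra)) in hK.
apply (bounded_derivs_in_B w (C0 * rho) rho' r f (lam * Rabs K) V Hw); auto.
- split; [nra | exact hrho].
- apply Rmult_le_pos; [lra | apply Rabs_pos].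
- revert hK. apply bounded_derivs_weaken.
  + intros x. rewrite Cmult_assoc, <- RtoC_mult, Rinv_r by lra. apply Cmult_1_l.
  + intros n. cbv beta. rewrite Rmult_assoc. apply Rmult_le_compat_l; [lra|].
    apply Rmult_le_compat_r; [left; apply Mw_pos | apply Rle_abs].
Qed.

Lemma open_interval r : open_set (fun x => - r < x < r).
Proof.
intros x hx. assert (hd : 0 < Rmin (x + r) (r - x)) by (apply Rmin_pos; lra).
exists (mkposreal _ hd). intros y hy. unfold disc in hy. simpl in hy.
pose proof (Rmin_l (x + r) (r - x)). pose proof (Rmin_r (x + r) (r - x)).
apply Rabs_lt_between in hy. lra.
Qed.

Lemma adherence_interval r x : adherence (fun y => - r < y < r) x -> - r <= x <= r.
Proof.
intros h. apply NNPP. intros hn.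
set (d := Rmax (x - r) (- r - x)).
assert (hd : 0 < d).
{ unfold d. destruct (Rle_lt_dec x r); [eapply Rlt_le_trans; [|apply Rmax_r]; lra | eapply Rlt_le_trans; [|apply Rmax_l]; lra]. }
destruct (h (disc x (mkposreal d hd))) as [y [h1 h2]].
{ exists (mkposreal d hd). intros y hy. exact hy. }
unfold disc in h1. simpl in h1. unfold d, Rmax in *. apply Rabs_lt_between in h1.
destruct (Rle_dec (x - r) (- r - x)); lra.
Qed.

Lemma relcomp_interval r (U : R -> Prop) : (forall x, - r <= x <= r -> U x) ->
  relcomp_open_in (fun x => - r < x < r) U.
Proof.
intros hU. split; [apply open_interval | split].
- apply compact_P5; [apply adherence_P3|]. exists (- r), r. intros x hx. now apply adherence_interval.
- intros x hx. now apply hU, adherence_interval.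
Qed.

Lemma common_interval (U1 U2 : R -> Prop) : open_set U1 -> open_set U2 -> U1 0 -> U2 0 ->
  exists r, 0 < r /\ (forall x, - (2 * r) <= x <= 2 * r -> U1 x) /\
    (forall x, - (2 * r) <= x <= 2 * r -> U2 x).
Proof.
intros o1 o2 h1 h2. destruct (o1 0 h1) as [d1 i1]. destruct (o2 0 h2) as [d2 i2].
exists (Rmin d1 d2 / 4).
assert (hm : 0 < Rmin d1 d2) by (apply Rmin_pos; [apply d1 | apply d2]).
pose proof (Rmin_l d1 d2). pose proof (Rmin_r d1 d2).
split; [lra|]. split; intros x hx; [apply i1 | apply i2]; unfold disc; apply Rabs_lt_between; lra.
Qed.

Lemma exists_nat_above x : exists n, (1 <= n)%nat /\ x <= INR n.
Proof.
destruct (nfloor_ex (Rmax 0 x) (Rmax_l 0 x)) as [n hn]. exists (S n). split; [lia|].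
rewrite S_INR. pose proof (Rmax_r 0 x). lra.
Qed.

Lemma in_B_mono w rho rho' V u : weight_function w -> 0 < rho <= rho' -> in_B w rho V u -> in_B w rho' V u.
Proof.
intros Hw hr [g [hg [M hM]]]. exists g. split; [exact hg|]. exists (Rabs M).
intros x n hx. specialize (hM x n hx).
apply Rle_trans with (Cmod (g n x) * exp (- phi_star w (rho * INR n) / rho)).
2:{ eapply Rle_trans; [exact hM | apply Rle_abs]. }
apply Rmult_le_compat_l; [apply Cmod_ge_0|].
pose proof (Mw_mono w Hw rho rho' n ltac:(lra) ltac:(lra)) as h. unfold Mw in h.
replace (- phi_star w (rho' * INR n) / rho') with (- (phi_star w (rho' * INR n) / rho')) by (field; lra).
replace (- phi_star w (rho * INR n) / rho) with (- (phi_star w (rho * INR n) / rho)) by (field; lra).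
rewrite !exp_Ropp. apply Rinv_le_contravar; [apply exp_pos | exact h].
Qed.

Theorem theorem3p1 (w : R -> R) (Hw : weight_function w) (Hc : concave_nonneg w) :
  propD (germ_roum w) /\ propD (germ_beur w).
Proof.
split; intros f j hj [U1 [o1 [z1 [_ e1]]]] [U2 [o2 [z2 [_ e2]]]];
  destruct (common_interval U1 U2 o1 o2 z1 z2) as [r [hr [i1 i2]]];
  destruct (local_root j hj) as [C0 [hC0 hroot]];
  pose proof (relcomp_interval (2 * r) U1 i1) as rc1; pose proof (relcomp_interval (2 * r) U2 i2) as rc2;
  exists (fun x => - r < x < r); (split; [apply open_interval | split; [lra|]]).
- destruct (e1 _ rc1) as [n1 [hn1 b1]]. destruct (e2 _ rc2) as [n2 [hn2 b2]].
  assert (p1 : 0 < INR n1) by (apply lt_0_INR; lia).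
  assert (p2 : 0 < INR n2) by (apply lt_0_INR; lia).
  (* The classes increase with [rho], so both powers are brought to a common parameter. *)
  set (rho := INR n1 + INR n2).
  apply (in_B_mono w (INR n1) rho _ _ Hw) in b1; [|unfold rho; lra].
  apply (in_B_mono w (INR n2) rho _ _ Hw) in b2; [|unfold rho; lra].
  destruct (exists_nat_above (C0 * rho)) as [n [hn hnr]].
  assert (hB : forall V : R -> Prop, (forall x, V x -> - r < x < r) -> in_B w (INR n) V f).
  { intros V hV. apply (hroot w rho (INR n) r f V); auto. unfold rho; lra. }
  split.
  + destruct (hB (fun x => - r < x < r) (fun x hx => hx)) as [g [hg _]]. now exists g.
  + intros V [_ [_ hV]]. exists n. split; [exact hn|]. apply hB. intros x hx. apply hV. now apply adherence_P1.
- assert (hB : forall n (V : R -> Prop), (1 <= n)%nat -> (forall x, V x -> - r < x < r) -> in_B w (/ INR n) V f).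
  (* To obtain the parameter [1 / n], the hypotheses are used at [1 / N] with [N >= C0 * n], which
     absorbs the constant. *)
  { intros n V hn hV. destruct (exists_nat_above (C0 * INR n)) as [N [hN hNr]].
    assert (p1 : 0 < INR n) by (apply lt_0_INR; lia).
    assert (p2 : 0 < INR N) by (apply lt_0_INR; lia).
    apply (hroot w (/ INR N) (/ INR n) r f V); auto.
    - now apply Rinv_0_lt_compat.
    - apply Rmult_le_reg_r with (INR N * INR n); [now apply Rmult_lt_0_compat|].
      replace (C0 * / INR N * (INR N * INR n)) with (C0 * INR n) by (field; lra).
      replace (/ INR n * (INR N * INR n)) with (INR N) by (field; lra). exact hNr. }
  split.
  + destruct (hB 1%nat (fun x => - r < x < r) (Nat.le_refl 1) (fun x hx => hx)) as [g [hg _]]. now exists g.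
  + intros V [_ [_ hV]] n hn. apply hB; [exact hn|]. intros x hx. apply hV. now apply adherence_P1.
Qed.
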